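(* Let $\mathfrak g$ be a complex semisimple Lie algebra with adjoint group $G$. Every spherical nilpotent adjoint orbit $O$ of $G$ in $\mathfrak g$ is conormal. That is, there exists $x\in O$ and a Lie subalgebra $\mathfrak s_O$ of $\mathfrak g$ such that $\mathfrak g=\mathfrak g^x\oplus\mathfrak s_O$.
   Context: A nilpotent $G$-orbit $O$ is spherical if, for a Borel subgroup $B$ of $G$, $O$ contains a dense $B$-orbit. A nilpotent orbit is called conormal if the centralizer $\mathfrak g^x$ of some (equivalently, any) element $x\in O$ admits a complementary subspace in $\mathfrak g$ that is a Lie subalgebra. *)

(* Defs.v *)
(* Finite-dimensional Lie algebras are encoded concretely
   as K^n = 'rV[K]_n with a bracket; subspaces are row spaces of matrices. *)
From HB Require Import structures.
From mathcomp Require Import all_boot all_order all_algebra.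
From mathcomp Require Import reals complex.
Set Implicit Arguments. Unset Strict Implicit. Unset Printing Implicit Defensive.
Import Order.TTheory GRing.Theory Num.Theory.
Local Open Scope ring_scope.

Section LieDefs.
Variable K : fieldType.
Variable n : nat.
Notation vec := 'rV[K]_n.

Definition is_lie_bracket (br : vec -> vec -> vec) : Prop :=
  [/\ (forall (a : K) u v w, br (a *: u + v) w = a *: br u w + br v w),
      (forall (a : K) u v w, br u (a *: v + w) = a *: br u v + br u w),
      (forall u, br u u = 0) &
      (forall u v w, br u (br v w) + br v (br w u) + br w (br u v) = 0)].

Definition ad (br : vec -> vec -> vec) (x : vec) : 'M[K]_n := lin1_mx (br x).

Definition lie_subalgebra (br : vec -> vec -> vec) (S : 'M[K]_n) : Prop :=
  forall u v : vec, (u <= S)%MS -> (v <= S)%MS -> (br u v <= S)%MS.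
Definition lie_ideal (br : vec -> vec -> vec) (I : 'M[K]_n) : Prop :=
  forall u v : vec, (v <= I)%MS -> (br u v <= I)%MS.

Definition lie_derived (br : vec -> vec -> vec) (S : 'M[K]_n) : 'M[K]_n :=
  (\sum_(i < n) \sum_(j < n) <<br (row i S) (row j S)>>)%MS.
Definition lie_solvable (br : vec -> vec -> vec) (S : 'M[K]_n) : Prop :=
  exists k, (iter k (lie_derived br) S <= (0 : 'M[K]_n))%MS.

Definition semisimple (br : vec -> vec -> vec) : Prop :=
  forall I : 'M[K]_n, lie_ideal br I -> lie_solvable br I -> (I <= (0 : 'M[K]_n))%MS.

Definition ad_nilpotent (br : vec -> vec -> vec) (x : vec) : Prop :=
  exists k, ad br x ^+ k = 0.

(* exponential of a matrix, exact for nilpotent n x n matrices *)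
Definition expm (A : 'M[K]_n) : 'M[K]_n :=
  \sum_(k < n.+1) (k`!%:R)^-1 *: A ^+ k.

Definition adjoint_group (br : vec -> vec -> vec) (g : 'M[K]_n) : Prop :=
  exists s : seq vec, (forall x, x \in s -> ad_nilpotent br x) /\
                      g = \prod_(x <- s) expm (ad br x).

Definition orbit_by (H : 'M[K]_n -> Prop) (x : vec) (v : vec) : Prop :=
  exists g, H g /\ v = x *m g.

Inductive pexpr (I : Type) :=
  | PConst of K | PVar of I | PAdd of pexpr I & pexpr I | PMul of pexpr I & pexpr I.

Fixpoint peval (I : Type) (f : I -> K) (p : pexpr I) : K :=
  match p with
  | PConst c => c
  | PVar i => f i
  | PAdd p q => peval f p + peval f q
  | PMul p q => peval f p * peval f q
  end.

Definition zclosed (T I : Type) (coord : T -> I -> K) (Z : T -> Prop) : Prop :=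
  exists P : pexpr I -> Prop,
    forall t, Z t <-> (forall p, P p -> peval (coord t) p = 0).

Definition rel_closed (T I : Type) (coord : T -> I -> K) (Y Z : T -> Prop) : Prop :=
  (forall t, Z t -> Y t) /\
  exists C, zclosed coord C /\ forall t, Z t <-> (Y t /\ C t).

Definition zdense_in (T I : Type) (coord : T -> I -> K) (Y Z : T -> Prop) : Prop :=
  (forall t, Z t -> Y t) /\
  forall C, zclosed coord C -> (forall t, Z t -> C t) -> forall t, Y t -> C t.

Definition zconnected (T I : Type) (coord : T -> I -> K) (Y : T -> Prop) : Prop :=
  forall Z1 Z2, rel_closed coord Y Z1 -> rel_closed coord Y Z2 ->
    (forall t, Y t <-> (Z1 t \/ Z2 t)) -> (forall t, ~ (Z1 t /\ Z2 t)) ->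
    (forall t, ~ Z1 t) \/ (forall t, ~ Z2 t).

Definition vcoord (v : vec) (i : 'I_n) : K := v 0 i.
Definition mcoord (A : 'M[K]_n) (ij : 'I_n * 'I_n) : K := A ij.1 ij.2.

Definition subgroup_of (G H : 'M[K]_n -> Prop) : Prop :=
  [/\ forall g, H g -> G g, H 1%:M,
      forall a b, H a -> H b -> H (a *m b) &
      forall a, H a -> H (invmx a)].

Definition derived_group (H : 'M[K]_n -> Prop) (g : 'M[K]_n) : Prop :=
  exists s : seq ('M[K]_n * 'M[K]_n),
    (forall p, p \in s -> H p.1 /\ H p.2) /\
    g = \prod_(p <- s) (p.1 * p.2 * invmx p.1 * invmx p.2).

Definition solvable_group (H : 'M[K]_n -> Prop) : Prop :=
  exists k, forall g, iter k derived_group H g -> g = 1%:M.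

Definition borel_subgroup (G B : 'M[K]_n -> Prop) : Prop :=
  [/\ subgroup_of G B, rel_closed mcoord G B, zconnected mcoord B,
      solvable_group B &
      forall B', subgroup_of G B' -> rel_closed mcoord G B' ->
        zconnected mcoord B' -> solvable_group B' ->
        (forall g, B g -> B' g) -> forall g, B' g -> B g].

Definition spherical (br : vec -> vec -> vec) (O : vec -> Prop) : Prop :=
  exists B, borel_subgroup (adjoint_group br) B /\
    exists y, O y /\ zdense_in vcoord O (orbit_by B y).

Definition conormal (br : vec -> vec -> vec) (O : vec -> Prop) : Prop :=
  exists x, O x /\ exists S : 'M[K]_n,
    lie_subalgebra br S /\
    (kermx (ad br x) + S == 1%:M)%MS /\ (kermx (ad br x) :&: S == (0 : 'M[K]_n))%MS.

End LieDefs.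

(* Main.v *)
(* Let [O] be the orbit, [B] the given connected solvable group and [y] in [O] with
   [B]-orbit dense in [O].  By the Lie-Kolchin theorem [B] is triangular in some
   basis; the elements [u] with [ad u] triangular in that basis form a solvable
   subalgebra [b], by Cartan's criterion.  Density gives [[b, y] = [g, y]], that is
   [b + g^y = g].  This is obtained without tangent spaces: an ultrapower [L] of [K]
   along an ultrafilter of generic points of [B] contains a generic element [g];
   for [x] nilpotent, differentiation along the vector field [w |-> [x, w]] is a
   derivation [D] of the coordinate ring of [O], which embeds in [L], and it extends
   to the entries of [g].  Then [D(g) g^-1] is a derivation of the Lie algebra over
   [L] that is triangular in the same basis, hence an [L]-combination of elements
   of [ad b], and its value at [y] is [[x, y]] up to conjugation by [g].

   Enlarge [b] to a maximal solvable subalgebra and take a basis [e_i] made of root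
   vectors and of a basis of a Cartan subalgebra, with a real grading [delta] that
   is injective on roots and nonnegative on [b].  Put [h = g^y].  Since [b + h] is
   everything, each [e_i] of negative degree is the leading (lowest) term of an
   element of [h], and this makes the span of the [e_i] that are not leading terms
   of elements of [h] a subalgebra; it is complementary to [h]. *)
Require Import Defs.
From HB Require Import structures.
From mathcomp Require Import all_boot all_order all_algebra.
From mathcomp Require Import reals complex.
From mathcomp Require Import boolp classical_sets filter ring zify.
Set Implicit Arguments. Unset Strict Implicit. Unset Printing Implicit Defensive.
Import Order.TTheory GRing.Theory Num.Theory.
Local Open Scope ring_scope.

(** The group [B] comes only with its Zariski topology and has no Lie algebra at hand; [b] stands in
    for it and may be larger, which is harmless because all that is needed is a solvable subalgebra
    with [b + g^y = g]. In [L] a generic element of [B] and the coordinate functions of [O] live in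
    one field, and equality in [L] of two polynomial functions of [y g] means equality on all of
    [O]. Extending [D] to the entries of [g] may involve arbitrary choices, but every choice yields
    a triangular derivation, and only its value at [y] matters. The scalars carry a conjugation and
    a partial order. Conjugation replaces the rational functionals on eigenvalues in Cartan's
    criterion: a vanishing trace becomes a vanishing sum of [|a|^2]. The order is used on the
    grading, whose values are real. Quotient modules never appear: the theorems of Lie and
    Lie-Kolchin are about two stable subspaces [A <= B] and eigenvectors modulo [A]. Matrices act on
    rows from the right, so products are read in the order of application. *)

Section Subspaces.

(** * Row spaces as subspaces, flags and triangular form *)

Variables (K : fieldType) (n : nat).
Implicit Types (A B M : 'M[K]_n) (u v w : 'rV[K]_n).

Lemma exists_max_rank (P : 'M[K]_n -> Prop) M :
  P M -> exists2 M', P M' & forall M'', P M'' -> (\rank M'' <= \rank M')%N.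
Proof.
move=> PM; pose Q r := `[<exists2 A, P A & \rank A = r>].
have exQ : exists r, Q r by exists (\rank M); apply/asboolP; exists M.
have ubQ r : Q r -> (r <= n)%N by move=> /asboolP[A _ <-]; apply: rank_leq_row.
have [r /asboolP[A PA rA] mx] := ex_maxnP exQ ubQ.
by exists A => // B PB; rewrite rA; apply: mx; apply/asboolP; exists B.
Qed.

Lemma exists_min_rank (P : 'M[K]_n -> Prop) M :
  P M -> exists2 M', P M' & forall M'', P M'' -> (\rank M' <= \rank M'')%N.
Proof.
move=> PM; pose Q r := `[<exists2 A, P A & \rank A = r>].
have exQ : exists r, Q r by exists (\rank M); apply/asboolP; exists M.
have [r /asboolP[A PA rA] mn] := ex_minnP exQ.
by exists A => // B PB; rewrite rA; apply: mn; apply/asboolP; exists B.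
Qed.

Lemma sub_adds_rowP A w v :
  reflect (exists a u, (u <= A)%MS /\ v = u + a *: w) (v <= A + w)%MS.
Proof.
apply: (iffP idP) => [/sub_addsmxP[[u1 u2] /= ->]|[a [u [uA ->]]]]; last first.
  by apply: addmx_sub_adds => //; apply: scalemx_sub.
exists (u2 0 0), (u1 *m A); rewrite submxMl; split => //; congr (_ + _).
by rewrite [u2]mx11_scalar mul_scalar_mx mxE eqxx.
Qed.

Lemma rank_adds_row A w : ~~ (w <= A)%MS -> (\rank A < \rank (A + w)%MS)%N.
Proof. by move=> wA; rewrite rank_ltmx// ltmxE addsmxSl addsmx_sub submx_refl. Qed.

(** A matrix of maximal rank with row space inside [Q] exhausts [Q], since a further vector of [Q]
    would raise the rank. Later subspaces given by linear conditions are turned into matrices this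
    way. *)
Lemma subspace_mx (Q : 'rV[K]_n -> Prop) :
  Q 0 -> (forall a u v, Q u -> Q v -> Q (a *: u + v)) ->
  exists M : 'M[K]_n, forall v, (v <= M)%MS <-> Q v.
Proof.
move=> Q0 Qlin.
have [|M QM maxM] := @exists_max_rank (fun M => forall v, (v <= M)%MS -> Q v) 0.
  by move=> v; rewrite submx0 => /eqP->.
exists M => v; split; first exact: QM.
move=> Qv; apply/negP => /negP vM.
have := rank_adds_row vM; rewrite ltnNge -(mxrank_gen (M + v)%MS) maxM//.
by move=> w; rewrite genmxE => /sub_adds_rowP[a [u [uM ->]]]; rewrite addrC; apply: Qlin => //; apply: QM.
Qed.

Lemma row_ext_sub m (A' : 'M[K]_(m, n)) B :
  (forall v, (v <= A')%MS -> (v <= B)%MS) -> (A' <= B)%MS.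
Proof. by move=> AB; apply/row_subP => i; apply: AB; apply: row_sub. Qed.

Definition stable_under (F : 'M[K]_n -> Prop) A :=
  forall f v, F f -> (v <= A)%MS -> (v *m f <= A)%MS.

(** The class of [w] in the quotient by [A] is a common eigenvector; the eigenvalue may depend on
    [f]. *)
Definition eig_mod (F : 'M[K]_n -> Prop) A w :=
  forall f, F f -> exists a, (w *m f - a *: w <= A)%MS.

(** A stable subspace is enlarged by one eigenvector modulo itself at a time. The rows of [P] form a
    basis adapted to the resulting flag, and stability of the span of the first rows means lower
    triangular form. *)
Lemma trig_of_flags (F : 'M[K]_n -> Prop) :
  (forall A, stable_under F A -> ~~ (1%:M <= A)%MS ->
     exists2 w, ~~ (w <= A)%MS & eig_mod F A w) ->
  exists2 P, P \in unitmx & forall f, F f -> is_trig_mx (P *m f *m invmx P).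
Proof.
move=> eigF.
(* The number of rows is a variable [m] with an equation [m = k], so that [m + 1] rows can be
   stacked without casts; the equation is eliminated at the end. *)
have /(_ n (leqnn n)) [m [mn [M [Mfree MT]]]] : forall k, (k <= n)%N ->
    exists m, m = k /\ exists M : 'M[K]_(m, n), row_free M /\
    forall f, F f -> exists2 T : 'M_m, is_trig_mx T & M *m f = T *m M.
  elim=> [_|k IHk kn].
    exists 0%N; split=> //; exists 0; split; first by rewrite /row_free mxrank0.
    by move=> f _; exists 0; rewrite ?mx0_is_trig//; apply/matrixP => -[].
  have [m [mk [M [Mfree MT]]]] := IHk (ltnW kn).
  have stM : stable_under F <<M>>%MS.
    move=> f v Ff; rewrite !genmxE => /submxP[D ->]; have [T _ eqT] := MT f Ff.
    by rewrite -mulmxA eqT mulmxA submxMl.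
  have nfM : ~~ (1%:M <= <<M>>)%MS.
    by apply/negP => /mxrankS; rewrite mxrank1 mxrank_gen (eqP Mfree) mk leqNgt kn.
  have [w wM eigw] := eigF _ stM nfM; rewrite genmxE in wM.
  exists (m + 1)%N; split; first by rewrite addn1 mk.
  exists (col_mx M w); split.
    have w0 : w != 0 by apply: contraNneq wM => ->; rewrite sub0mx.
    rewrite /row_free -addsmxE mxrank_disjoint_sum ?rank_rV ?w0 ?(eqP Mfree)//.
    apply/eqP; rewrite -mxrank_eq0; apply/negPn/negP => c0.
    have : (M :&: w :=: w)%MS.
      apply/eqmxP; rewrite -(mxrank_leqif_eq (capmxSr _ _)) eqn_leq mxrankS ?capmxSr//=.
      by rewrite rank_rV w0 lt0n.
    by move=> e; rewrite -e capmxSl in wM.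
  move=> f Ff; have [T Ttrig eqT] := MT f Ff; have [a] := eigw f Ff.
  rewrite genmxE => /submxP[D eqD].
  exists (block_mx T 0 D a%:M); first by rewrite is_trig_block_mx// eqxx Ttrig/= mx11_is_trig.
  rewrite mul_col_mx eqT mul_block_col mul0mx addr0; congr (col_mx _ _).
  by rewrite mul_scalar_mx -eqD subrK.
subst m; have uM : M \in unitmx by rewrite -row_free_unit.
by exists M => // f /MT[T tT ->]; rewrite mulmxK.
Qed.

Lemma trig_mul (A B : 'M[K]_n) : is_trig_mx A -> is_trig_mx B -> is_trig_mx (A *m B).
Proof.
move=> /is_trig_mxP tA /is_trig_mxP tB; apply/is_trig_mxP => i j ij; rewrite !mxE.
apply: big1 => k _; case: (ltnP i k) => ik; first by rewrite tA ?mul0r.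
by rewrite tB ?mulr0//; apply: leq_ltn_trans ij.
Qed.

Lemma trig_mul_diag (A B : 'M[K]_n) i :
  is_trig_mx A -> is_trig_mx B -> (A *m B) i i = A i i * B i i.
Proof.
move=> /is_trig_mxP tA /is_trig_mxP tB; rewrite !mxE (bigD1 i)//= big1 ?addr0// => k.
rewrite neq_ltn => /orP[ki|ik]; first by rewrite tB ?mulr0.
by rewrite tA ?mul0r.
Qed.

End Subspaces.

(** * Polynomials in a matrix and generalized eigenspaces *)

Lemma not_eigenvalue_unit (K : fieldType) n (X : 'M[K]_n) a :
  ~~ eigenvalue X a -> X - a%:M \in unitmx.
Proof.
rewrite -row_free_unit -kermx_eq0 => na; apply/rowV0P => u /sub_kermxP ua.
apply/eqP; apply: contraNT na => u0; apply/eigenvalueP; exists u => //.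
by move/eqP: ua; rewrite mulmxBr mul_mx_scalar subr_eq0 => /eqP.
Qed.

Lemma conj_unitK (K : fieldType) n (P A B : 'M[K]_n) : P \in unitmx ->
  P *m A *m invmx P *m (P *m B *m invmx P) = P *m (A *m B) *m invmx P.
Proof. by move=> uP; rewrite !mulmxA mulmxKV. Qed.

Lemma mxtrace_conj_unit (K : fieldType) n (P A : 'M[K]_n) : P \in unitmx ->
  \tr (P *m A *m invmx P) = \tr A.
Proof. by move=> uP; rewrite mxtrace_mulC !mulmxA mulVmx// mul1mx. Qed.

Lemma char_poly_conj_unit (K : fieldType) n (P A : 'M[K]_n) : P \in unitmx ->
  char_poly (P *m A *m invmx P) = char_poly A.
Proof.
move=> uP; rewrite /char_poly /char_poly_mx !map_mxM /= map_invmx.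
have uP' : map_mx polyC P \in unitmx.
  by rewrite unitmxE det_map_mx rmorph_unit.
have -> : 'X%:M - map_mx polyC P *m map_mx polyC A *m invmx (map_mx polyC P)
  = map_mx polyC P *m ('X%:M - map_mx polyC A) *m invmx (map_mx polyC P).
  by rewrite mulmxBr mulmxBl scalar_mxC mulmxK.
by rewrite !det_mulmx mulrC mulrA -det_mulmx mulVmx// det1 mul1r.
Qed.

Section PolyPart.
Variables (K : closedFieldType) (n' : nat).
Local Notation n := n'.+1.
Implicit Types (X : 'M[K]_n) (v : 'rV[K]_n).

Lemma char_poly_split X : exists rs : seq K, char_poly X = \prod_(a <- rs) ('X - a%:P).
Proof.
have [rs ->] := closed_field_poly_normal (char_poly X); exists rs.
by rewrite (monicP (char_poly_monic X)) scale1r.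
Qed.

(** The linear factors of the characteristic polynomial are applied to a vector outside [A] one
    after another. By Cayley-Hamilton the result ends in [A]; the vector just before the first
    factor that leads into [A] is the required one. *)
Lemma eig_quot X (A B : 'M[K]_n) : (forall v, (v <= B)%MS -> (v *m X <= B)%MS) ->
  ~~ (B <= A)%MS ->
  exists (w : 'rV[K]_n) a, [/\ (w <= B)%MS, ~~ (w <= A)%MS & (w *m X - a *: w <= A)%MS].
Proof.
move=> stB nBA.
have [v vB vA] : exists2 v : 'rV[K]_n, (v <= B)%MS & ~~ (v <= A)%MS.
  by have /row_subPn[i ?] := nBA; exists (row i B) => //; apply: row_sub.
have [rs cp] := char_poly_split X.
have : (v *m horner_mx X (\prod_(a <- rs) ('X - a%:P)) <= A)%MS.
  by rewrite -cp Cayley_Hamilton mulmx0 sub0mx.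
elim: rs v vB vA {cp} => [|a rs IH] v vB vA.
  by rewrite big_nil rmorph1 mulmx1 (negPf vA).
have e : v *m horner_mx X ('X - a%:P) = v *m X - a *: v.
  by rewrite rmorphB /= horner_mx_X horner_mx_C mulmxBr mul_mx_scalar.
rewrite big_cons rmorphM mulmxA e; case: (boolP (v *m X - a *: v <= A)%MS) => [wA _|wA].
  by exists v, a.
by apply: IH => //; rewrite addmx_sub ?stB// eqmx_opp scalemx_sub.
Qed.

Lemma trig_single X : exists2 P, P \in unitmx & is_trig_mx (P *m X *m invmx P).
Proof.
have [|P uP tP] := @trig_of_flags K n (eq X).
  move=> A stA nA; have [|w [a [_ wA wX]]] := @eig_quot X A 1%:M _ nA.
    by move=> v _; rewrite submx1.
  by exists w => // f <-; exists a.
by exists P => //; apply: tP.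
Qed.

Lemma nilp_char_poly X k : X ^+ k = 0 -> char_poly X = 'X^n.
Proof.
move=> Xk; have [rs cp] := char_poly_split X.
have r0 a : a \in rs -> a = 0.
  move=> ars; have : root (char_poly X) a by rewrite cp root_prod_XsubC.
  rewrite -eigenvalue_root_char => /eigenvalueP[v vX v0].
  have e j : v *m X ^+ j = a ^+ j *: v.
    elim: j => [|j IH]; first by rewrite !expr0 mulmx1 scale1r.
    by rewrite exprSr mulmxA IH -scalemxAl vX scalerA -exprSr.
  have := e k; rewrite Xk mulmx0 => /esym/eqP; rewrite scaler_eq0 (negPf v0) orbF.
  by rewrite expf_eq0 => /andP[_ /eqP].
have -> : char_poly X = 'X^(size rs).
  rewrite cp; elim: rs r0 {cp} => [|a rs IH] r0; first by rewrite big_nil.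
  rewrite big_cons IH => [|b brs]; last by apply: r0; rewrite inE brs orbT.
  by rewrite (r0 a) ?mem_head// subr0 exprS.
congr ('X^_); apply: succn_inj.
by rewrite -(size_char_poly X) cp size_prod_XsubC.
Qed.

Lemma nilp_exp X k : X ^+ k = 0 -> X ^+ n = 0.
Proof.
by move=> /nilp_char_poly cp; rewrite -[RHS](Cayley_Hamilton X) cp rmorphXn/= horner_mx_X.
Qed.

(** The characteristic polynomial is ['X^n]; its value at -1 is, up to the sign [(-1)^n], the
    determinant of [1 + X]. *)
Lemma nilp_det X k : X ^+ k = 0 -> \det (1 + X) = 1.
Proof.
move=> /nilp_char_poly cp; have := congr1 (fun p => p.[-1]) cp.
rewrite /= hornerXn /char_poly -horner_evalE -det_map_mx.
have -> : map_mx (horner_eval (-1)) (char_poly_mx X) = - (1 + X).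
  apply/matrixP => i j; rewrite !mxE horner_evalE hornerD hornerN hornerC hornerMn hornerX.
  by rewrite mulNrn opprD.
rewrite -scaleN1r detZ => /(congr1 (fun z => (-1) ^+ n * z)).
by rewrite mulrA -expr2 sqrr_sign mul1r.
Qed.

Lemma nilp_of_trig X P : P \in unitmx -> is_trig_mx (P *m X *m invmx P) ->
  (forall i, (P *m X *m invmx P) i i = 0) -> X ^+ n = 0.
Proof.
move=> uP tP d0; rewrite -[RHS](Cayley_Hamilton X) -(char_poly_conj_unit X uP).
rewrite char_poly_trig//; under eq_bigr do rewrite d0 subr0.
by rewrite prodr_const card_ord rmorphXn/= horner_mx_X.
Qed.

Lemma nilp_trig_diag X P k : P \in unitmx -> is_trig_mx (P *m X *m invmx P) ->
  X ^+ k = 0 -> forall i, (P *m X *m invmx P) i i = 0.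
Proof.
move=> uP tP Xk i; apply/eqP; set a := _ i i; suff : a ^+ n == 0 by rewrite expf_eq0.
rewrite -[a ^+ n]hornerXn -(nilp_char_poly Xk) -(char_poly_conj_unit X uP) char_poly_trig//.
by rewrite horner_prod (bigD1 i)//= hornerXsubC subrr mul0r.
Qed.

(** Chinese remaindering: [M] is the modulus for the nodes already treated, [u * M] is congruent to
    1 modulo the new factor, and [P] is corrected by a multiple of it. *)
Lemma poly_interp (f : K -> K) (N : nat) (s : seq K) : uniq s ->
  exists P : {poly K}, forall a, a \in s -> ('X - a%:P) ^+ N %| P - (f a)%:P.
Proof.
elim: s => [_|a s IH /= /andP[as_ us]]; first by exists 0.
have [P Ps] := IH us; pose M := \prod_(b <- s) ('X - b%:P) ^+ N.
have cM : coprimep M (('X - a%:P) ^+ N).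
  rewrite /M; elim: (s) as_ => [|b r IHr]; first by rewrite big_nil coprime1p.
  rewrite inE negb_or => /andP[ab ar]; rewrite big_cons coprimepMl IHr// andbT.
  by rewrite coprimep_expl// coprimep_expr// coprimep_XsubC root_XsubC.
have /Bezout_eq1_coprimepP[[u w] /= uw] := cM.
exists (P + u * M * ((f a)%:P - P)) => b; rewrite inE => /predU1P[->|bs].
  have -> : P + u * M * ((f a)%:P - P) - (f a)%:P =
      (u * M - 1) * ((f a)%:P - P).
    by rewrite mulrBl mul1r opprB addrAC addrC [P - _]addrC.
  by rewrite -uw opprD addrA subrr add0r -mulNr -mulrA mulrCA dvdp_mulr.
rewrite addrAC dvdp_add ?Ps// dvdp_mulr// dvdp_mull//.
rewrite /M (big_rem b)//=; exact: dvdp_mulIl.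
Qed.

(** The kernels of the pairwise coprime powers [('X - a) ^+ n] span the whole space, so an additive
    property need only be checked on generalized eigenvectors. *)
Lemma gen_eig_ind X (Q : 'rV[K]_n -> Prop) :
  Q 0 -> (forall u v, Q u -> Q v -> Q (u + v)) ->
  (forall a v, v *m (X - a%:M) ^+ n = 0 -> Q v) -> forall v, Q v.
Proof.
move=> Q0 QD Qe v; have [rs cp] := char_poly_split X.
pose s := undup rs; pose p_ (i : 'I_(size s)) := ('X - (s`_i)%:P) ^+ n.
have cop : {in predT &, forall i j, j != i -> coprimep (p_ i) (p_ j)}.
  move=> i j _ _ ij; rewrite coprimep_expl// coprimep_expr// coprimep_XsubC root_XsubC.
  by rewrite nth_uniq ?undup_uniq.
have dv : mxminpoly X %| \prod_i p_ i.
  apply: dvdp_trans (mxminpoly_dvd_char X) _.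
  have szrs : size rs = n by apply: succn_inj; rewrite -(size_char_poly X) cp size_prod_XsubC.
  have -> : \prod_i p_ i = (\prod_(b <- s) ('X - b%:P)) ^+ size rs.
    by rewrite szrs prodrXl (big_nth 0) big_mkord.
  rewrite cp.
  have : {subset rs <= s} by move=> b; rewrite mem_undup.
  elim: {cp szrs} (rs) => [|b r IH] sub; first by rewrite big_nil expr0 dvdpp.
  rewrite big_cons exprS dvdp_mul ?IH//; last by move=> c cr; rewrite sub// inE cr orbT.
  by rewrite (big_rem b) ?sub ?mem_head//= dvdp_mulIl.
have := submx1 v; rewrite -(kermxpoly_min dv) (kermxpoly_prod X cop).
move/sub_sumsmxP => [u ->]; apply: (big_ind Q) => // i _; apply: (Qe s`_i).
rewrite -mulmxA; have -> : (X - (s`_i)%:M) ^+ n = horner_mx X (p_ i).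
  by rewrite rmorphXn rmorphB /= horner_mx_X horner_mx_C.
by rewrite mulmx_ker mulmx0.
Qed.

(** The exponent [2 * n] leaves room for brackets: if [u] and [v] are killed by [n]-th powers, their
    bracket is killed by a [2n]-th power. Divisibility by ['X] makes the new operator send a vector
    into any stable subspace into which [X] sends it. *)
Lemma poly_part X (f : K -> K) : f 0 = 0 ->
  exists P : {poly K}, 'X %| P /\ forall k a v, (k <= 2 * n)%N ->
    v *m (X - a%:M) ^+ k = 0 -> v *m horner_mx X P = f a *: v.
Proof.
move=> f0; have [rs cp] := char_poly_split X.
(* The node 0 is added to the eigenvalues to obtain divisibility by ['X], since [f 0 = 0]. *)
have [P Ps] := @poly_interp f (2 * n) (undup (0 :: rs)) (undup_uniq _).
exists P; split.
  have /Ps : 0 \in undup (0 :: rs) by rewrite mem_undup mem_head.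
  by rewrite f0 !subr0; apply: dvdp_trans; rewrite mul2n doubleS exprS dvdp_mulIl.
move=> k a v kn vk; case: (boolP (a \in rs)) => ars; last first.
  suff -> : v = 0 by rewrite mul0mx scaler0.
  elim: k vk {kn} => [|k IH]; first by rewrite expr0 mulmx1.
  rewrite exprSr mulmxA => e; apply: IH; set w := v *m _ in e *.
  apply/eqP; apply: contraNT ars => w0.
  rewrite -root_prod_XsubC -cp -eigenvalue_root_char; apply/eigenvalueP; exists w => //.
  by move/eqP: e; rewrite mulmxBr mul_mx_scalar subr_eq0 => /eqP.
have /Ps/dvdpP[q e] : a \in undup (0 :: rs) by rewrite mem_undup inE ars orbT.
have -> : P = ('X - a%:P) ^+ k * (('X - a%:P) ^+ (2 * n - k) * q) + (f a)%:P.
  by rewrite mulrA -exprD subnKC// mulrC -e subrK.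
rewrite rmorphD rmorphM mulmxDr /= horner_mx_C mul_mx_scalar mulmxA.
by rewrite rmorphXn rmorphB /= horner_mx_X horner_mx_C vk mul0mx add0r.
Qed.

Lemma diag_eigen X (P : 'M[K]_n) i : P \in unitmx -> is_trig_mx (P *m X *m invmx P) ->
  exists2 v : 'rV[K]_n, v != 0 & v *m X = (P *m X *m invmx P) i i *: v.
Proof.
move=> uP tP; have : root (char_poly X) ((P *m X *m invmx P) i i).
  rewrite -(char_poly_conj_unit X uP) char_poly_trig//.
  by rewrite rootE horner_prod (bigD1 i)//= hornerXsubC subrr mul0r.
by rewrite -eigenvalue_root_char => /eigenvalueP[v]; exists v.
Qed.

Lemma conj_horner (P X : 'M[K]_n) q : P \in unitmx ->
  P *m horner_mx X q *m invmx P = horner_mx (P *m X *m invmx P) q.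
Proof.
move=> uP; elim/poly_ind: q => [|q c IH]; first by rewrite !rmorph0 mulmx0 mul0mx.
rewrite !rmorphD !rmorphM /= !horner_mx_X !horner_mx_C -IH.
by rewrite mulmxDr mulmxDl -!mulmxE conj_unitK// scalar_mxC mulmxK.
Qed.

Lemma trig_horner (T : 'M[K]_n) q : is_trig_mx T ->
  is_trig_mx (horner_mx T q) /\ forall i, horner_mx T q i i = q.[T i i].
Proof.
move=> tT; elim/poly_ind: q => [|q c [IH1 IH2]].
  by rewrite rmorph0; split=> [|i]; rewrite ?mx0_is_trig// mxE horner0.
rewrite rmorphD rmorphM /= horner_mx_X horner_mx_C -mulmxE; split=> [|i]; last first.
  by rewrite mxE trig_mul_diag// IH2 !hornerE mxE eqxx.
apply/is_trig_mxP => i j ij; have /is_trig_mxP/(_ _ _ ij) e := trig_mul IH1 tT.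
by rewrite mxE e add0r mxE -val_eqE /= (ltn_eqF ij).
Qed.

End PolyPart.

(** In a triangular basis the product has diagonal entries [a * a^* = |a|^2], with [a] the
    eigenvalues of [X]. These are nonnegative and sum to zero, so all eigenvalues vanish. *)
Lemma conj_part_nilp (C : numClosedFieldType) n' (X : 'M[C]_n'.+1) (P : {poly C}) :
  (forall a (v : 'rV[C]_n'.+1), v *m (X - a%:M) = 0 -> v *m horner_mx X P = a^* *: v) ->
  \tr (X *m horner_mx X P) = 0 -> X ^+ n'.+1 = 0.
Proof.
move=> XP tr0; have [Q uQ tQ] := trig_single X.
have [tP dP] := trig_horner P tQ.
have d i : P.[(Q *m X *m invmx Q) i i] = ((Q *m X *m invmx Q) i i)^*.
  have [v v0 vX] := diag_eigen i uQ tQ.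
  have e1 : v *m horner_mx X P = P.[(Q *m X *m invmx Q) i i] *: v.
    elim/poly_ind: (P) => [|q c IH]; first by rewrite rmorph0 mulmx0 horner0 scale0r.
    rewrite rmorphD rmorphM /= horner_mx_X horner_mx_C mulmxDr mul_mx_scalar mulmxA IH.
    by rewrite -scalemxAl vX scalerA !hornerE scalerDl.
  have := XP ((Q *m X *m invmx Q) i i) v; rewrite mulmxBr vX mul_mx_scalar subrr => /(_ erefl).
  by rewrite e1 => /eqP; rewrite -subr_eq0 -scalerBl scaler_eq0 (negPf v0) orbF subr_eq0 => /eqP.
apply: (nilp_of_trig uQ tQ) => i; apply/eqP; rewrite -normr_eq0.
move: tr0; rewrite -(mxtrace_conj_unit _ uQ) -conj_unitK// conj_horner// /mxtrace.
under eq_bigr do rewrite trig_mul_diag// dP d -normCK.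
move/eqP; rewrite psumr_eq0 => [/allP/(_ i)|j _]; last exact: exprn_ge0.
by rewrite mem_index_enum => /(_ isT); rewrite expf_eq0.
Qed.

Lemma mx_ext (K : fieldType) m n (A B : 'M[K]_(m, n)) :
  (forall v : 'rV_m, v *m A = v *m B) -> A = B.
Proof. by move=> AB; apply/row_matrixP => i; rewrite !rowE AB. Qed.

(** * Lie's theorem, Cartan's criterion and the Killing form *)

Section CommScalar.
Variables (K : numFieldType) (n' : nat).
Local Notation n := n'.+1.
Variables (A X Y Z : 'M[K]_n) (w : 'rV[K]_n).

Fixpoint krylov k : 'M[K]_n :=
  if k is k'.+1 then (krylov k' + w *m X ^+ k')%MS else A.

Lemma krylovS k (v : 'rV_n) : (v <= krylov k)%MS -> (v <= krylov k.+1)%MS.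
Proof. by move=> vk; apply: submx_trans vk _; apply: addsmxSl. Qed.

Lemma krylov_pow k : (w *m X ^+ k <= krylov k.+1)%MS.
Proof. exact: addsmxSr. Qed.

Lemma krylovX k (v : 'rV_n) : (forall u : 'rV_n, (u <= A)%MS -> (u *m X <= A)%MS) ->
  (v <= krylov k)%MS -> (v *m X <= krylov k.+1)%MS.
Proof.
move=> AX; elim: k v => [|k IH] v; first by move=> /AX; exact: (@krylovS 0).
move=> /sub_adds_rowP[a [u [uk ->]]]; rewrite mulmxDl addmx_sub//; first exact/krylovS/IH.
by rewrite -scalemxAl scalemx_sub// -mulmxA mulmxE -exprSr krylov_pow.
Qed.

(* On the Krylov space of [w] modulo [A], [Y - mu] lowers the filtration and
   sends the top vector [w X^m] to [- m c w X^(m-1)]; as [w X^m] lies in lower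
   steps for the first dependent [m], this forces [m c = 0]. *)
Lemma comm_scalar0 (mu c : K) :
  Z = Y *m X - X *m Y ->
  (forall u : 'rV_n, (u <= A)%MS -> (u *m X <= A)%MS) ->
  (forall u : 'rV_n, (u <= A)%MS -> (u *m Y <= A)%MS) ->
  ~~ (w <= A)%MS -> (w *m Y - mu *: w <= A)%MS ->
  (forall k, (w *m X ^+ k *m Z - c *: (w *m X ^+ k) <= krylov k)%MS) -> c = 0.
Proof.
move=> eZ AX AY wA wY wZ.
have [m wm minm] : exists2 m, (w *m X ^+ m <= krylov m)%MS &
    forall k, (k < m)%N -> ~~ (w *m X ^+ k <= krylov k)%MS.
  have ex : exists m, (w *m X ^+ m <= krylov m)%MS.
    apply/not_existsP => nex.
    have rk k : (k <= \rank (krylov k))%N.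
      elim: k => // k IH; apply: leq_ltn_trans IH _; apply: rank_adds_row.
      by apply/negP; apply: nex.
    by have := leq_trans (rk n.+1) (rank_leq_row _); rewrite ltnn.
  have [m wm mn] := ex_minnP ex; exists m => // k km; apply/negP => /mn.
  by rewrite leqNgt km.
have XY : X *m Y = Y *m X - Z by rewrite eZ opprB addrC subrK.
have step k : ((w *m X ^+ k.+1 *m Y - mu *: (w *m X ^+ k.+1)
               + (k.+1%:R * c) *: (w *m X ^+ k))%R <= krylov k)%MS.
  elim: k => [|k IH].
    rewrite [X in (X <= _)%MS](_ : _ = (w *m Y - mu *: w) *m X - (w *m X ^+ 0 *m Z - c *: (w *m X ^+ 0))); last first.
      rewrite expr1 expr0 mulmx1 mul1r -mulmxA XY mulmxBr mulmxBl !mulmxA.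
      by rewrite -scalemxAl opprB addrA addrAC -!addrA; congr (_ + _); rewrite addrCA.
    by rewrite addmx_sub ?AX// eqmx_opp; apply: (wZ 0%N).
  set u := _ + _ in IH.
  have -> : w *m X ^+ k.+2 *m Y - mu *: (w *m X ^+ k.+2) + (k.+2%:R * c) *: (w *m X ^+ k.+1) =
     u *m X - (w *m X ^+ k.+1 *m Z - c *: (w *m X ^+ k.+1)).
    rewrite /u exprSr -mulmxE !mulmxA -(mulmxA _ X Y) XY mulmxBr mulmxDl mulmxBl -!scalemxAl.
    rewrite -(mulmxA w (X ^+ k) X) mulmxE -exprSr -[in LHS]natr1 mulrDl mul1r scalerDl.
    rewrite !mulmxA opprB.
    move: (_ *m Z) (_ *m Y *m X) (mu *: _) (_ * c *: _) (c *: _) => a b d e g.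
    by apply/matrixP => i j; rewrite !mxE; ring.
  by rewrite addmx_sub ?krylovX// eqmx_opp.
case: m wm minm => [|m] wm minm; first by rewrite expr0 mulmx1 (negPf wA) in wm.
have low k (v : 'rV_n) : (v <= krylov k.+1)%MS -> (v *m Y - mu *: v <= krylov k)%MS.
  elim: k v => [|k IH] v /sub_adds_rowP[a [u [uk ->]]].
    rewrite expr0 mulmx1 mulmxDl -scalemxAl scalerDr scalerA mulrC -scalerA opprD addrACA -scalerBr.
    by rewrite addmx_sub ?scalemx_sub// addmx_sub ?AY// eqmx_opp scalemx_sub.
  rewrite mulmxDl -scalemxAl scalerDr scalerA mulrC -scalerA opprD addrACA -scalerBr.
  apply: addmx_sub; [exact/krylovS/IH | apply: scalemx_sub].
  have := step k; set s := (_ * c) *: _ => st.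
  have -> : w *m X ^+ k.+1 *m Y - mu *: (w *m X ^+ k.+1) = (w *m X ^+ k.+1 *m Y - mu *: (w *m X ^+ k.+1) + s) - s.
    by rewrite addrK.
  apply: addmx_sub; first by apply: (@krylovS k); exact: st.
  by rewrite eqmx_opp; apply: scalemx_sub; apply: krylov_pow.
have := low m _ wm; have := step m; set v := _ - _ => vs vk.
have : (((m.+1%:R * c) *: (w *m X ^+ m))%R <= krylov m)%MS.
  by rewrite -[X in (X <= _)%MS](addKr v) addmx_sub// eqmx_opp.
have [->//|c0] := eqVneq c 0.
by rewrite eqmx_scale ?mulf_neq0 ?pnatr_eq0// (negPf (minm m (ltnSn m))).
Qed.

End CommScalar.

(** * Simultaneous diagonalization *)

Section Diagonal.
Variables (K : numFieldType) (n' : nat).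
Local Notation n := n'.+1.
Implicit Types (A B P W : 'M[K]_n) (v : 'rV[K]_n).

Lemma diagonalizable_conj A P : P \in unitmx -> is_diag_mx (P *m A *m invmx P) -> diagonalizable A.
Proof. by move=> uP dA; exists P => //; rewrite /similar_to /= conjumx. Qed.

Lemma codiag2 A B : comm_mx A B -> diagonalizable A -> diagonalizable B ->
  exists2 P, P \in unitmx & is_diag_mx (P *m A *m invmx P) /\ is_diag_mx (P *m B *m invmx P).
Proof.
move=> cAB dA dB; have /codiagonalizableP[P uP] : {in [:: A; B] &, forall C D, comm_mx C D} /\ {in [:: A; B], forall C, diagonalizable C}.
  split=> [C D|C]; rewrite !inE => /orP[]/eqP-> //.
  - by move=> /orP[]/eqP->.
  - by move=> /orP[]/eqP-> //; apply/esym.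
by rewrite /= /similar_to /= !conjumx// andbT => /andP[? ?]; exists P.
Qed.

Lemma is_diag_lin a A B : is_diag_mx A -> is_diag_mx B -> is_diag_mx (a *: A + B).
Proof.
move=> /is_diag_mxP dA /is_diag_mxP dB; apply/is_diag_mxP => i j ij.
by rewrite !mxE dA// dB// mulr0 addr0.
Qed.

Lemma diag_lin a A B : comm_mx A B -> diagonalizable A -> diagonalizable B ->
  diagonalizable (a *: A + B).
Proof.
move=> cAB dA dB; have [P uP [PA PB]] := codiag2 cAB dA dB.
apply: (diagonalizable_conj uP).
by rewrite mulmxDr mulmxDl -scalemxAr -scalemxAl is_diag_lin.
Qed.

Lemma row_mul_diag v A i : is_diag_mx A -> (v *m A) 0 i = v 0 i * A i i.
Proof.
move=> /is_diag_mxP dA; rewrite mxE (bigD1 i)//= big1 ?addr0// => j ji.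
by rewrite dA ?mulr0.
Qed.

Lemma ker_diag P A v : P \in unitmx -> is_diag_mx (P *m A *m invmx P) ->
  v *m A = 0 <-> forall i, (v *m invmx P) 0 i * (P *m A *m invmx P) i i = 0.
Proof.
move=> uP dA; have e : v *m invmx P *m (P *m A *m invmx P) = v *m A *m invmx P.
  by rewrite !mulmxA mulmxKV.
split=> [v0 i|v0]; first by rewrite -row_mul_diag// e v0 mul0mx mxE.
rewrite -[v *m A](mulmxK uP) -(mulmxKV uP (v *m A)) -e.
suff -> : v *m invmx P *m (P *m A *m invmx P) = 0 by rewrite !mul0mx.
by apply/rowP => i; rewrite row_mul_diag// v0 mxE.
Qed.

Lemma diag_nilpotent0 A k : diagonalizable A -> A ^+ k = 0 -> A = 0.
Proof.
move=> [P uP]; rewrite /similar_to /= conjumx// => dA Ak; apply: mx_ext => v; rewrite mulmx0.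
apply/(ker_diag v uP dA) => i; suff -> : (P *m A *m invmx P) i i = 0 by rewrite mulr0.
have dk j : (P *m A ^+ j *m invmx P) i i = (P *m A *m invmx P) i i ^+ j.
  elim: j => [|j IH]; first by rewrite !expr0 mulmx1 mulmxV// mxE eqxx.
  rewrite exprSr -mulmxE -conj_unitK// exprSr -IH.
  have /is_diag_mxP dA' := dA; rewrite mxE (bigD1 i)//= big1 ?addr0// => l li.
  by rewrite dA' ?mulr0.
have := dk k; rewrite Ak mulmx0 mul0mx mxE => /esym/eqP; rewrite expf_eq0 => /andP[_ /eqP].
by [].
Qed.

Lemma fresh_elt (s : seq K) : exists e, e \notin s.
Proof.
exists (1 + \sum_(x <- s) `|x|); apply/negP => es.
have s0 : 0 <= \sum_(x <- s) `|x| by apply: sumr_ge0.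
have : `|1 + \sum_(x <- s) `|x| | <= \sum_(x <- s) `|x|.
  by rewrite [leRHS](big_rem _ es)/= lerDl sumr_ge0.
by rewrite ger0_norm ?addr_ge0// gerDr ler10.
Qed.

(** Let [q] be the product over the nonzero eigenvalues. Then [q(A) A = 0] and [q = r X + q(0)] with
    [q(0)] nonzero, so the identity is [q(A) / q(0) - r(A) A / q(0)]; polynomials in [A] preserve
    [W]. *)
Lemma diag_split A W v : diagonalizable A ->
  (forall u : 'rV_n, (u <= W)%MS -> (u *m A <= W)%MS) -> (v <= W)%MS ->
  exists v1 v2 : 'rV_n, [/\ v1 *m A = 0, (v1 <= W)%MS, (v2 <= W)%MS & v = v1 + v2 *m A].
Proof.
move=> /diagonalizableP[rs urs dv] sA vW.
have sAW : stablemx W A by apply: row_ext_sub => u /submxP[d ->]; rewrite mulmxA sA// submxMl.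
have sq q : (v *m horner_mx A q <= W)%MS.
  by apply: submx_trans (horner_mx_stable q sAW); apply: submxMr.
pose q := \prod_(x <- rem 0 rs) ('X - x%:P).
have q0 : q.[0] != 0.
  by rewrite -/(root q 0) root_prod_XsubC mem_rem_uniqF.
have qA : horner_mx A (q * 'X) = 0.
  apply/eqP; rewrite -dvd_mxminpoly; apply: dvdp_trans dv _.
  rewrite /q; have [r0|r0] := boolP (0 \in rs); last by rewrite rem_id// dvdp_mulIl.
  by rewrite (big_rem 0)//= subr0 mulrC dvdpp.
have [r qr] : exists r, q = r * 'X + q.[0]%:P.
  have /factor_theorem[r e] : root (q - q.[0]%:P) 0 by rewrite rootE !hornerE subrr.
  by exists r; rewrite subr0 in e; rewrite -e subrK.
have hX p : horner_mx A p *m A = horner_mx A (p * 'X) by rewrite rmorphM /= horner_mx_X.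
exists (q.[0]^-1 *: (v *m horner_mx A q)), (- q.[0]^-1 *: (v *m horner_mx A r)).
rewrite !scalemx_sub ?sq//; split=> //.
  by rewrite -scalemxAl -mulmxA hX qA mulmx0 scaler0.
rewrite scaleNr mulNmx -scalemxAl -scalerBr -mulmxA hX.
rewrite -mulmxBr -rmorphB /= [X in X - _]qr addrC addKr horner_mx_C mul_mx_scalar scalerA mulVf//.
by rewrite scale1r.
Qed.

End Diagonal.

(** * The adjoint representation and solvable subalgebras *)

Section Lie.
Variables (K : numClosedFieldType) (n' : nat).
Local Notation n := n'.+1.
Local Notation vec := 'rV[K]_n.
Variable br : vec -> vec -> vec.
Hypothesis lb : is_lie_bracket br.
Implicit Types (u v w x y z : vec) (A B S D X : 'M[K]_n).

Lemma brDl u v w : br (u + v) w = br u w + br v w.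
Proof. by have [/(_ 1) L _ _ _] := lb; have := L u v w; rewrite !scale1r. Qed.
Lemma brDr u v w : br w (u + v) = br w u + br w v.
Proof. by have [_ /(_ 1) L _ _] := lb; have := L w u v; rewrite !scale1r. Qed.
Lemma br0l u : br 0 u = 0.
Proof. by apply: (addrI (br 0 u)); rewrite -brDl !addr0. Qed.
Lemma br0r u : br u 0 = 0.
Proof. by apply: (addrI (br u 0)); rewrite -brDr !addr0. Qed.
Lemma brZl a u w : br (a *: u) w = a *: br u w.
Proof. by have [L _ _ _] := lb; have := L a u 0 w; rewrite !addr0 br0l addr0. Qed.
Lemma brZr a u w : br w (a *: u) = a *: br w u.
Proof. by have [_ L _ _] := lb; have := L a w u 0; rewrite !addr0 br0r addr0. Qed.
Lemma brNl u w : br (- u) w = - br u w.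
Proof. by rewrite -scaleN1r brZl scaleN1r. Qed.
Lemma brNr u w : br w (- u) = - br w u.
Proof. by rewrite -scaleN1r brZr scaleN1r. Qed.
Lemma brxx u : br u u = 0. Proof. by case: lb. Qed.
Lemma brC u v : br u v = - br v u.
Proof.
have := brxx (u + v); rewrite brDl !brDr !brxx addr0 add0r => /eqP.
by rewrite addr_eq0 => /eqP.
Qed.
Lemma jacobi u v w : br (br u v) w = br u (br v w) - br v (br u w).
Proof.
have [_ _ _ /(_ u v w)] := lb; rewrite (brC w u) brNr (brC w (br u v)).
by move/eqP; rewrite subr_eq0 => /eqP <-.
Qed.

Lemma br_suml I (r : seq I) P (F : I -> vec) v :
  br (\sum_(i <- r | P i) F i) v = \sum_(i <- r | P i) br (F i) v.
Proof. by apply: (big_morph (br^~ v)) => [a b|]; rewrite ?brDl ?br0l. Qed.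
Lemma br_sumr I (r : seq I) P (F : I -> vec) v :
  br v (\sum_(i <- r | P i) F i) = \sum_(i <- r | P i) br v (F i).
Proof. by apply: (big_morph (br v)) => [a b|]; rewrite ?brDr ?br0r. Qed.

Lemma mul_ad u v : v *m ad br u = br u v.
Proof.
rewrite /ad; have L : linear (br u) by move=> a x y; rewrite brDr brZr.
pose f : {linear vec -> vec} := HB.pack (br u) (GRing.isLinear.Build K vec vec *:%R (br u) L).
exact: (mul_rV_lin1 f).
Qed.

Lemma ad_lin a u v : ad br (a *: u + v) = a *: ad br u + ad br v.
Proof. by apply: mx_ext => w; rewrite mulmxDr -scalemxAr !mul_ad brDl brZl. Qed.
Lemma adD u v : ad br (u + v) = ad br u + ad br v.
Proof. by have := ad_lin 1 u v; rewrite !scale1r. Qed.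
Lemma ad0 : ad br 0 = 0.
Proof. by apply: mx_ext => w; rewrite mul_ad br0l mulmx0. Qed.
Lemma adZ a u : ad br (a *: u) = a *: ad br u.
Proof. by rewrite -[_ *: u]addr0 ad_lin ad0 addr0. Qed.
Lemma adN u : ad br (- u) = - ad br u.
Proof. by rewrite -scaleN1r adZ scaleN1r. Qed.
Lemma ad_sum I (r : seq I) P (F : I -> vec) :
  ad br (\sum_(i <- r | P i) F i) = \sum_(i <- r | P i) ad br (F i).
Proof. by apply: (big_morph (ad br)) => [a b|]; rewrite ?adD ?ad0. Qed.
Lemma ad_br u v : ad br (br u v) = ad br v *m ad br u - ad br u *m ad br v.
Proof. by apply: mx_ext => w; rewrite mulmxBr !mulmxA !mul_ad jacobi. Qed.

Definition kf u v := \tr (ad br u *m ad br v).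

Lemma kfC u v : kf u v = kf v u. Proof. exact: mxtrace_mulC. Qed.
Lemma kf_linl a u v w : kf (a *: u + v) w = a * kf u w + kf v w.
Proof. by rewrite /kf ad_lin mulmxDl -scalemxAl mxtraceD mxtraceZ. Qed.
Lemma kfDl u v w : kf (u + v) w = kf u w + kf v w.
Proof. by have := kf_linl 1 u v w; rewrite scale1r mul1r. Qed.
Lemma kf0l w : kf 0 w = 0.
Proof. by rewrite /kf ad0 mul0mx mxtrace0. Qed.
Lemma kfZl a u w : kf (a *: u) w = a * kf u w.
Proof. by rewrite -[_ *: u]addr0 kf_linl kf0l addr0. Qed.
Lemma kfNl u w : kf (- u) w = - kf u w.
Proof. by rewrite -scaleN1r kfZl mulN1r. Qed.
Lemma kfDr u v w : kf w (u + v) = kf w u + kf w v.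
Proof. by rewrite kfC kfDl !(kfC w). Qed.
Lemma kf0r w : kf w 0 = 0. Proof. by rewrite kfC kf0l. Qed.
Lemma kfZr a u w : kf w (a *: u) = a * kf w u.
Proof. by rewrite kfC kfZl kfC. Qed.
Lemma kfNr u w : kf w (- u) = - kf w u.
Proof. by rewrite kfC kfNl kfC. Qed.
Lemma kf_suml I (r : seq I) P (F : I -> vec) v :
  kf (\sum_(i <- r | P i) F i) v = \sum_(i <- r | P i) kf (F i) v.
Proof. by apply: (big_morph (kf^~ v)) => [a b|]; rewrite ?kfDl ?kf0l. Qed.
Lemma kf_sumr I (r : seq I) P (F : I -> vec) v :
  kf v (\sum_(i <- r | P i) F i) = \sum_(i <- r | P i) kf v (F i).
Proof. by apply: (big_morph (kf v)) => [a b|]; rewrite ?kfDr ?kf0r. Qed.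
Lemma kf_inv u v w : kf (br u v) w = kf u (br v w).
Proof.
rewrite /kf !ad_br mulmxBl mulmxBr !raddfB /=; congr (_ - _); last by rewrite mulmxA.
by rewrite -mulmxA mxtrace_mulC mulmxA.
Qed.

Lemma derivedS S u v : (u <= S)%MS -> (v <= S)%MS -> (br u v <= lie_derived br S)%MS.
Proof.
move=> /submxP[a ->] /submxP[b ->]; rewrite !mulmx_sum_row br_suml summx_sub// => i _.
rewrite br_sumr summx_sub// => j _; rewrite brZl brZr !scalemx_sub//.
by rewrite /lie_derived (sumsmx_sup i)// (sumsmx_sup j)// genmxE.
Qed.

Lemma derived_sub S A : (forall u v, (u <= S)%MS -> (v <= S)%MS -> (br u v <= A)%MS) ->
  (lie_derived br S <= A)%MS.
Proof.
move=> SA; apply/sumsmx_subP => i _; apply/sumsmx_subP => j _.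
by rewrite genmxE SA ?row_sub.
Qed.

Lemma derived_mono S A : (S <= A)%MS -> (lie_derived br S <= lie_derived br A)%MS.
Proof. by move=> SA; apply: derived_sub => u v uS vS; apply: derivedS; apply: submx_trans SA. Qed.

Lemma derived_subalg S : lie_subalgebra br S -> (lie_derived br S <= S)%MS.
Proof. exact: derived_sub. Qed.

Lemma subalg_derived S : lie_subalgebra br S -> lie_subalgebra br (lie_derived br S).
Proof. by move=> aS u v uS vS; apply: derivedS; apply: submx_trans (derived_subalg aS). Qed.

Lemma solvable_mono S A : (S <= A)%MS -> lie_solvable br A -> lie_solvable br S.
Proof.
move=> SA [k Ak]; exists k; apply: submx_trans Ak.
by elim: k S A SA => //= k IH S A SA; apply: derived_mono; apply: IH.
Qed.

Lemma solvable_of_derived S A : (lie_derived br S <= A)%MS -> lie_solvable br A -> lie_solvable br S.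
Proof. by move=> SA /(solvable_mono SA)[k Sk]; exists k.+1; rewrite iterSr. Qed.

Definition lie_stab S A := forall u w, (u <= S)%MS -> (w <= A)%MS -> (br u w <= A)%MS.

(** Lie's theorem on [B / A], by induction on the derived length. In a minimal stable [M] above [A]
    the derived algebra [I] has a common eigenvector of weight [lam]. Since [lam] vanishes on
    [[S, I]], the [lam]-weight vectors form a stable subspace and fill [M]. Then [lam] vanishes on
    all commutators, so [S] acts on [M / A] by commuting maps, each eigenspace is stable and fills
    [M] as well: [S] acts by scalars. *)
Theorem lie_thm S A B : lie_subalgebra br S -> lie_solvable br S ->
  lie_stab S A -> lie_stab S B -> (A <= B)%MS -> ~~ (B <= A)%MS ->
  exists w, [/\ (w <= B)%MS, ~~ (w <= A)%MS &
    forall u, (u <= S)%MS -> exists a, (br u w - a *: w <= A)%MS].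
Proof.
move=> + [k]; elim: k S A B => [|k IH] S A B aS Sk sA sB AB nBA.
  have /row_subPn[i iA] := nBA; exists (row i B); rewrite row_sub iA; split=> // u uS.
  exists 0; have /eqP -> : u == 0 by rewrite -submx0; apply: submx_trans Sk.
  by rewrite br0l scale0r subr0 sub0mx.
pose Q M := [/\ (A <= M)%MS, ~~ (M <= A)%MS, lie_stab S M & (M <= B)%MS].
have [M [AM nMA sM MB] minM] : exists2 M, Q M & forall M', Q M' -> (\rank M <= \rank M')%N.
  by apply: (@exists_min_rank _ _ Q B).
suff [w [wM wA wS]] : exists w, [/\ (w <= M)%MS, ~~ (w <= A)%MS &
    forall u, (u <= S)%MS -> exists a, (br u w - a *: w <= A)%MS].
  by exists w; split=> //; apply: submx_trans MB.
have minS M' : (A <= M')%MS -> (M' <= M)%MS -> lie_stab S M' -> ~~ (M' <= A)%MS -> (M <= M')%MS.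
  move=> AM' M'M sM' nM'; rewrite -(mxrank_leqif_sup M'M) eqn_leq mxrankS//=.
  by apply: minM; split=> //; apply: submx_trans MB.
clear B sB AB nBA MB minM Q.
set I := lie_derived br S; have IS : (I <= S)%MS := derived_subalg aS.
have sI M' : lie_stab S M' -> lie_stab I M' by move=> s u w uI; apply: s; apply: submx_trans IS.
have [|w [wM wA wI]] := IH I A M (subalg_derived aS) _ (sI _ sA) (sI _ sM) AM nMA.
  by rewrite -iterSr.
have [lam wlam] : {lam : vec -> K & forall y, (y <= I)%MS -> (br y w - lam y *: w <= A)%MS}.
  apply: (@boolp.choice _ _ (fun y a => (y <= I)%MS -> (br y w - a *: w <= A)%MS)) => y.
  by have [/wI[a ?]|yI] := boolP (y <= I)%MS; [exists a | exists 0].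
have brI x y : (x <= S)%MS -> (y <= I)%MS -> (br x y <= I)%MS.
  by move=> xS yI; apply: derivedS => //; apply: submx_trans IS.
have lam0 x y : (x <= S)%MS -> (y <= I)%MS -> lam (br x y) = 0.
  move=> xS yI; apply: (@comm_scalar0 K n' A (ad br x) (ad br y) (ad br (br x y)) w (lam y)) => //.
  - exact: ad_br.
  - by move=> u uA; rewrite mul_ad sA.
  - by move=> u uA; rewrite mul_ad sA// (submx_trans yI).
  - by rewrite mul_ad wlam.
  (* The Krylov estimate is proved for all [z] in [I] at once, because moving [z] past [ad br x]
     produces the new element [br x z] of [I]. *)
  move: (br x y) (brI _ _ xS yI) => z zI {y yI} k'.
  elim: k' z zI => [|k' IHk] z zI; first by rewrite expr0 mulmx1 mul_ad wlam.
  have Xad : ad br x *m ad br z = ad br z *m ad br x - ad br (br x z).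
    by rewrite ad_br opprB addrC subrK.
  rewrite exprSr -mulmxE mulmxA -(mulmxA _ (ad br x) (ad br z)) Xad mulmxBr mulmxA.
  set v := w *m _.
  have -> : v *m ad br z *m ad br x - v *m ad br (br x z) - lam z *: (v *m ad br x) =
     (v *m ad br z - lam z *: v) *m ad br x - (v *m ad br (br x z) - lam (br x z) *: v)
     - lam (br x z) *: v.
    rewrite mulmxBl -scalemxAl; move: (_ *m _ *m _) (_ *m ad br (br x z)) (_ *: (_ *m _)) (_ *: v) => a b d e.
    by apply/matrixP => i j; rewrite !mxE; ring.
  apply: addmx_sub; [apply: addmx_sub|].
  - by apply: krylovX; [move=> u uA; rewrite mul_ad sA | exact: IHk].
  - by rewrite eqmx_opp krylovS// IHk// brI.
  - by rewrite eqmx_opp scalemx_sub// krylov_pow.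
have wt v y : (v <= M)%MS -> (y <= I)%MS -> (br y v - lam y *: v <= A)%MS.
  have [||W WP] := @subspace_mx K n (fun v => (v <= M)%MS /\ forall y, (y <= I)%MS -> (br y v - lam y *: v <= A)%MS).
  - by rewrite sub0mx; split=> // z zI; rewrite br0r scaler0 subr0 sub0mx.
  - move=> a u1 u2 [u1M u1P] [u2M u2P]; split=> [|z zI]; first by rewrite addmx_sub ?scalemx_sub.
    have -> : br z (a *: u1 + u2) - lam z *: (a *: u1 + u2) =
       a *: (br z u1 - lam z *: u1) + (br z u2 - lam z *: u2).
      by rewrite brDr brZr scalerDr opprD addrACA scalerBr !scalerA mulrC.
    by rewrite addmx_sub ?scalemx_sub ?u1P ?u2P.
  suff : (M <= W)%MS by move=> MW vM yI; have [_ /(_ y yI)] := (WP v).1 (submx_trans vM MW).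
  apply: minS.
  - apply: row_ext_sub => u uA; apply/WP; split=> [|z zI]; first exact: submx_trans AM.
    by rewrite addmx_sub ?(sI _ sA)// eqmx_opp scalemx_sub.
  - by apply: row_ext_sub => u /WP[].
  - move=> x u xS /WP[uM uP]; apply/WP; split=> [|z zI]; first exact: sM.
    have -> : br z (br x u) - lam z *: br x u =
        br x (br z u - lam z *: u) - (br (br x z) u - lam (br x z) *: u).
      rewrite lam0// scale0r subr0 jacobi brDr brNr brZr opprB.
      move: (br z _) (br x (br z u)) (_ *: _) => a b d.
      by apply/matrixP => i j; rewrite !mxE; ring.
    by rewrite addmx_sub ?sA ?uP// eqmx_opp uP// brI.
  - apply: contra wA => WA; apply: submx_trans WA; apply/WP; split=> //.
(* The Krylov argument again, now started at an eigenvector [w'] of [ad br x2] modulo [A];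
   [br x1 x2] is already known to act on [M] by a scalar. *)
have comm x1 x2 v : (x1 <= S)%MS -> (x2 <= S)%MS -> (v <= M)%MS -> (br (br x1 x2) v <= A)%MS.
  move=> x1S x2S vM; have x12 : (br x1 x2 <= I)%MS by exact: derivedS.
  have [|w' [a [w'M w'A w'x]]] := @eig_quot K n' (ad br x2) A M _ nMA.
    by move=> u uM; rewrite mul_ad sM.
  suff l0 : lam (br x1 x2) = 0 by have := wt v _ vM x12; rewrite l0 scale0r subr0.
  apply: (@comm_scalar0 K n' A (ad br x1) (ad br x2) (ad br (br x1 x2)) w' a) => //.
  - exact: ad_br.
  - by move=> u uA; rewrite mul_ad sA.
  - by move=> u uA; rewrite mul_ad sA.
  move=> k'; have w'k : (w' *m ad br x1 ^+ k' <= M)%MS.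
    elim: k' => [|k' IHk]; first by rewrite expr0 mulmx1.
    by rewrite exprSr -mulmxE mulmxA mul_ad sM.
  rewrite mul_ad; apply: submx_trans (wt _ _ w'k x12) _.
  by elim: (k') => //= j /submx_trans; apply; apply: addsmxSl.
exists w; split=> // s sS.
have [|w' [a [w'M w'A w's]]] := @eig_quot K n' (ad br s) A M _ nMA.
  by move=> u uM; rewrite mul_ad sM.
exists a; have [||W WP] := @subspace_mx K n (fun v => (v <= M)%MS /\ (br s v - a *: v <= A)%MS).
- by rewrite br0r scaler0 subr0 !sub0mx.
- move=> b u1 u2 [u1M u1P] [u2M u2P]; split; first by rewrite addmx_sub ?scalemx_sub.
  have -> : br s (b *: u1 + u2) - a *: (b *: u1 + u2) =
       b *: (br s u1 - a *: u1) + (br s u2 - a *: u2).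
    by rewrite brDr brZr scalerDr opprD addrACA scalerBr !scalerA mulrC.
  by rewrite addmx_sub ?scalemx_sub.
suff MW : (M <= W)%MS by have [_] := (WP w).1 (submx_trans wM MW).
apply: minS.
- apply: row_ext_sub => u uA; apply/WP; split; first exact: submx_trans AM.
  by rewrite addmx_sub ?sA// eqmx_opp scalemx_sub.
- by apply: row_ext_sub => u /WP[].
- move=> x u xS /WP[uM uP]; apply/WP; split; first exact: sM.
  have -> : br s (br x u) - a *: br x u = br x (br s u - a *: u) + br (br s x) u.
    rewrite brDr brNr brZr jacobi; move: (br s _) (br x (br s u)) (_ *: _) => b d e.
    by apply/matrixP => i j; rewrite !mxE; ring.
  by apply: addmx_sub; [exact: sA | exact: comm].
- apply: contra w'A => WA; apply: submx_trans WA; apply/WP; split=> //.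
  by rewrite -mul_ad.
Qed.

Local Notation subalg := (lie_subalgebra br).

Lemma lie_trig S : subalg S -> lie_solvable br S ->
  exists2 P, P \in unitmx & forall u, (u <= S)%MS -> is_trig_mx (P *m ad br u *m invmx P).
Proof.
move=> aS sS; have [|P uP tP] := @trig_of_flags K n (fun f => exists2 u, (u <= S)%MS & f = ad br u).
  move=> A stA nA; have [||||w [_ wA wS]] := @lie_thm S A 1%:M aS sS.
  - by move=> u w uS wA; rewrite -mul_ad; apply: stA => //; exists u.
  - by move=> u w _ _; rewrite submx1.
  - by rewrite submx1.
  - by [].
  by exists w => // f [u uS ->]; have [a] := wS u uS; exists a; rewrite mul_ad.
by exists P => // u uS; apply: tP; exists u.
Qed.

Lemma kf_trig P u v : P \in unitmx -> is_trig_mx (P *m ad br u *m invmx P) ->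
  is_trig_mx (P *m ad br v *m invmx P) ->
  kf u v = \sum_i (P *m ad br u *m invmx P) i i * (P *m ad br v *m invmx P) i i.
Proof.
move=> uP tu tv; rewrite /kf -(mxtrace_conj_unit _ uP) -conj_unitK// /mxtrace.
by apply: eq_bigr => i _; rewrite trig_mul_diag.
Qed.

Lemma trig_comm_diag (A B : 'M[K]_n) i :
  is_trig_mx A -> is_trig_mx B -> (A *m B - B *m A) i i = 0.
Proof. by move=> tA tB; rewrite mxE [X in _ + X]mxE !trig_mul_diag// mulrC subrr. Qed.

Lemma kf_solvable S u v w : subalg S -> lie_solvable br S ->
  (u <= S)%MS -> (v <= S)%MS -> (w <= S)%MS -> kf (br u v) w = 0.
Proof.
move=> aS sS uS vS wS; have [P uP tP] := lie_trig aS sS.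
rewrite (kf_trig uP) ?tP ?aS// big1// => i _.
by rewrite ad_br mulmxBr mulmxBl -!conj_unitK// trig_comm_diag ?mul0r ?tP.
Qed.

Lemma kf_nilpotent S u v : subalg S -> lie_solvable br S ->
  (u <= S)%MS -> (v <= S)%MS -> ad_nilpotent br u -> kf u v = 0.
Proof.
move=> aS sS uS vS [k uk]; have [P uP tP] := lie_trig aS sS.
rewrite (kf_trig uP) ?tP// big1// => i _.
by rewrite (nilp_trig_diag uP (tP _ uS) uk) mul0r.
Qed.

Definition is_der D := forall u v, br u v *m D = br (u *m D) v + br u (v *m D).

Lemma der_ad x : is_der (ad br x).
Proof.
move=> u v; by rewrite !mul_ad jacobi subrK.
Qed.

Lemma ad_der D v : is_der D -> ad br (v *m D) = ad br v *m D - D *m ad br v.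
Proof.
move=> dD; apply: mx_ext => w.
by rewrite mulmxBr !mulmxA !mul_ad dD addrK.
Qed.

(** By the Leibniz rule, each application of [D - (a + b)] to the bracket applies [D - a] to the
    first factor or [D - b] to the second. *)
Lemma der_gen_eig D a b i j k u v : is_der D -> (i + j <= k)%N ->
  u *m (D - a%:M) ^+ i = 0 -> v *m (D - b%:M) ^+ j = 0 ->
  br u v *m (D - (a + b)%:M) ^+ k = 0.
Proof.
move=> dD; elim: k i j u v => [|k IH] i j u v.
  rewrite leqn0 addn_eq0 => /andP[/eqP-> _]; rewrite !expr0 !mulmx1 => -> _.
  exact: br0l.
case: i => [_|i].
  by rewrite expr0 mulmx1 => -> _; rewrite br0l mul0mx.
case: j => [_ _|j ijk].
  by rewrite expr0 mulmx1 => ->; rewrite br0r mul0mx.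
rewrite !(exprS _ i) !(exprS _ j) (exprS _ k) -!mulmxE !mulmxA => ui vj.
have -> : br u v *m (D - (a + b)%:M) = br (u *m (D - a%:M)) v + br u (v *m (D - b%:M)).
  rewrite !mulmxBr dD !mul_mx_scalar brDl brDr brNl brNr brZl brZr.
  by rewrite scalerDl opprD addrACA.
have e1 : br (u *m (D - a%:M)) v *m (D - (a + b)%:M) ^+ k = 0.
  apply: (IH i j.+1); [by rewrite addSn in ijk | by [] | by rewrite exprS -mulmxE mulmxA].
have e2 : br u (v *m (D - b%:M)) *m (D - (a + b)%:M) ^+ k = 0.
  apply: (IH i.+1 j); [by rewrite addSnnS; rewrite addSn in ijk | by rewrite exprS -mulmxE mulmxA | by []].
by rewrite mulmxDl e1 e2 addr0.
Qed.

(** Generalized eigenspaces multiply by adding eigenvalues, so an additive function of the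
    eigenvalue acts as a derivation. It serves with [f] the conjugation, and with [f] the identity
    for the semisimple part. *)
Lemma der_horner D (f : K -> K) (P : {poly K}) :
  (forall a b, f (a + b) = f a + f b) -> is_der D ->
  (forall k a v, (k <= 2 * n)%N -> v *m (D - a%:M) ^+ k = 0 -> v *m horner_mx D P = f a *: v) ->
  is_der (horner_mx D P).
Proof.
move=> fD dD PD u; move: (horner_mx D P) PD => E PD.
have n2 : (n <= 2 * n)%N by rewrite leq_pmull.
apply: (@gen_eig_ind _ _ D) => [|v w IHv IHw|b v vb].
- by rewrite !(br0r, mul0mx) addr0.
- by rewrite !brDr !mulmxDl !brDr IHv IHw addrACA.
move: u; apply: (@gen_eig_ind _ _ D) => [|u w IHv IHw|a u ua].
- by rewrite !(br0l, mul0mx) addr0.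
- by rewrite !brDl !mulmxDl !brDl IHv IHw addrACA.
rewrite (PD n a u)// (PD n b v)// (PD (2 * n)%N (a + b))//; last first.
  by apply: (der_gen_eig dD _ ua vb); rewrite mul2n addnn.
by rewrite fD scalerDl brZl brZr.
Qed.

Lemma horner_stable X A (q : {poly K}) v :
  (forall u, (u <= A)%MS -> (u *m X <= A)%MS) -> (v <= A)%MS -> (v *m horner_mx X q <= A)%MS.
Proof.
move=> sA vA; have : stablemx A X by apply: row_ext_sub => u /submxP[d ->]; rewrite mulmxA sA// submxMl.
by move=> /(horner_mx_stable q) sAq; apply: submx_trans sAq; apply: submxMr.
Qed.

(* [E] acts as the scalar [a^*] on the generalized eigenspace of [D] for [a]. *)
Lemma conj_part D : is_der D -> exists E, [/\ is_der E,
  forall A v, (forall u, (u <= A)%MS -> (u *m D <= A)%MS) -> (v *m D <= A)%MS -> (v *m E <= A)%MS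
  & \tr (D *m E) = 0 -> D ^+ n = 0].
Proof.
move=> dD; have [|P [/dvdpP[q Pq] PD]] := @poly_part K n' D Num.conj _; first exact: rmorph0.
exists (horner_mx D P); split.
- by apply: (der_horner (f := Num.conj)) => // a b; rewrite rmorphD.
- move=> A v sA vA; rewrite Pq mulrC rmorphM /= horner_mx_X -mulmxE mulmxA.
  exact: horner_stable.
- by apply: conj_part_nilp => a v va; apply: (PD 1%N) => //; rewrite ?expr1// mul2n.
Qed.

(** With [E] the conjugate part of [ad br x], it suffices that the trace of [ad br x *m E] vanishes.
    For a bracket, the trace of [ad br (br u v) *m E] is [- kf u (v *m E)], and [v *m E] lies in the
    derived algebra because bracketing with [x] sends [v] there. *)
Lemma nilpotent_of_kf S x : subalg S -> (x <= lie_derived br S)%MS ->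
  (forall u v, (u <= lie_derived br S)%MS -> (v <= S)%MS -> kf u v = 0) ->
  ad_nilpotent br x.
Proof.
move=> aS xS' kS; have dS := derived_subalg aS.
have [E [dE sE trE]] := conj_part (der_ad x).
exists n; apply: trE.
have [||M MP] := @subspace_mx K n (fun z => \tr (ad br z *m E) = 0).
- by rewrite ad0 mul0mx mxtrace0.
- by move=> a u v eu ev; rewrite ad_lin mulmxDl mxtraceD -scalemxAl mxtraceZ eu ev mulr0 addr0.
apply/MP; apply: (submx_trans xS'); apply: derived_sub => u v uS vS; apply/MP.
rewrite ad_br mulmxBl raddfB /= -mulmxA mxtrace_mulC -raddfB /= -!mulmxA -mulmxBr.
rewrite -opprB -ad_der// mulmxN raddfN /= -[\tr _]/(kf u (v *m E)) kfC kS ?oppr0//.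
apply: sE; last by rewrite mul_ad derivedS// (submx_trans xS').
by move=> w wS'; rewrite mul_ad derivedS// ?(submx_trans xS')// (submx_trans wS').
Qed.

Lemma eig_nilpotent0 A u z a : ad_nilpotent br u ->
  (forall w, (w <= A)%MS -> (br u w <= A)%MS) -> ~~ (z <= A)%MS ->
  (br u z - a *: z <= A)%MS -> a = 0.
Proof.
move=> [k uk] sA zA ez.
have : (z *m ad br u ^+ k - a ^+ k *: z <= A)%MS.
  elim: (k) => [|j IH]; first by rewrite !expr0 mulmx1 scale1r subrr sub0mx.
  have -> : z *m ad br u ^+ j.+1 - a ^+ j.+1 *: z =
     br u (z *m ad br u ^+ j - a ^+ j *: z) + a ^+ j *: (br u z - a *: z).
    rewrite exprSr -mulmxE mulmxA mul_ad brDr brNr brZr exprSr scalerBr scalerA addrA.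
    by rewrite subrK.
  by rewrite addmx_sub ?sA// scalemx_sub.
rewrite uk mulmx0 sub0r eqmx_opp; have [//|a0] := eqVneq a 0.
by rewrite eqmx_scale ?expf_neq0// (negPf zA).
Qed.

Lemma subalg_add_row A z : subalg A ->
  (forall u, (u <= A)%MS -> (br u z <= A + z)%MS) -> subalg (A + z)%MS.
Proof.
move=> aA nA u v /sub_adds_rowP[a [u' [u'A ->]]] /sub_adds_rowP[b [v' [v'A ->]]].
rewrite brDl !brDr !brZl !brZr brxx !scaler0 addr0 (brC z).
have sub w : (w <= A)%MS -> (w <= A + z)%MS by move/submx_trans; apply; apply: addsmxSl.
by rewrite !addmx_sub ?scalemx_sub ?nA// ?eqmx_opp ?nA// sub// aA.
Qed.

Lemma derived_add_row A z : subalg A ->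
  (forall u, (u <= A)%MS -> (br u z <= A)%MS) -> (lie_derived br (A + z)%MS <= A)%MS.
Proof.
move=> aA nA; apply: derived_sub => u v /sub_adds_rowP[a [u' [u'A ->]]] /sub_adds_rowP[b [v' [v'A ->]]].
rewrite brDl !brDr !brZl !brZr brxx !scaler0 addr0 (brC z).
by rewrite !addmx_sub ?scalemx_sub ?nA// ?eqmx_opp ?nA// aA.
Qed.

Lemma solvable_add_row A z : subalg A -> lie_solvable br A ->
  (forall u, (u <= A)%MS -> (br u z <= A)%MS) ->
  subalg (A + z)%MS /\ lie_solvable br (A + z)%MS.
Proof.
move=> aA sA nA; split.
  by apply: subalg_add_row => // u uA; apply: submx_trans (nA u uA) _; apply: addsmxSl.
by apply: solvable_of_derived sA; apply: derived_add_row.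
Qed.

(** An Engel argument: for a maximal solvable subalgebra [M] of [Q], Lie's theorem gives an
    eigenvector [z] outside [M] modulo [M]. Nilpotency makes its eigenvalues zero, so [z] normalizes
    [M] and can be added to it. *)
Lemma nilpotent_subalg_solvable Q : subalg Q ->
  (forall u, (u <= Q)%MS -> ad_nilpotent br u) -> lie_solvable br Q.
Proof.
move=> aQ nQ.
have [|M [MQ aM sM] maxM] := @exists_max_rank K n
    (fun M => [/\ (M <= Q)%MS, subalg M & lie_solvable br M]) 0.
  split; first by rewrite sub0mx.
    by move=> u v; rewrite submx0 => /eqP-> _; rewrite br0l sub0mx.
  by exists 0%N; rewrite sub0mx.
have [QM|nQM] := boolP (Q <= M)%MS; first exact: solvable_mono sM.
have [||z [zQ zM zu]] := @lie_thm M M Q aM sM _ _ MQ nQM.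
- by move=> u w uM wM; apply: aM.
- by move=> u w uM wQ; apply: aQ => //; apply: submx_trans MQ.
have zN u : (u <= M)%MS -> (br u z <= M)%MS.
  move=> uM; have [a ea] := zu u uM.
  have a0 : a = 0.
    by apply: (eig_nilpotent0 (nQ u _) _ zM ea) => [|w wM]; [exact: submx_trans MQ|exact: aM].
  by rewrite a0 scale0r subr0 in ea.
have [aMz sMz] := solvable_add_row aM sM zN.
have := rank_adds_row zM; rewrite ltnNge maxM//; split=> //.
by rewrite addsmx_sub MQ.
Qed.

Lemma cartan_criterion S : subalg S ->
  (forall u v, (u <= lie_derived br S)%MS -> (v <= S)%MS -> kf u v = 0) ->
  lie_solvable br S.
Proof.
move=> aS kS; apply: (@solvable_of_derived S (lie_derived br S)) => //.
apply: nilpotent_subalg_solvable; first exact: subalg_derived.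
by move=> u uS; apply: nilpotent_of_kf kS.
Qed.

Lemma kf_gram : exists G : 'M[K]_n, forall u v, kf u v = (u *m G *m v^T) 0 0.
Proof.
exists (\matrix_(i < n, j < n) kf (delta_mx 0 i) (delta_mx 0 j)) => u v.
rewrite [in LHS](row_sum_delta u) [in LHS](row_sum_delta v) kf_suml !mxE.
under eq_bigr do rewrite kf_sumr.
rewrite exchange_big /=; apply: eq_bigr => j _; rewrite !mxE mulr_suml.
by apply: eq_bigr => i _; rewrite kfZl kfZr !mxE mulrCA mulrC; ring.
Qed.

(** * Semisimple algebras: nondegenerate Killing form, inner derivations *)

Section Semisimple.
Hypothesis ss : semisimple br.

Lemma kf_nondeg u : (forall v, kf u v = 0) -> u = 0.
Proof.
have [||I IP] := @subspace_mx K n (fun u => forall v, kf u v = 0).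
- by move=> v; rewrite kf0l.
- by move=> a u1 u2 e1 e2 v; rewrite kf_linl e1 e2 mulr0 addr0.
have idI : lie_ideal br I.
  by move=> x v /IP vI; apply/IP => w; rewrite brC kfNl kf_inv vI oppr0.
move=> /IP uI; apply/eqP; rewrite -submx0; apply: submx_trans uI _; apply: ss => //.
have aI : subalg I by move=> x v xI vI; apply: idI.
apply: cartan_criterion => // x v xI _.
by apply: (IP x).1; apply: submx_trans (derived_subalg aI).
Qed.

Lemma ad_inj u : ad br u = 0 -> u = 0.
Proof. by move=> u0; apply: kf_nondeg => v; rewrite /kf u0 mul0mx mxtrace0. Qed.

Lemma center0 u : (forall v, br u v = 0) -> u = 0.
Proof. by move=> u0; apply: ad_inj; apply: mx_ext => v; rewrite mul_ad u0 mulmx0. Qed.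

Lemma kf_represent (f : {linear vec -> K^o}) : exists e, forall v, f v = kf e v.
Proof.
have [G GE] := kf_gram.
have uG : G \in unitmx.
  rewrite -row_free_unit -kermx_eq0; apply/rowV0P => u /sub_kermxP uG.
  by apply: kf_nondeg => v; rewrite GE uG mul0mx mxE.
exists ((\row_i f (delta_mx 0 i)) *m invmx G) => v.
rewrite GE mulmxKV// [in LHS](row_sum_delta v) linear_sum !mxE.
by apply: eq_bigr => i _; rewrite linearZ /= !mxE mulrC.
Qed.

(** The element [x] represents the functional sending [v] to the trace of [D *m ad br v]. Then
    [E = D - ad br x] is trace-orthogonal to every [ad br v], and [kf (u *m E) v] is, by cyclicity,
    the trace of [E] against the [ad] of a bracket. *)
Lemma der_inner D : is_der D -> exists x, D = ad br x.
Proof.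
move=> dD.
have L : linear (fun v => \tr (D *m ad br v) : K^o).
  by move=> a u v; rewrite ad_lin mulmxDr -scalemxAr mxtraceD mxtraceZ.
pose f : {linear vec -> K^o} := HB.pack (fun v => \tr (D *m ad br v) : K^o) (GRing.isLinear.Build K vec K^o *:%R _ L).
have [x xP] := kf_represent f; exists x.
have dE : is_der (D - ad br x).
  by move=> u v; rewrite !mulmxBr dD der_ad brDl brDr brNl brNr opprD addrACA.
apply/eqP; rewrite -subr_eq0; apply/eqP; apply: mx_ext => u; rewrite mulmx0.
apply: kf_nondeg => v; rewrite /kf ad_der// mulmxBl raddfB /= -mulmxA mxtrace_mulC.
rewrite -mulmxA -raddfB /= -[X in _ - X]mulmxA -mulmxBr -ad_br mulmxBl raddfB /=.
by rewrite -/(kf _ _) -xP subrr.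
Qed.

(** * Borel subalgebras, Jordan decomposition and Cartan subalgebras *)

Definition max_solvable B := [/\ subalg B, lie_solvable br B &
  forall B', subalg B' -> lie_solvable br B' -> (B <= B')%MS -> (B' <= B)%MS].

Lemma exists_max_solvable S : subalg S -> lie_solvable br S ->
  exists2 B, max_solvable B & (S <= B)%MS.
Proof.
move=> aS sS; have [|B [aB sB SB] mxB] := @exists_max_rank K n
  (fun B => [/\ subalg B, lie_solvable br B & (S <= B)%MS]) S; first by split.
exists B => //; split=> // B' aB' sB' BB'; rewrite -(mxrank_leqif_sup BB') eqn_leq mxrankS//=.
by apply: mxB; split=> //; apply: submx_trans BB'.
Qed.

Section MaxSolvable.
Variable B : 'M[K]_n.
Hypothesis mB : max_solvable B.
Let aB : subalg B. Proof. by case: mB. Qed.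
Let sB : lie_solvable br B. Proof. by case: mB. Qed.

Lemma max_solvable_norm z : (forall u, (u <= B)%MS -> (br u z <= B)%MS) -> (z <= B)%MS.
Proof.
move=> nz; have [_ _ mx] := mB; have [aBz sBz] := solvable_add_row aB sB nz.
by apply: submx_trans (mx _ aBz sBz (addsmxSl _ _)); apply: addsmxSr.
Qed.

(* If [z] in the orthogonal of [B] is an eigenvector of [B] modulo [B], the
   Killing form vanishes on the derived algebra of [B + Kz], so [B + Kz] is
   solvable by Cartan's criterion. *)
Lemma max_solvable_perp z : (forall u, (u <= B)%MS -> kf z u = 0) -> (z <= B)%MS.
Proof.
have [||N NP] := @subspace_mx K n (fun z => forall u, (u <= B)%MS -> kf z u = 0).
- by move=> u _; rewrite kf0l.
- by move=> a u1 u2 e1 e2 v vB; rewrite kf_linl e1// e2// mulr0 addr0.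
move=> /NP; suff NB : (N <= B)%MS by move/submx_trans; apply.
apply/negPn/negP => nNB.
have sN : lie_stab B N.
  by move=> u v uB /NP vN; apply/NP => w wB; rewrite brC kfNl kf_inv vN ?oppr0 ?aB.
have [||||y [yN yB ye]] := @lie_thm B (N :&: B)%MS N aB sB.
- by move=> u v uB; rewrite !sub_capmx => /andP[vN vB]; rewrite sN ?aB.
- exact: sN.
- exact: capmxSl.
- by rewrite sub_capmx submx_refl.
have kyB u : (u <= B)%MS -> kf y u = 0 by move/NP: yN => yN; exact: yN.
have nyB : ~~ (y <= B)%MS by move: yB; rewrite sub_capmx yN.
have aBy : subalg (B + y)%MS.
  apply: subalg_add_row => // u /ye[a]; rewrite sub_capmx => /andP[_ eB].
  by apply/sub_adds_rowP; exists a, (br u y - a *: y); rewrite subrK.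
have sBy : lie_solvable br (B + y)%MS.
  apply: cartan_criterion => // u v uD vB.
  have [||M MP] := @subspace_mx K n (fun u => kf u v = 0).
  - by rewrite kf0l.
  - by move=> a u1 u2 e1 e2; rewrite kf_linl e1 e2 mulr0 addr0.
  apply/MP; apply: submx_trans uD _; apply: derived_sub => {u}.
  move=> _ _ /sub_adds_rowP[a [u [uB ->]]] /sub_adds_rowP[b [w [wB ->]]]; apply/MP.
  have /sub_adds_rowP[c [v' [v'B ->]]] := vB.
  rewrite kfDr kfZr brDl !brDr !brZl !brZr brxx !scaler0 addr0 !kfDl !kfZl.
  have h1 p q : (p <= B)%MS -> (q <= B)%MS -> kf (br p y) q = 0.
    by move=> pB qB; rewrite brC kfNl kf_inv kyB ?oppr0// aB.
  have h2 p : kf (br p y) y = 0 by rewrite kf_inv brxx kf0r.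
  have h3 p q : (p <= B)%MS -> (q <= B)%MS -> kf (br p q) y = 0.
    by move=> pB qB; rewrite kfC kyB// aB.
  rewrite (brC y w) !kfNl !h2 !h1// (kf_solvable aB sB)// h3//.
  by rewrite !(oppr0, mulr0, addr0).
have [_ _ mx] := mB; have := mx _ aBy sBy (addsmxSl _ _).
by rewrite addsmx_sub (negPf nyB) andbF.
Qed.

(** For the converse, the conjugate part of [ad br z] is inner, say [ad br x]. It preserves [B]
    because [ad br z] maps [B] into [B]; so [x] normalizes [B], lies in it, and [kf z x = 0] forces
    nilpotency. *)
Lemma max_solvable_nilp z : (z <= B)%MS ->
  ad_nilpotent br z <-> forall u, (u <= B)%MS -> kf z u = 0.
Proof.
move=> zB; split=> [nz u uB|kz]; first exact: (kf_nilpotent aB sB).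
have [E [dE sE trE]] := conj_part (der_ad z); have [x xE] := der_inner dE.
exists n; apply: trE; rewrite xE; apply: kz; apply: max_solvable_norm => u uB.
rewrite brC eqmx_opp -mul_ad -xE; apply: sE => [w wB|]; rewrite mul_ad aB//.
Qed.

Local Notation semis z := (diagonalizable (ad br z)).

(** Jordan decomposition: the polynomial in [ad br z] acting as [a] on the generalized eigenspace
    for [a] is a derivation, hence inner. Having no constant term, it inherits inclusions from
    [ad br z]. *)
Lemma semisimple_part z : exists zs, [/\ semis zs, ad_nilpotent br (z - zs) &
  forall A v, (forall u, (u <= A)%MS -> (br z u <= A)%MS) -> (br z v <= A)%MS -> (br zs v <= A)%MS].
Proof.
have [P [/dvdpP[q Pq] PD]] := @poly_part K n' (ad br z) id (erefl 0).
have dP := der_horner (f := id) (fun _ _ => erefl) (der_ad z) PD.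
have [zs ezs] := der_inner dP; exists zs.
have n2 : (n <= 2 * n)%N by rewrite leq_pmull.
split.
- rewrite -ezs; have [rs cp] := char_poly_split (ad br z).
  apply/diagonalizablePeigen; exists (undup rs); first exact: undup_uniq.
  apply/eqmxP; rewrite submx1/=; apply: row_ext_sub => v _.
  elim/(@gen_eig_ind _ _ (ad br z)): v => [|u v Qu Qv|a v va].
  + by rewrite sub0mx.
  + exact: addmx_sub.
  have [v0|v0] := eqVneq v 0; first by rewrite v0 sub0mx.
  have ars : a \in undup rs.
    rewrite mem_undup -root_prod_XsubC -cp -eigenvalue_root_char.
    have [//|na] := boolP (eigenvalue (ad br z) a); case/eqP: v0.
    move: na => /not_eigenvalue_unit /(unitrX n); rewrite -[_ \is a _]/(_ \in unitmx) => uX.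
    by rewrite -(mulmxK uX v) va mul0mx.
  rewrite (big_rem a)//=; apply: submx_trans (addsmxSl _ _).
  by apply/eigenspaceP; apply: (PD n).
- exists n; rewrite adD adN -ezs.
  apply: mx_ext => v; rewrite mulmx0; elim/(@gen_eig_ind _ _ (ad br z)): v => [|u v Qu Qv|a v va].
  + by rewrite mul0mx.
  + by rewrite mulmxDl Qu Qv addr0.
  have : forall j, v *m (ad br z - horner_mx (ad br z) P) ^+ j = v *m (ad br z - a%:M) ^+ j.
    elim=> [|j IH]; first by rewrite !expr0.
    rewrite !exprSr -!mulmxE !mulmxA IH !mulmxBr mul_mx_scalar; congr (_ - _).
    have c : GRing.comm ((ad br z - a%:M) ^+ j) (horner_mx (ad br z) P).
      apply/commr_sym/commrX/commr_sym; rewrite -(horner_mx_C (ad br z)) -[X in X - _]horner_mx_X -rmorphB.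
      exact: comm_horner_mx2.
    by rewrite -!mulmxA [X in _ *m X]c mulmxA (PD n a)// -scalemxAl.
  by move=> ->.
- move=> A v sA vA; rewrite -mul_ad -ezs Pq mulrC rmorphM /= horner_mx_X -mulmxE mulmxA.
  by apply: horner_stable => [u uA|]; rewrite mul_ad// sA.
Qed.

Lemma comm_ad u v : br u v = 0 -> comm_mx (ad br u) (ad br v).
Proof. by move=> uv; apply/eqP; rewrite eq_sym -subr_eq0 -ad_br uv ad0. Qed.

Lemma kf_proj (T : 'M[K]_n) : (forall u, (u <= T)%MS -> (forall v, (v <= T)%MS -> kf u v = 0) -> u = 0) ->
  forall z, exists2 t : vec, (t <= T)%MS & forall v, (v <= T)%MS -> kf (z - t) v = 0.
Proof.
move=> ndT z; have [G GE] := kf_gram; pose R := row_base T.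
have RT v : (v <= T)%MS -> exists d, v = d *m R.
  by rewrite -(eq_row_base T) => /submxP[d ->]; exists d.
pose M := R *m G *m R^T.
have uM : M \in unitmx.
  rewrite -row_free_unit -kermx_eq0; apply/rowV0P => d /sub_kermxP dM.
  have dR0 : d *m R = 0.
    apply: ndT => [|v /RT[c ->]]; first by rewrite -(eq_row_base T) submxMl.
    by rewrite GE trmx_mul mulmxA -!(mulmxA d) mulmxA dM mul0mx mxE.
  by apply: (row_free_inj (row_base_free T)); rewrite dR0 mul0mx.
pose t := z *m G *m R^T *m invmx M *m R.
have e : t *m G *m R^T = z *m G *m R^T.
  by rewrite -mulmxA -(mulmxA _ R) (mulmxA R G) -/M mulmxKV.
exists t; first by rewrite -(eq_row_base T) submxMl.
by move=> _ /RT[c ->]; rewrite kfDl kfNl !GE trmx_mul !mulmxA e subrr.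
Qed.

(* [T] consists of the semisimple elements of [B] that commute with a semisimple
   [u0 \in B] whose centralizer has minimal dimension. *)
Theorem cartan_subalgebra : exists T P : 'M[K]_n, [/\ P \in unitmx, (T <= B)%MS,
  forall u, (u <= T)%MS -> is_diag_mx (P *m ad br u *m invmx P),
  (forall v, (forall u, (u <= T)%MS -> br u v = 0) -> (v <= T)%MS) &
  forall u, (u <= T)%MS -> (forall v, (v <= T)%MS -> kf u v = 0) -> u = 0].
Proof.
pose good r := `[<exists u, [/\ (u <= B)%MS, semis u & \rank (kermx (ad br u)) = r]>].
have exg : exists r, good r.
  exists (\rank (kermx (ad br 0))); apply/asboolP; exists 0; split=> //; first exact: sub0mx.
  by rewrite ad0; apply: diagonalizable0.
have [r /asboolP[u0 [u0B u0s u0r]] minr] := ex_minnP exg.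
have kerE u v : (v <= kermx (ad br u))%MS <-> br u v = 0.
  by rewrite -mul_ad; split=> [/sub_kermxP|e] //; apply/sub_kermxP.
(* Avoiding finitely many ratios, [e *: z + u0] has an eigenvalue 0 only where [u0] has, so its
   centralizer lies in that of [u0]. By minimality they coincide, and then [z] commutes with this
   centralizer. *)
have central z : (z <= B)%MS -> br u0 z = 0 -> semis z -> forall v, br u0 v = 0 -> br z v = 0.
  move=> zB u0z zs.
  have [P uP [dU dZ]] := codiag2 (comm_ad u0z) u0s zs.
  set a := P *m ad br u0 *m invmx P in dU; set b := P *m ad br z *m invmx P in dZ.
  have [e] := fresh_elt (0 :: [seq - (a i i / b i i) | i : 'I_n]).
  rewrite inE negb_or => /andP[e0 eab].
  have ad' : ad br (e *: z + u0) = e *: ad br z + ad br u0 by rewrite ad_lin.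
  have dE : P *m ad br (e *: z + u0) *m invmx P = e *: b + a.
    by rewrite ad' mulmxDr mulmxDl -scalemxAr -scalemxAl.
  have d' : is_diag_mx (e *: b + a) by apply: is_diag_lin.
  have ker_sub : (kermx (ad br (e *: z + u0)) <= kermx (ad br u0))%MS.
    apply: row_ext_sub => v /sub_kermxP v0; apply/sub_kermxP.
    have dd : is_diag_mx (P *m ad br (e *: z + u0) *m invmx P) by rewrite dE.
    apply/(ker_diag v uP dU) => i; have := (ker_diag v uP dd).1 v0 i; rewrite dE -/a.
    rewrite [(_ + a) i i]mxE [(_ *: b) i i]mxE.
    move/eqP; rewrite mulf_eq0 => /orP[/eqP->|]; first by rewrite mul0r.
    have [->|b0 ab] := eqVneq (b i i) 0; first by rewrite mulr0 add0r => /eqP->; rewrite mulr0.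
    case/negP: eab; apply/mapP; exists i; rewrite ?mem_enum//.
    apply/eqP; rewrite -mulNr -(inj_eq (mulIf b0)) mulfVK//.
    by rewrite -addr_eq0.
  have gd : good (\rank (kermx (ad br (e *: z + u0)))).
    apply/asboolP; exists (e *: z + u0); split=> //; first by rewrite addmx_sub ?scalemx_sub.
    by apply: (diagonalizable_conj uP); rewrite dE.
  have : (kermx (ad br u0) <= kermx (ad br (e *: z + u0)))%MS.
    by rewrite -(mxrank_leqif_sup ker_sub) eqn_leq mxrankS//= u0r minr.
  move=> sub v u0v; have /kerE := submx_trans ((kerE _ _).2 u0v) sub.
  rewrite brDl u0v addr0 brZl => /eqP; rewrite scaler_eq0 (negPf e0) /=.
  by move/eqP.
have [||T TP] := @subspace_mx K n (fun z => [/\ (z <= B)%MS, br u0 z = 0 & semis z]).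
- by rewrite sub0mx br0r ad0; split=> //; apply: diagonalizable0.
- move=> a z1 z2 [z1B u01 s1] [z2B u02 s2]; split; first by rewrite addmx_sub ?scalemx_sub.
    by rewrite brDr brZr u01 u02 scaler0 addr0.
  by rewrite ad_lin; apply: diag_lin => //; apply: comm_ad; apply: central.
have TC z v : (z <= T)%MS -> br u0 v = 0 -> br z v = 0 by move=> /TP[? ? ?]; apply: central.
have TB : (T <= B)%MS by apply: row_ext_sub => z /TP[].
have TT u v : (u <= T)%MS -> (v <= T)%MS -> br u v = 0 by move=> uT /TP[_ + _]; apply: TC.
have brC0 u v w : br u v = 0 -> br u w = 0 -> br u (br v w) = 0.
  by move=> uv uw; have := jacobi u v w; rewrite uv uw br0l br0r subr0.
have BC z : (z <= B)%MS -> br u0 z = 0 -> exists t y, [/\ (t <= T)%MS, (y <= B)%MS, br u0 y = 0, ad_nilpotent br y & z = t + y].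
  move=> zB u0z; have [zs [zss zn zA]] := semisimple_part z.
  have zsB : (zs <= B)%MS.
    apply: max_solvable_norm => u uB; rewrite brC eqmx_opp; apply: zA => [v vB|]; exact: aB.
  have u0zs : br u0 zs = 0.
    have : (br zs u0 <= (0 : 'M_n))%MS.
      by apply: zA => [v|]; [rewrite submx0 => /eqP->; rewrite br0r sub0mx | rewrite brC u0z oppr0 sub0mx].
    by rewrite submx0 brC oppr_eq0 => /eqP.
  exists zs, (z - zs); split=> //; first by apply/TP.
  - by rewrite addmx_sub ?eqmx_opp.
  - by rewrite brDr brNr u0z u0zs subr0.
  - by rewrite addrC subrK.
have kBT z y : (z <= B)%MS -> (y <= B)%MS -> ad_nilpotent br y -> kf z y = 0.
  by move=> zB yB ny; rewrite kfC; apply: (kf_nilpotent aB sB).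
(* A vector of [W] is the sum of one commuting with [u0] and some [br u0 v2]; by invariance, an
   element [z] commuting with [u0] is orthogonal to the latter. *)
have split_kf (W : 'M_n) z : (forall u, (u <= W)%MS -> (br u0 u <= W)%MS) -> br u0 z = 0 ->
    (forall v, (v <= W)%MS -> br u0 v = 0 -> kf z v = 0) -> forall v, (v <= W)%MS -> kf z v = 0.
  move=> sW u0z zW v vW; have [|v1 [v2 [v10 v1W v2W ->]]] := @diag_split _ _ _ W v u0s _ vW.
    by move=> u uW; rewrite mul_ad sW.
  by rewrite kfDr zW -?mul_ad// mul_ad -kf_inv brC u0z oppr0 kf0l addr0.
have stB u : (u <= B)%MS -> (br u0 u <= B)%MS by move=> uB; apply: aB.
have perpB z : br u0 z = 0 -> (forall v, (v <= T)%MS -> kf z v = 0) ->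
    (forall v, (v <= B)%MS -> br u0 v = 0 -> ad_nilpotent br v -> kf z v = 0) ->
    forall v, (v <= B)%MS -> kf z v = 0.
  move=> u0z zT zN; apply: (split_kf B) => // v vB u0v; have [t [y [tT yB u0y ny ->]]] := BC v vB u0v.
  by rewrite kfDr zT// zN// addr0.
have ndT u : (u <= T)%MS -> (forall v, (v <= T)%MS -> kf u v = 0) -> u = 0.
  move=> uT uT0; have [uB u0u us] := (TP u).1 uT.
  have /(max_solvable_nilp uB)[k uk] : forall v, (v <= B)%MS -> kf u v = 0.
    by apply: perpB => // v vB _ nv; apply: kBT.
  by apply: ad_inj; apply: diag_nilpotent0 uk.
(* [C'] is the orthogonal of [T] in the centralizer of [u0], and [N], its part in [B] orthogonal to
   [B], consists of nilpotents. If [N] were smaller, Lie's theorem would give [y] in [C'] outside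
   [N] normalizing [N]. As [N + Ky] is solvable, [y] is orthogonal to [N], hence to [B], hence lies
   in [B] and in [N]. *)
have perpN z : br u0 z = 0 -> (forall v, (v <= T)%MS -> kf z v = 0) ->
   forall u, (u <= B)%MS -> kf z u = 0.
  have [||N NP] := @subspace_mx K n (fun z => [/\ (z <= B)%MS, br u0 z = 0 & forall u, (u <= B)%MS -> kf z u = 0]).
  - by rewrite sub0mx br0r; split=> // u _; rewrite kf0l.
  - move=> a z1 z2 [z1B u01 s1] [z2B u02 s2]; split; first by rewrite addmx_sub ?scalemx_sub.
      by rewrite brDr brZr u01 u02 scaler0 addr0.
    by move=> u uB; rewrite kf_linl s1// s2// mulr0 addr0.
  have [||C' CP] := @subspace_mx K n (fun z => br u0 z = 0 /\ forall v, (v <= T)%MS -> kf z v = 0).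
  - by rewrite br0r; split=> // u _; rewrite kf0l.
  - move=> a z1 z2 [u01 s1] [u02 s2]; split; first by rewrite brDr brZr u01 u02 scaler0 addr0.
    by move=> u uB; rewrite kf_linl s1// s2// mulr0 addr0.
  suff CN : (C' <= N)%MS.
    by move=> u0z zT; have /NP[] : (z <= N)%MS by apply: submx_trans CN; apply/CP.
  have NC : (N <= C')%MS.
    by apply: row_ext_sub => u /NP[uB u0u ku]; apply/CP; split=> // v vT; apply: ku; apply: submx_trans TB.
  have aN : subalg N.
    move=> u v /NP[uB u0u ku] /NP[vB u0v kv]; apply/NP; split; [exact: aB | exact: brC0 |].
    by move=> w wB; rewrite kf_inv ku// aB.
  have sN : lie_solvable br N by apply: solvable_mono sB; apply: row_ext_sub => u /NP[].
  have nilN u : (u <= N)%MS -> ad_nilpotent br u by move=> /NP[uB _ ku]; apply/max_solvable_nilp.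
  apply/negPn/negP => nCN.
  have [||y [yC yN yS]] := @lie_thm N N C' aN sN _ _ NC nCN.
  - exact: aN.
  - move=> u v /NP[uB u0u ku] /CP[u0v kv]; apply/CP; split; first exact: brC0.
    by move=> t tT; rewrite kf_inv (brC v t) (TC t)// oppr0 kf0r.
  have Ny u : (u <= N)%MS -> (br u y <= N)%MS.
    move=> uN; have [a ea] := yS u uN.
    have a0 : a = 0 by apply: (eig_nilpotent0 (nilN u uN) _ yN ea) => w; apply: aN.
    by rewrite a0 scale0r subr0 in ea.
  have [aNy sNy] := solvable_add_row aN sN Ny.
  have kNy v : (v <= N)%MS -> kf y v = 0.
    move=> vN; rewrite kfC; apply: (kf_nilpotent aNy sNy); last exact: nilN.
      by apply: submx_trans vN _; apply: addsmxSl.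
    exact: addsmxSr.
  have [u0y yT] := (CP y).1 yC.
  have yB : forall v, (v <= B)%MS -> kf y v = 0.
    apply: perpB => // v vB u0v nv; apply: kNy; apply/NP; split=> //.
    by apply/max_solvable_nilp.
  by case/negP: yN; apply/NP; split=> //; apply: max_solvable_perp.
(* Subtracting projections to [T] leaves elements orthogonal to [B], which lie in [B]. So [z - t] is
   orthogonal to everything commuting with [u0], and then to the whole algebra. *)
have CT z : br u0 z = 0 -> (z <= T)%MS.
  move=> u0z; have [t tT zt] := kf_proj ndT z.
  suff /eqP : z - t = 0 by rewrite subr_eq0 => /eqP->.
  have u0t : br u0 t = 0 by have [] := (TP t).1 tT.
  have u0y : br u0 (z - t) = 0 by rewrite brDr brNr u0z u0t subr0.
  have yB := perpN _ u0y zt.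
  apply: kf_nondeg => v; apply: (split_kf 1%:M) (submx1 v) => // [u _|{}v _ u0v]; first exact: submx1.
  have [t' t'T vt'] := kf_proj ndT v.
  have u0t' : br u0 t' = 0 by have [] := (TP t').1 t'T.
  rewrite -(subrK t' v) kfDr (zt t')// addr0; apply: yB; apply: max_solvable_perp.
  by apply: perpN => //; rewrite brDr brNr u0v u0t' subr0.
have [Q uQ] : codiagonalizable [seq ad br (row i T) | i : 'I_n].
  apply/codiagonalizableP; split=> [_ _ /mapP[i _ ->] /mapP[j _ ->]|_ /mapP[i _ ->]].
    by apply: comm_ad; apply: TT; apply: row_sub.
  by have /TP[] := row_sub i T.
move=> /allP dQ; exists T, Q; split=> // [u uT|v vT].
  have /submxP[d ->] := uT; rewrite mulmx_sum_row ad_sum mulmx_sumr mulmx_suml.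
  apply: (big_ind is_diag_mx) => [|A A' dA dA'|i _]; first exact: mx0_is_diag.
    by have := is_diag_lin 1 dA dA'; rewrite scale1r.
  rewrite adZ -scalemxAr -scalemxAl -[_ *: _]addr0 is_diag_lin ?mx0_is_diag//.
  have := dQ (ad br (row i T)); rewrite /similar_to /= conjumx//; apply.
  by apply/mapP; exists i; rewrite ?mem_enum.
apply: CT; apply: vT; apply/TP; split=> //; exact: brxx.
Qed.

(** * Roots *)

Lemma eigen_finite (X : 'M[K]_n) (f : nat -> vec) (c : nat -> K) : injective c ->
  (forall j, f j *m X = c j *: f j) -> exists j, f j = 0.
Proof.
move=> ic fX; apply/not_existsP => nf; have nf0 j : f j != 0 by apply/eqP/nf.
pose s := [seq c j | j <- iota 0 n.+1].
have us : uniq s by rewrite map_inj_uniq ?iota_uniq.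
have rs : all (root (char_poly X)) s.
  apply/allP => _ /mapP[j _ ->]; rewrite -eigenvalue_root_char.
  by apply/eigenvalueP; exists (f j).
have := max_poly_roots (monic_neq0 (char_poly_monic X)) rs us.
by rewrite size_char_poly size_map size_iota ltnn.
Qed.

(** * Triples spanning sl2 *)

Section Sl2.
Variables E F H : vec.
Hypotheses (brEF : br E F = H) (brHF : br H F = - 2 *: F).

Definition lower j w := w *m ad br F ^+ j.

Lemma lowerS j w : lower j.+1 w = br F (lower j w).
Proof. by rewrite /lower exprSr -mulmxE mulmxA mul_ad. Qed.

Lemma lower_weight mu w j : br H w = mu *: w -> br H (lower j w) = (mu - 2 * j%:R) *: lower j w.
Proof.
move=> Hw; elim: j => [|j IH]; first by rewrite /lower expr0 mulmx1 mulr0 subr0.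
rewrite lowerS; have := jacobi H F (lower j w); rewrite brHF brZl IH brZr => e.
have -> : br H (br F (lower j w)) = - 2 *: br F (lower j w) + (mu - 2 * j%:R) *: br F (lower j w).
  by rewrite e subrK.
by rewrite -scalerDl; congr (_ *: _); rewrite -natr1; ring.
Qed.

(** The usual formula for highest weight vectors persists when [br E w] is merely killed by [F].
    This weaker hypothesis is the one refuted in [sl2_raise_ne0]. *)
Lemma raise_lower mu w j : br H w = mu *: w -> br F (br E w) = 0 ->
  br E (lower j.+1 w) = (j.+1%:R * (mu - j%:R)) *: lower j w.
Proof.
move=> Hw FEw.
have step v : br E (br F v) = br F (br E v) + br H v.
  by have := jacobi E F v; rewrite brEF => ->; rewrite addrC subrK.
elim: j => [|j IH].
  by rewrite lowerS step /lower expr0 !mulmx1 FEw add0r Hw subr0 mul1r.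
rewrite lowerS step IH brZr -lowerS (lower_weight _ Hw) -scalerDl; congr (_ *: _).
by rewrite -[in RHS]natr1 -natr1; ring.
Qed.

Lemma lower_nilp mu w : br H w = mu *: w -> exists j, lower j w = 0.
Proof.
move=> Hw; apply: (@eigen_finite (ad br H) (lower^~ w) (fun j => mu - 2 * j%:R)).
  move=> i j /addrI/oppr_inj/mulfI; rewrite pnatr_eq0 => /(_ isT)/eqP.
  by rewrite eqr_nat => /eqP.
by move=> j; rewrite mul_ad (lower_weight _ Hw).
Qed.

Lemma lower_last mu w : w != 0 -> br H w = mu *: w ->
  exists2 j, lower j w != 0 & lower j.+1 w = 0.
Proof.
move=> w0 /lower_nilp ex; have ex' : exists j, lower j w == 0 by have [j ?] := ex; exists j; apply/eqP.
have [[|j] /eqP lj mj] := ex_minnP ex'; first by rewrite /lower expr0 mulmx1 in lj; rewrite lj eqxx in w0.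
by exists j => //; apply/negP => /mj; rewrite ltnn.
Qed.

Lemma sl2_nat mu w : w != 0 -> br H w = mu *: w -> br F (br E w) = 0 -> exists m, mu = m%:R.
Proof.
move=> w0 Hw FEw; have [j lj ljS] := lower_last w0 Hw.
have := raise_lower j Hw FEw; rewrite ljS br0r => /esym/eqP.
rewrite scaler_eq0 (negPf lj) orbF mulf_eq0 pnatr_eq0 /= subr_eq0 => /eqP->.
by exists j.
Qed.

End Sl2.

Lemma sl2_opp E F H : br E F = H -> br H E = 2 *: E -> br H F = - 2 *: F ->
  [/\ br F E = - H, br (- H) F = 2 *: F & br (- H) E = - 2 *: E].
Proof. by move=> eH HE HF; rewrite brC eH !brNl HE HF scaleNr opprK -scaleNr. Qed.

(** If [F] killed [br E w], then [mu] would be a natural number. For the opposite triple, [br E w]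
    would be a highest weight vector of weight [- (mu + 2)], which would also have to be natural. *)
Lemma sl2_raise_ne0 E F H w mu : br E F = H -> br H E = 2 *: E -> br H F = - 2 *: F ->
  br H w = mu *: w -> br E w != 0 -> br F (br E w) != 0.
Proof.
move=> eH HE HF Hw Ew; apply/eqP => FEw.
have w0 : w != 0 by apply: contraNneq Ew => ->; rewrite br0r.
have [m em] := sl2_nat eH HF w0 Hw FEw.
have [eH' HE' HF'] := sl2_opp eH HE HF.
have HEw : br (- H) (br E w) = - (mu + 2) *: br E w.
  rewrite brNl; have := jacobi H E w; rewrite HE Hw brZl brZr => /eqP.
  by rewrite eq_sym subr_eq => /eqP->; rewrite -scalerDl -scaleNr addrC.
have [|m' em'] := sl2_nat eH' HF' Ew HEw; first by rewrite FEw br0r.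
have : (m' + (m + 2))%:R = 0 :> K by rewrite natrD -em' natrD -em; ring.
by move/eqP; rewrite pnatr_eq0 addnA addn2.
Qed.

(** * Root vectors, positive roots and a real grading *)

Section Roots.
Variables T P : 'M[K]_n.
Hypotheses (uP : P \in unitmx) (TB : (T <= B)%MS).
Hypothesis dT : forall u, (u <= T)%MS -> is_diag_mx (P *m ad br u *m invmx P).
Hypothesis cT : forall v, (forall u, (u <= T)%MS -> br u v = 0) -> (v <= T)%MS.
Hypothesis ndT : forall u, (u <= T)%MS -> (forall v, (v <= T)%MS -> kf u v = 0) -> u = 0.

(** The rows of [P] are weight vectors for [T], [al i] is the weight of row [i] and [comp i] the
    coordinate along it. Roots are handled as indices; [root_inj] shows that a root determines its
    index. *)
Definition e_ i := row i P.
Definition al i u := (P *m ad br u *m invmx P) i i.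
Definition comp i v := (v *m invmx P) 0 i.

Lemma comp_lin i a u v : comp i (a *: u + v) = a * comp i u + comp i v.
Proof. by rewrite /comp mulmxDl -scalemxAl !mxE. Qed.
Lemma compZ i a u : comp i (a *: u) = a * comp i u.
Proof. by rewrite /comp -scalemxAl !mxE. Qed.
Lemma compD i u v : comp i (u + v) = comp i u + comp i v.
Proof. by rewrite /comp mulmxDl !mxE. Qed.
Lemma comp0 i : comp i 0 = 0. Proof. by rewrite /comp mul0mx mxE. Qed.
Lemma comp_e i j : comp i (e_ j) = (j == i)%:R.
Proof. by rewrite /comp /e_ -row_mul mulmxV// !mxE. Qed.

Lemma comp_sum v : v = \sum_i comp i v *: e_ i.
Proof.
rewrite -[LHS](mulmxKV uP) mulmx_sum_row; apply: eq_bigr => i _.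
by rewrite /comp.
Qed.

Lemma comp_ext u v : (forall i, comp i u = comp i v) -> u = v.
Proof. by move=> uv; rewrite [u]comp_sum [v]comp_sum; apply: eq_bigr => i _; rewrite uv. Qed.

Lemma comp_ne0 v : v != 0 -> exists i, comp i v != 0.
Proof.
move=> v0; apply/existsP; apply: contraNT v0; rewrite negb_exists => /forallP v0.
apply/eqP; apply: comp_ext => i; rewrite comp0.
by apply/eqP; move: (v0 i); rewrite negbK.
Qed.

Lemma e_neq0 i : e_ i != 0.
Proof. by apply/eqP => ei; have /eqP := comp_e i i; rewrite ei comp0 eqxx eq_sym oner_eq0. Qed.

Lemma al_lin i a u v : al i (a *: u + v) = a * al i u + al i v.
Proof. by rewrite /al ad_lin mulmxDr mulmxDl -scalemxAr -scalemxAl !mxE. Qed.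
Lemma alD i u v : al i (u + v) = al i u + al i v.
Proof. by have := al_lin i 1 u v; rewrite scale1r mul1r. Qed.
Lemma al0 i : al i 0 = 0. Proof. by apply: (addrI (al i 0)); rewrite -alD !addr0. Qed.
Lemma alZ i a u : al i (a *: u) = a * al i u.
Proof. by rewrite -[_ *: u]addr0 al_lin al0 addr0. Qed.
Lemma comp_br i u v : (u <= T)%MS -> comp i (br u v) = al i u * comp i v.
Proof.
move=> uT; rewrite /comp -mul_ad.
have -> : v *m ad br u *m invmx P = v *m invmx P *m (P *m ad br u *m invmx P).
  by rewrite !mulmxA mulmxKV.
by rewrite row_mul_diag ?dT// mulrC.
Qed.

Lemma br_e i u : (u <= T)%MS -> br u (e_ i) = al i u *: e_ i.
Proof.
move=> uT; apply: comp_ext => k; rewrite comp_br// compZ comp_e.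
by case: eqP => [->//|_]; rewrite !mulr0.
Qed.

Lemma br_T u v : (u <= T)%MS -> (v <= T)%MS -> br u v = 0.
Proof.
move=> uT vT; apply: ad_inj; apply: mx_ext => w; rewrite mulmx0 mul_ad.
by apply: comp_ext => k; rewrite jacobi compD -scaleN1r compZ !comp_br// comp0; ring.
Qed.

Lemma comp_weight v f k : (forall u, (u <= T)%MS -> br u v = f u *: v) -> comp k v != 0 ->
  forall u, (u <= T)%MS -> al k u = f u.
Proof.
move=> vf vk u uT; have := comp_br k v uT; rewrite vf// compZ.
by move/(mulIf vk).
Qed.

Lemma weight_br v w f g : (forall u, (u <= T)%MS -> br u v = f u *: v) ->
  (forall u, (u <= T)%MS -> br u w = g u *: w) ->
  forall u, (u <= T)%MS -> br u (br v w) = (f u + g u) *: br v w.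
Proof.
move=> vf wg u uT; have := jacobi u v w; rewrite (vf u uT) (wg u uT) brZl brZr => /eqP.
by rewrite eq_sym subr_eq => /eqP->; rewrite -scalerDl.
Qed.

Lemma comp_br_e i j k : comp k (br (e_ i) (e_ j)) != 0 ->
  forall u, (u <= T)%MS -> al k u = al i u + al j u.
Proof.
apply: (@comp_weight _ (fun u => al i u + al j u)); apply: weight_br => u uT; exact: br_e.
Qed.

Lemma kf_weight v w f g u : (forall u, (u <= T)%MS -> br u v = f u *: v) ->
  (forall u, (u <= T)%MS -> br u w = g u *: w) -> (u <= T)%MS -> (f u + g u) * kf v w = 0.
Proof.
move=> vf wg uT; have := kf_inv v u w; rewrite brC vf// wg// kfNl kfZl kfZr.
by move/eqP; rewrite -subr_eq0 -opprD oppr_eq0 -mulrDl => /eqP.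
Qed.

Definition isroot i := exists2 u, (u <= T)%MS & al i u != 0.

Lemma not_root i : ~ isroot i -> forall u, (u <= T)%MS -> al i u = 0.
Proof. by move=> nr u uT; apply/eqP/negPn/negP => a0; apply: nr; exists u. Qed.

Lemma not_root_T i : ~ isroot i -> (e_ i <= T)%MS.
Proof. by move=> nr; apply: cT => u uT; rewrite br_e// not_root// scale0r. Qed.

Lemma root_pair i : exists2 j, kf (e_ i) (e_ j) != 0 & forall u, (u <= T)%MS -> al j u = - al i u.
Proof.
have [j kij] : exists j, kf (e_ i) (e_ j) != 0.
  apply/existsP; apply: contraT; rewrite negb_exists => /forallP k0.
  case/negP: (e_neq0 i); apply/eqP/kf_nondeg => v; rewrite [v]comp_sum kf_sumr big1// => j _.
  by rewrite kfZr; move: (k0 j); rewrite negbK => /eqP->; rewrite mulr0.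
exists j => // u uT; have := @kf_weight (e_ i) (e_ j) (al i) (al j) u _ _ uT.
move=> /(_ (fun v vT => br_e i vT) (fun v vT => br_e j vT))/eqP.
by rewrite mulf_eq0 (negPf kij) orbF addrC addr_eq0 => /eqP.
Qed.

Lemma br_pair i v : (forall u, (u <= T)%MS -> br u v = - al i u *: v) ->
  (br (e_ i) v <= T)%MS /\ forall u, (u <= T)%MS -> kf (br (e_ i) v) u = al i u * kf (e_ i) v.
Proof.
move=> vi; split=> [|u uT].
  apply: cT => u uT; rewrite (weight_br (f := al i) (g := fun u => - al i u))//.
    by rewrite subrr scale0r.
  by move=> *; apply: br_e.
by rewrite kf_inv brC kfNr vi// kfZr mulNr opprK.
Qed.

(* [t] is dual to the root [al i]; were [al i t = 0], the trace argument of
   Cartan's criterion would make the semisimple element [t] nilpotent. *)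
Lemma root_dual i : isroot i -> exists j t, [/\ (t <= T)%MS,
  forall u, (u <= T)%MS -> kf t u = al i u,
  forall u, (u <= T)%MS -> al j u = - al i u, kf (e_ i) (e_ j) != 0 &
  t = (kf (e_ i) (e_ j))^-1 *: br (e_ i) (e_ j) /\ al i t != 0].
Proof.
move=> ri; have [j kij aj] := root_pair i.
have vj u : (u <= T)%MS -> br u (e_ j) = - al i u *: e_ j by move=> uT; rewrite br_e// aj.
have [bT bk] := br_pair vj.
pose t := (kf (e_ i) (e_ j))^-1 *: br (e_ i) (e_ j).
have tT : (t <= T)%MS by apply: scalemx_sub.
have tk u : (u <= T)%MS -> kf t u = al i u by move=> uT; rewrite kfZl bk// mulrCA mulVf ?mulr1.
exists j, t; split=> //; split=> //; apply/eqP => at0.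
have [E [dE sE trE]] := conj_part (der_ad t).
have jE : e_ j *m E = 0.
  apply/eqP; rewrite -submx0; apply: sE => [v|]; first by rewrite submx0 => /eqP->; rewrite mul0mx sub0mx.
  by rewrite mul_ad vj// at0 oppr0 scale0r sub0mx.
have tr0 : \tr (ad br t *m E) = 0.
  rewrite adZ -scalemxAl mxtraceZ ad_br mulmxBl raddfB /= -mulmxA mxtrace_mulC -raddfB /= -!mulmxA -mulmxBr.
  by rewrite -opprB -ad_der// jE ad0 oppr0 mulmx0 mxtrace0 mulr0.
have ad0t : ad br t = 0.
  by apply: (diag_nilpotent0 (diagonalizable_conj uP (dT tT)) (trE tr0)).
have [u uT] := ri; rewrite -tk//; rewrite /kf ad0t mul0mx mxtrace0 eqxx.
by [].
Qed.

(** Index [j] carries the opposite root and [t] is the Killing dual of the root of [i]. The coroot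
    proper, with value 2, is the rescaled [cr_h]. *)
Record coroot_spec i j t : Prop := CorootSpec {
  cr_T : (t <= T)%MS;
  cr_dual : forall u, (u <= T)%MS -> kf t u = al i u;
  cr_opp : forall u, (u <= T)%MS -> al j u = - al i u;
  cr_br : br (e_ i) (e_ j) = kf (e_ i) (e_ j) *: t;
  cr_kf : kf (e_ i) (e_ j) != 0;
  cr_al : al i t != 0 }.

Lemma coroot i : isroot i -> exists j t, coroot_spec i j t.
Proof.
move=> /root_dual[j [t [tT tk aj kij [et at0]]]]; exists j, t; split=> //.
by rewrite et scalerA divff// scale1r.
Qed.

Section Coroot.
Variables (i j : 'I_n) (t : vec).
Hypothesis cr : coroot_spec i j t.

Definition cr_h := (2 / al i t) *: t.
Definition cr_f := (2 / al i t / kf (e_ i) (e_ j)) *: e_ j.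

Lemma cr_hT : (cr_h <= T)%MS. Proof. by rewrite scalemx_sub// (cr_T cr). Qed.

Lemma al_h : al i cr_h = 2. Proof. by rewrite alZ mulfVK ?(cr_al cr). Qed.

Lemma cr_sl2 : [/\ br (e_ i) cr_f = cr_h, br cr_h (e_ i) = 2 *: e_ i & br cr_h cr_f = - 2 *: cr_f].
Proof.
rewrite br_e ?cr_hT// al_h; split=> //.
  by rewrite brZr (cr_br cr) scalerA mulfVK ?(cr_kf cr).
by rewrite brZr br_e ?cr_hT// (cr_opp cr) ?cr_hT// al_h !scalerA mulrC.
Qed.

(** Otherwise some nonzero combination [v] of [e_ k] and [e_ j] is Killing-orthogonal to [e_ i].
    Then [br (e_ i) v] is an element of [T] orthogonal to [T], hence 0, and [v] is a highest weight
    vector of weight -2. *)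
Lemma neg_unique k : (forall u, (u <= T)%MS -> al k u = - al i u) -> k = j.
Proof.
move=> ak; apply/eqP/negPn/negP => kj.
pose c := kf (e_ i) (e_ k) / kf (e_ i) (e_ j).
pose v := e_ k - c *: e_ j.
have v0 : v != 0.
  apply/eqP => v0; have : comp k v = 0 by rewrite v0 comp0.
  rewrite compD -scaleN1r !compZ !comp_e eqxx eq_sym (negPf kj) !mulr0 addr0.
  by move/eqP; rewrite oner_eq0.
have vi u : (u <= T)%MS -> br u v = - al i u *: v.
  move=> uT; rewrite brDr brNr brZr !br_e// ak// (cr_opp cr)// scalerBr !scalerA.
  by congr (_ - _ *: _); rewrite mulrC.
have [bT bk] := br_pair vi.
have Ev : br (e_ i) v = 0.
  apply: ndT => // u uT; rewrite bk// kfDr kfNr kfZr mulfVK ?(cr_kf cr)//.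
  by rewrite subrr mulr0.
have [eH HE HF] := cr_sl2.
have [|m em] := sl2_nat eH HF v0 (vi _ cr_hT); first by rewrite Ev br0r.
have : (m + 2)%:R = 0 :> K by rewrite natrD -em al_h; ring.
by move/eqP; rewrite pnatr_eq0 addn2.
Qed.

(** The top of the string through [e_ k] is a highest weight vector, so its weight is natural; each
    raising step added 2. *)
Lemma al_int k : exists m p : nat, al k cr_h = m%:R - p%:R.
Proof.
have [eH HE HF] := cr_sl2; have [eH' HE' HF'] := sl2_opp eH HE HF.
have Hk : br (- cr_h) (e_ k) = - al k cr_h *: e_ k by rewrite brNl br_e ?cr_hT// scaleNr.
have [p lp lpS] := lower_last HF' (e_neq0 k) Hk.
have wp := lower_weight HF' p Hk.
set w := lower _ _ _ in lp wp.
have Hw : br cr_h w = (al k cr_h + 2 * p%:R) *: w.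
  by rewrite -[LHS]opprK -brNl wp -scaleNr opprB opprK addrC.
have [|m em] := sl2_nat eH HF lp Hw; first by rewrite /w -lowerS lpS br0r.
by exists m, (2 * p)%N; rewrite -em natrM addrK.
Qed.

End Coroot.

Lemma root_opp i j t : coroot_spec i j t -> isroot j.
Proof.
move=> cr; exists t; first exact: cr_T cr.
by rewrite (cr_opp cr) ?(cr_T cr)// oppr_eq0 (cr_al cr).
Qed.

Lemma root_inj i k : isroot i -> (forall u, (u <= T)%MS -> al k u = al i u) -> k = i.
Proof.
move=> ri ak; have [j [t cr]] := coroot ri; have [i' [t' cr']] := coroot (root_opp cr).
transitivity i'; first by apply: (neg_unique cr') => u uT; rewrite (cr_opp cr)// opprK ak.
by apply/esym; apply: (neg_unique cr') => u uT; rewrite (cr_opp cr)// opprK.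
Qed.

Lemma weight_line v i : isroot i -> (forall u, (u <= T)%MS -> br u v = al i u *: v) ->
  v = comp i v *: e_ i.
Proof.
move=> ri vi; rewrite [LHS]comp_sum (bigD1 i)//= big1 ?addr0// => k ki.
have [->|vk] := eqVneq (comp k v) 0; first by rewrite scale0r.
by case/eqP: ki; apply: root_inj ri (comp_weight vi vk).
Qed.

Lemma root_bracket i j : isroot i -> br (e_ i) (e_ j) != 0 ->
  exists2 i', (forall u, (u <= T)%MS -> al i' u = - al i u) & br (e_ i') (br (e_ i) (e_ j)) != 0.
Proof.
move=> ri nz; have [i' [t cr]] := coroot ri; exists i'; first exact: cr_opp cr.
have [eH HE HF] := cr_sl2 cr.
have := sl2_raise_ne0 eH HE HF (br_e j (cr_hT cr)) nz.
by apply: contraNneq => z; rewrite brZl z scaler0.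
Qed.

Lemma root_B i : (e_ i <= B)%MS -> isroot i -> forall u, (u <= B)%MS -> kf (e_ i) u = 0.
Proof.
move=> iB [t tT at0] u uB; apply: (mulfI at0); rewrite mulr0 -kfZl -br_e//.
by apply: (kf_solvable aB sB) => //; apply: submx_trans TB.
Qed.

(** [B] is stable under [T]. Applying [br u - al k u] with [u] separating the weights of [k] and [i]
    kills the component at [k] and keeps the one at [i]; in the end only a multiple of [e_ i] is
    left. *)
Lemma comp_B v i : (v <= B)%MS -> isroot i -> comp i v != 0 -> (e_ i <= B)%MS.
Proof.
move=> vB ri vi.
suff /(_ (enum 'I_n))[w [wB wi wk]] : forall s : seq 'I_n, exists w, [/\ (w <= B)%MS, comp i w != 0 &
     forall k, k \in s -> k != i -> comp k w = 0].
  have -> : e_ i = (comp i w)^-1 *: w; last exact: scalemx_sub.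
  apply: comp_ext => k; rewrite compZ comp_e; case: eqP => [<-|/eqP ik]; first by rewrite mulVf.
  have -> : comp k w = 0 by apply: wk; rewrite ?mem_enum// eq_sym.
  by rewrite mulr0.
elim=> [|k s [w [wB wi wk]]]; first by exists v; split.
have [ki|ki] := eqVneq k i.
  by exists w; split=> // l; rewrite inE ki => /orP[/eqP->|]; [rewrite eqxx | apply: wk].
have [u uT ku] : exists2 u, (u <= T)%MS & al k u != al i u.
  apply/not_exists2P => ne; case/eqP: ki; apply: root_inj ri _ => u uT.
  by apply/eqP/negPn/negP => ne'; have [] := ne u.
exists (br u w - al k u *: w).
have cw l : comp l (br u w - al k u *: w) = (al l u - al k u) * comp l w.
  by rewrite compD -scaleNr compZ comp_br// -mulrDl.
split; first by rewrite addmx_sub ?eqmx_opp ?scalemx_sub// aB// (submx_trans uT).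
  by rewrite cw mulf_neq0// subr_eq0 eq_sym.
move=> l; rewrite inE cw => /orP[/eqP-> _|ls li]; first by rewrite subrr mul0r.
by rewrite wk ?mulr0.
Qed.

Definition ispos i := isroot i /\ (e_ i <= B)%MS.

(** The only weight vector not orthogonal to [e_ i] is [e_ j]. If it is not in [B], then [e_ i] is
    orthogonal to [B] and so belongs to [B]. *)
Lemma pos_or_neg i j t : coroot_spec i j t -> isroot i -> ~ ispos i -> ispos j.
Proof.
move=> cr ri ni; split; first exact: root_opp cr.
apply/negPn/negP => jB; apply: ni; split=> //; apply: max_solvable_perp => v vB.
rewrite [v]comp_sum kf_sumr big1// => k _; rewrite kfZr.
have [->|vk] := eqVneq (comp k v) 0; first by rewrite mul0r.
have [->|kk] := eqVneq (kf (e_ i) (e_ k)) 0; first by rewrite mulr0.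
have ak u : (u <= T)%MS -> al k u = - al i u.
  move=> uT; have := @kf_weight (e_ i) (e_ k) (al i) (al k) u _ _ uT.
  move=> /(_ (fun v vT => br_e i vT) (fun v vT => br_e k vT))/eqP.
  by rewrite mulf_eq0 (negPf kk) orbF addrC addr_eq0 => /eqP.
have kj : k = j by apply: (neg_unique cr).
by case/negP: jB; rewrite -kj; apply: (comp_B vB) => //; rewrite kj; apply: root_opp cr.
Qed.

Lemma pos_opp i j t : coroot_spec i j t -> ispos i -> ~ ispos j.
Proof.
by move=> cr [ri iB] [_ jB]; have := cr_kf cr; rewrite (root_B iB ri jB) eqxx.
Qed.

(** The image of [k] under the reflection in [i]. Lowering [e_ k] as far as possible, [p] times,
    gives [w], from which raising is nonzero at least [m + 2p] times. After [p] steps one is back on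
    the line of [e_ k], so [m] more steps from [e_ k] are nonzero, and they stay in [B]. *)
Lemma pos_reflect i j t k (m : nat) : coroot_spec i j t -> ispos i -> ispos k ->
  al k (cr_h i t) = - m%:R -> (0 < m)%N ->
  exists2 k', ispos k' & forall u, (u <= T)%MS -> al k' u = al k u + m%:R * al i u.
Proof.
move=> cr [ri iB] [rk kB] km m0.
have [eH HE HF] := cr_sl2 cr; have [eH' HE' HF'] := sl2_opp eH HE HF.
have Hk : br (cr_h i t) (e_ k) = - m%:R *: e_ k by rewrite br_e ?(cr_hT cr)// km.
have [p lp lpS] := lower_last HF (e_neq0 k) Hk.
have wp := lower_weight HF p Hk; set f := cr_f i j t in HF lp lpS wp eH eH' HE'.
set w := lower f p (e_ k) in lp wp.
have Hw : br (- cr_h i t) w = (m + 2 * p)%:R *: w.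
  by rewrite brNl wp -scaleNr; congr (_ *: _); rewrite natrD natrM; ring.
have Fw : br (e_ i) (br f w) = 0 by rewrite /w -lowerS lpS br0r.
have rl := fun q => raise_lower eH' HF' q Hw Fw.
have nz q : (q <= m + 2 * p)%N -> lower (e_ i) q w != 0.
  elim: q => [|q IH] qM; first by rewrite /lower expr0 mulmx1.
  apply/eqP => z; have := rl q; rewrite z br0r => /esym/eqP.
  rewrite scaler_eq0 (negPf (IH (ltnW qM))) orbF mulf_eq0 pnatr_eq0 /= subr_eq0 eqr_nat.
  by rewrite gtn_eqF.
have wtF q u : (u <= T)%MS -> br u (lower f q (e_ k)) = (al k u - q%:R * al i u) *: lower f q (e_ k).
  elim: q u => [|q IH] u uT; first by rewrite /lower expr0 mulmx1 mul0r subr0 br_e.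
  rewrite lowerS (weight_br (f := fun u => - al i u) (g := fun u => al k u - q%:R * al i u))//.
    by congr (_ *: _); rewrite -natr1; ring.
  by move=> v vT; rewrite brZr br_e// (cr_opp cr)// !scalerA mulrC.
have wtE q u : (u <= T)%MS -> br u (lower (e_ i) q w) = (al k u - p%:R * al i u + q%:R * al i u) *: lower (e_ i) q w.
  elim: q u => [|q IH] u uT; first by rewrite /lower expr0 mulmx1 mul0r addr0 wtF.
  rewrite lowerS (weight_br (f := al i) (g := fun u => al k u - p%:R * al i u + q%:R * al i u))//.
    by congr (_ *: _); rewrite -natr1; ring.
  by move=> v vT; rewrite br_e.
have ek : lower (e_ i) p w = comp k (lower (e_ i) p w) *: e_ k.
  by apply: weight_line => // u uT; rewrite wtE// subrK.
have lowD q : lower (e_ i) (p + q) w = lower (e_ i) q (lower (e_ i) p w).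
  by rewrite /lower exprD -mulmxE mulmxA.
have nzm : lower (e_ i) m (e_ k) != 0.
  have : lower (e_ i) (p + m) w != 0 by apply: nz; rewrite addnC leq_add2l mul2n -addnn leq_addl.
  by rewrite lowD ek /lower -scalemxAl scaler_eq0 negb_or => /andP[].
have wtm u : (u <= T)%MS -> br u (lower (e_ i) m (e_ k)) = (al k u + m%:R * al i u) *: lower (e_ i) m (e_ k).
  elim: (m) u => [|q IH] u uT; first by rewrite /lower expr0 mulmx1 mul0r addr0 br_e.
  rewrite lowerS (weight_br (f := al i) (g := fun u => al k u + q%:R * al i u))//.
    by congr (_ *: _); rewrite -natr1; ring.
  by move=> v vT; rewrite br_e.
have inB : (lower (e_ i) m (e_ k) <= B)%MS.
  elim: (m) => [|q IH]; first by rewrite /lower expr0 mulmx1.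
  by rewrite lowerS aB.
have [k' k'0] := comp_ne0 nzm; have ak' := comp_weight wtm k'0; exists k' => //.
have rk' : isroot k'.
  exists (cr_h i t); first exact: cr_hT cr.
  rewrite ak' ?(cr_hT cr)// km (al_h cr).
  have -> : - m%:R + m%:R * 2 = m%:R :> K by ring.
  by rewrite pnatr_eq0 -lt0n.
by split=> //; apply: comp_B inB rk' k'0.
Qed.

Lemma kf_T u v : (u <= T)%MS -> (v <= T)%MS -> kf u v = \sum_i al i u * al i v.
Proof. by move=> uT vT; apply: kf_trig => //; apply: is_diag_mx_is_trig; apply: dT. Qed.

Lemma al_real_h i j t k : coroot_spec i j t -> al k (cr_h i t) \is Num.real.
Proof. by move=> cr; have [m [p ->]] := al_int cr k; rewrite rpredB ?realn. Qed.

(** The Killing square of the coroot is [4 / al i t]; it is also a sum of squares of integers, one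
    of them 2. *)
Lemma coroot_gt0 i j t : coroot_spec i j t -> 0 < al i t.
Proof.
move=> cr; have hT := cr_hT cr; have a0 := cr_al cr.
have k4 : kf (cr_h i t) (cr_h i t) = 4 / al i t.
  by rewrite {1}/cr_h kfZl (cr_dual cr)// (al_h cr); field.
have : 0 < kf (cr_h i t) (cr_h i t).
  rewrite kf_T// (bigD1 i)//= (al_h cr) ltr_wpDr//; last by rewrite mulr_gt0 ?ltr0n.
  apply: sumr_ge0 => k _; have rk := al_real_h k cr.
  by rewrite -expr2 real_exprn_even_ge0.
by rewrite k4 pmulr_rgt0 ?ltr0n// invr_gt0.
Qed.

Lemma al_real i j t k : coroot_spec i j t -> al k t \is Num.real.
Proof.
move=> cr; have -> : al k t = al k (cr_h i t) * (al i t / 2).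
  by rewrite alZ; have := cr_al cr => a0; field.
by rewrite realM ?(al_real_h k cr)// realM ?realV ?realn// gtr0_real// (coroot_gt0 cr).
Qed.

(* The reflection in the root [i] maps the positive roots with negative value
   at the coroot of [i] injectively to positive roots other than [i] with the
   opposite value. *)
Lemma sum_pos_gt0 i j t : coroot_spec i j t -> ispos i ->
  0 < \sum_(k | `[< ispos k >]) al k (cr_h i t).
Proof.
move=> cr pi; set h := cr_h i t; have hT : (h <= T)%MS := cr_hT cr.
have hi : al i h = 2 := al_h cr.
have [f fP] : {f : 'I_n -> 'I_n & forall k, ispos k /\ al k h < 0 ->
    ispos (f k) /\ forall u, (u <= T)%MS -> al (f k) u = al k u - al k h * al i u}.
  apply: (@boolp.choice _ _ (fun k k' => ispos k /\ al k h < 0 ->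
    ispos k' /\ forall u, (u <= T)%MS -> al k' u = al k u - al k h * al i u)) => k.
  have [[pk nk]|npk] := pselect (ispos k /\ al k h < 0); last by exists k.
  have [m [p emp]] := al_int cr k; rewrite -/h in emp.
  have mp : (m < p)%N by rewrite -(ltr_nat K) -subr_lt0 -emp.
  have emp' : al k h = - (p - m)%:R by rewrite emp natrB ?(ltnW mp)// opprB.
  have [|k' pk' ak'] := pos_reflect cr pi pk emp'; first by rewrite subn_gt0.
  by exists k' => _; split=> // u uT; rewrite ak'// emp' mulNr opprK.
pose S := [set k | `[< ispos k >] & al k h < 0].
pose Q := [set k | `[< ispos k >] & ~~ (al k h < 0)].
have inS k : k \in S -> ispos k /\ al k h < 0 by rewrite inE => /andP[/asboolP].
have fh k : k \in S -> al (f k) h = - al k h.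
  by move=> /inS/fP[_ ->//]; rewrite hi mulr_natr mulr2n opprD addrA subrr sub0r.
have finj : {in S &, injective f}.
  move=> k l kS lS fkl; have [_ fk] := fP k (inS _ kS); have [[rl _] _] := inS l lS.
  have [_ fl] := fP l (inS _ lS).
  have kl : al k h = al l h by apply: oppr_inj; rewrite -!fh// fkl.
  apply: (root_inj rl) => u uT; have := fk u uT; rewrite fkl fl// kl.
  by move/addIr.
have iS : i \notin f @: S.
  apply/negP => /imsetP[k kS ik]; have [_ fk] := fP k (inS _ kS).
  have kh : al k h = - 2 by have := fh k kS; rewrite -ik hi => ->; rewrite opprK.
  have kj : k = j.
    apply: (neg_unique cr) => u uT; have := fk u uT; rewrite -ik kh => e.
    have -> : al k u = (al k u - - 2 * al i u) - 2 * al i u by ring.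
    by rewrite -e; ring.
  by have [pk _] := inS k kS; apply: (pos_opp cr pi); rewrite -kj.
have sub : i |: f @: S \subset Q.
  apply/fintype.subsetP => l; rewrite !inE => /predU1P[->|/imsetP[k kS ->]].
    by rewrite hi (lt_gtF (ltr0n K 2)); apply/andP; split; [apply/asboolP|].
  have [pf _] := fP k (inS _ kS); rewrite fh// oppr_lt0; apply/andP; split; first exact/asboolP.
  by have [_ /ltW] := inS k kS; move=> k0; apply/negP => /lt_le_trans/(_ k0); rewrite ltxx.
rewrite (bigID (fun k => al k h < 0)) /=.
rewrite (eq_bigl (fun k => k \in S)); last by move=> k; rewrite inE.
rewrite [X in _ + X](eq_bigl (fun k => k \in Q)); last by move=> k; rewrite inE.
rewrite [X in _ + X](big_setID (i |: f @: S)) /= (finset.setIidPr sub) big_setU1// big_imset//= hi.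
rewrite [X in 2 + X](eq_bigr _ fh) sumrN.
move: (\sum_(k in S) _) => s; set r := \sum_(k in _) _.
have -> : s + (2 - s + r) = 2 + r by ring.
rewrite ltr_wpDr ?ltr0n// sumr_ge0// => k; rewrite !inE => /andP[_ /andP[_]].
by rewrite -real_leNgt ?real0 ?(al_real_h k cr).
Qed.

(** Every failure of positivity, and every coincidence of values, bounds [c] by one of finitely many
    ratios; [c] exceeds them all. Thus [c *: d + t] keeps what [d] separates and adds what [t]
    separates. *)
Lemma perturb d t : (forall i, al i t \is Num.real) -> (forall i, al i d \is Num.real) ->
  exists2 c, c \is Num.real &
    (forall i, 0 < al i d -> 0 < al i (c *: d + t)) /\
    forall i j, al i d != al j d \/ al i t != al j t -> al i (c *: d + t) != al j (c *: d + t).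
Proof.
move=> rt rd.
pose s1 := \sum_i `|al i t / al i d|.
pose s2 := \sum_p `|(al p.1 t - al p.2 t) / (al p.1 d - al p.2 d)|.
have s1_ge0 : 0 <= s1 by apply: sumr_ge0.
have s2_ge0 : 0 <= s2 by apply: sumr_ge0.
pose c := 1 + s1 + s2.
have c_gt0 : 0 < c by rewrite /c -addrA ltr_wpDr ?addr_ge0.
exists c; first exact: gtr0_real.
split=> [i di|i j dij].
  have : `|al i t / al i d| < c.
    rewrite /c /s1 (bigD1 i)//= -addrA [1 + _]addrC -!addrA ltrDl.
    by rewrite ltr_wpDl ?sumr_ge0// ltr_wpDl.
  rewrite normf_div (gtr0_norm di) ltr_pdivrMr// real_ltr_norml ?rt// => /andP[lt _].
  by rewrite alD alZ -(opprK (al i t)) subr_gt0 ltrNl.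
rewrite -subr_eq0 !alD !alZ opprD addrACA -mulrBr.
have [e|nd] := eqVneq (al i d - al j d) 0.
  rewrite e mulr0 add0r subr_eq0; case: dij => // /negP[].
  by rewrite -subr_eq0 e eqxx.
apply/eqP => z; have : `|(al i t - al j t) / (al i d - al j d)| < c.
  rewrite /c /s2 (bigD1 (i, j))//= addrA ltr_wpDr ?sumr_ge0//.
  by rewrite ltrDr ltr_wpDr.
have -> : (al i t - al j t) / (al i d - al j d) = - c.
  apply: (mulIf nd); rewrite mulfVK// mulNr; apply/eqP.
  by rewrite -addr_eq0 addrC z.
by rewrite normrN gtr0_norm// ltxx.
Qed.

Lemma weight_sep i j : (forall k l t, coroot_spec k l t -> al i t = al j t) ->
  forall u, (u <= T)%MS -> al i u = al j u.
Proof.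
move=> ij.
have dual m : exists2 r, (r <= T)%MS & forall u, (u <= T)%MS -> kf r u = al m u.
  have [rm|nrm] := pselect (isroot m).
    by have [m' [t cr]] := coroot rm; exists t; [exact: cr_T cr | exact: cr_dual cr].
  by exists 0 => [|u uT]; [exact: sub0mx | rewrite kf0l not_root].
have [r rT ri] := dual i; have [s sT sj] := dual j.
suff rs : r = s by move=> u uT; rewrite -ri// -sj// rs.
apply/eqP; rewrite -subr_eq0; apply/eqP.
have rsT : (r - s <= T)%MS by rewrite addmx_sub ?eqmx_opp.
apply: center0 => v; rewrite [v]comp_sum br_sumr big1// => k _; rewrite brZr br_e//.
suff -> : al k (r - s) = 0 by rewrite scale0r scaler0.
have [rk|nrk] := pselect (isroot k); last exact: not_root.
have [l [t cr]] := coroot rk.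
rewrite -(cr_dual cr)// kfDr kfNr !(kfC t) ri ?(cr_T cr)// sj ?(cr_T cr)//.
by rewrite (ij k l t cr) subrr.
Qed.

(** The start is [rho], the sum of the duals of the positive roots, which is positive on positive
    roots. Perturbing by the dual of each root in turn separates the weights, because the duals
    determine a weight. *)
Lemma exists_grading : exists2 d, (d <= T)%MS & [/\ forall i, al i d \is Num.real,
  forall i, ispos i -> 0 < al i d &
  forall i j, al i d = al j d -> forall u, (u <= T)%MS -> al i u = al j u].
Proof.
have [t tP] : {t : 'I_n -> vec & forall k, (isroot k -> exists j, coroot_spec k j (t k)) /\ (~ isroot k -> t k = 0)}.
  apply: (@boolp.choice _ _ (fun k t => (isroot k -> exists j, coroot_spec k j t) /\ (~ isroot k -> t = 0))) => k.
  have [rk|nrk] := pselect (isroot k); last by exists 0.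
  by have [j [t cr]] := coroot rk; exists t; split=> // _; exists j.
have tT k : (t k <= T)%MS.
  have [rk|nrk] := pselect (isroot k); last by rewrite (tP k).2 ?sub0mx.
  by have [j cr] := (tP k).1 rk; exact: cr_T cr.
have tR k i : al i (t k) \is Num.real.
  have [rk|nrk] := pselect (isroot k); last by rewrite (tP k).2// al0 real0.
  by have [j cr] := (tP k).1 rk; exact: al_real i cr.
pose rho := \sum_(k | `[< ispos k >]) t k.
have alS (i : 'I_n) (Q : pred 'I_n) : al i (\sum_(k | Q k) t k) = \sum_(k | Q k) al i (t k).
  by apply: (big_morph (al i)) => [u v|]; rewrite ?alD ?al0.
have rhopos i : ispos i -> 0 < al i rho.
  move=> pi; have [ri _] := pi; have [j cr] := (tP i).1 ri.
  have := sum_pos_gt0 cr pi; rewrite /rho alS.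
  (* Symmetry of the Killing form exchanges the roles of [i] and [k]; the factor [al i (t i) / 2]
     turns the coroot into the dual. *)
  have -> : \sum_(k | `[< ispos k >]) al i (t k) = al i (t i) / 2 * \sum_(k | `[< ispos k >]) al k (cr_h i (t i)).
    rewrite mulr_sumr; apply: eq_bigr => k /asboolP[rk _]; have [l crk] := (tP k).1 rk.
    rewrite -(cr_dual cr)// kfC (cr_dual crk)// /cr_h alZ.
    by have := cr_al cr => a0; field.
  by move=> s0; rewrite mulr_gt0// divr_gt0 ?(coroot_gt0 cr).
have [d [dinT dR dP dS]] : exists d, [/\ (d <= T)%MS, forall i, al i d \is Num.real,
     forall i, ispos i -> 0 < al i d & forall i j, al i d = al j d -> forall k, k \in enum 'I_n -> al i (t k) = al j (t k)].
  elim: (enum 'I_n) => [|k s [d [dinT dR dP dS]]].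
    exists rho; split=> //; first by apply: summx_sub => k _.
    by move=> i; rewrite /rho alS; apply: sum_real => k _; exact: tR.
  have [c cR [cP cS]] := perturb (tR k) dR.
  exists (c *: d + t k); split.
  - by rewrite addmx_sub ?scalemx_sub.
  - by move=> i; rewrite alD alZ realD// realM.
  - by move=> i /dP; apply: cP.
  move=> i j e l; have ed : al i d = al j d.
    by apply/eqP/negPn/negP => ne; have := cS i j (or_introl ne); rewrite e eqxx.
  rewrite inE => /predU1P[->|]; last exact: dS.
  by apply/eqP/negPn/negP => ne; have := cS i j (or_intror ne); rewrite e eqxx.
exists d => //; split=> // i j e; apply: weight_sep => k l t' cr.
have rk : isroot k by exists t'; [exact: cr_T cr | exact: cr_al cr].
have [m crm] := (tP k).1 rk.
have -> : t' = t k.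
  apply/eqP; rewrite -subr_eq0; apply/eqP; apply: ndT => [|u uT].
    by rewrite addmx_sub ?eqmx_opp ?tT// (cr_T cr).
  by rewrite kfDl kfNl (cr_dual cr)// (cr_dual crm)// subrr.
by apply: (dS _ _ e); rewrite mem_enum.
Qed.

Lemma grading_pos d i : (forall i, ispos i -> 0 < al i d) -> (d <= T)%MS -> al i d = 0 -> ~ isroot i.
Proof.
move=> dP dinT di ri; have [j [t cr]] := coroot ri.
have [pi|npi] := pselect (ispos i); first by have := dP i pi; rewrite di ltxx.
by have := dP j (pos_or_neg cr ri npi); rewrite (cr_opp cr)// di oppr0 ltxx.
Qed.

Lemma root_nilpotent i : isroot i -> ad_nilpotent br (e_ i).
Proof.
move=> ri; have [j [t cr]] := coroot ri; have [eH HE HF] := cr_sl2 cr.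
have [eH' HE' HF'] := sl2_opp eH HE HF.
have [N NP] : {N : 'I_n -> nat & forall k, lower (e_ i) (N k) (e_ k) = 0}.
  apply: (@boolp.choice _ _ (fun k N => lower (e_ i) N (e_ k) = 0)) => k.
  by apply: (lower_nilp HF' (mu := - al k (cr_h i t))); rewrite brNl br_e ?(cr_hT cr)// scaleNr.
exists (\sum_k N k)%N; apply: mx_ext => v; rewrite mulmx0 [v]comp_sum mulmx_suml big1// => k _.
rewrite -scalemxAl (bigD1 k)//= exprD -mulmxE mulmxA.
by rewrite -[_ *m _ ^+ N k]/(lower (e_ i) (N k) (e_ k)) NP mul0mx scaler0.
Qed.

Lemma T_span (W : 'M[K]_n) : (forall i j t, coroot_spec i j t -> (t <= W)%MS) -> (T <= W)%MS.
Proof.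
move=> tW.
have zero u : (u <= T)%MS -> (forall v, (v <= T :&: W)%MS -> kf u v = 0) -> u = 0.
  move=> uT u0; apply: center0 => v; rewrite [v]comp_sum br_sumr big1// => k _; rewrite brZr br_e//.
  have [rk|nrk] := pselect (isroot k); last by rewrite not_root// scale0r scaler0.
  have [l [t cr]] := coroot rk.
  by rewrite -(cr_dual cr)// kfC u0 ?scale0r ?scaler0// sub_capmx (cr_T cr) (tW _ _ _ cr).
apply: row_ext_sub => z zT.
have [|r rTW zr] := @kf_proj (T :&: W)%MS _ z.
  by move=> u; rewrite sub_capmx => /andP[uT _]; apply: zero.
move: (rTW); rewrite sub_capmx => /andP[rT rW].
suff /eqP : z - r = 0 by rewrite subr_eq0 => /eqP->.
by apply: zero => //; rewrite addmx_sub ?eqmx_opp.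
Qed.

(** Root vectors are nilpotent. For opposite roots, [e_ j *m expm (ad br (e_ i))] is
    [e_ j + br (e_ i) (e_ j)] plus a multiple of [e_ i], so the root duals lie in [W], and they span
    [T]. *)
Lemma nilpotent_span (W : 'M[K]_n) : (forall x, ad_nilpotent br x -> (x <= W)%MS) ->
  (forall x y, ad_nilpotent br x -> ad_nilpotent br y -> (y *m expm (ad br x) <= W)%MS) ->
  (1%:M <= W)%MS.
Proof.
move=> nW eW.
have tW i j t : coroot_spec i j t -> (t <= W)%MS.
  move=> cr; have ri : isroot i by exists t; [exact: cr_T cr | exact: cr_al cr].
  have rj := root_opp cr.
  have iW := nW _ (root_nilpotent ri); have jW := nW _ (root_nilpotent rj).
  suff : (br (e_ i) (e_ j) <= W)%MS by rewrite (cr_br cr) eqmx_scale// (cr_kf cr).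
  have := eW _ _ (root_nilpotent ri) (root_nilpotent rj).
  rewrite /expm mulmx_sumr !big_ord_recl /= invr1 !scale1r expr0 expr1 mulmx1 mul_ad.
  set r := \sum_(k < _) _ => rW.
  have rW' : (r <= W)%MS.
    apply: summx_sub => k _; rewrite -scalemxAr scalemx_sub//.
    rewrite /bump !add1n -[_ *m _ ^+ _]/(lower (e_ i) k.+2 (e_ j)).
    elim: (nat_of_ord k) => [|l IHl].
      rewrite !lowerS /lower expr0 mulmx1 (cr_br cr) brZr brC br_e ?(cr_T cr)//.
      by rewrite scalemx_sub// eqmx_opp scalemx_sub.
    suff -> : lower (e_ i) l.+3 (e_ j) = 0 by rewrite sub0mx.
    elim: l {IHl} => [|l IHl]; last by rewrite lowerS IHl br0r.
    rewrite !lowerS /lower expr0 mulmx1 (cr_br cr) brZr (brC (e_ i) t) br_e ?(cr_T cr)//.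
    by rewrite brZr brNr brZr brxx scaler0 oppr0 scaler0.
  have -> : br (e_ i) (e_ j) = (e_ j + (br (e_ i) (e_ j) + r)) - e_ j - r.
    by rewrite [e_ j + _]addrC !addrK.
  by apply: addmx_sub; [apply: addmx_sub; rewrite ?eqmx_opp | rewrite eqmx_opp].
have TW := T_span tW.
apply: row_ext_sub => v _; rewrite [v]comp_sum summx_sub// => i _; rewrite scalemx_sub//.
have [ri|nri] := pselect (isroot i); first by apply: nW; apply: root_nilpotent.
by apply: submx_trans TW; apply: not_root_T.
Qed.

End Roots.

(** What the complement needs from root theory: [delta i] is the value of the weight at the
    separating element, and degree 0 is the Cartan subalgebra. The last clause says that an opposite
    root vector does not kill a nonzero bracket. *)
Theorem graded_basis : exists (P : 'M[K]_n) (delta : 'I_n -> K), [/\ P \in unitmx,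
  forall i, delta i \is Num.real,
  forall v i, (v <= B)%MS -> comp P i v != 0 -> 0 <= delta i,
  forall i j k, comp P k (br (e_ P i) (e_ P j)) != 0 -> delta k = delta i + delta j &
  [/\ forall i j, delta i = delta j -> delta i != 0 -> i = j,
    forall i j, delta i = 0 -> delta j = 0 -> br (e_ P i) (e_ P j) = 0 &
    forall i j, delta i != 0 -> br (e_ P i) (e_ P j) != 0 ->
      exists2 i', delta i' = - delta i & br (e_ P i') (br (e_ P i) (e_ P j)) != 0]].
Proof.
have [T [P [uP TB dT cT ndT]]] := cartan_subalgebra.
have [d dinT [dR dP dS]] := exists_grading uP TB dT cT ndT.
have root_of i : al P i d != 0 -> isroot T P i by move=> i0; exists d.
have not_root_of i : al P i d = 0 -> ~ isroot T P i by apply: grading_pos dP dinT.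
exists P, (al P ^~ d); split=> //.
- move=> v i vB vi; have [ri|nri] := pselect (isroot T P i); last by rewrite (not_root nri).
  by apply/ltW/dP; split=> //; apply: comp_B vB ri vi.
- by move=> i j k /(comp_br_e uP dT)/(_ d dinT).
split=> [i j ij i0|i j i0 j0|i j i0 nz].
- apply/esym; apply: (root_inj uP dT cT ndT (root_of i i0)).
  by apply: dS; rewrite ij.
- by apply: (br_T uP dT); apply: (not_root_T uP dT cT); apply: not_root_of.
have [i' ai' nz'] := root_bracket uP dT cT (root_of i i0) nz.
by exists i' => //; exact: ai'.
Qed.

Lemma nilpotent_span_ss (W : 'M[K]_n) : (forall x, ad_nilpotent br x -> (x <= W)%MS) ->
  (forall x y, ad_nilpotent br x -> ad_nilpotent br y -> (y *m expm (ad br x) <= W)%MS) ->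
  (1%:M <= W)%MS.
Proof.
have [T [P [uP TB dT cT ndT]]] := cartan_subalgebra.
exact: (nilpotent_span uP dT cT).
Qed.

End MaxSolvable.
End Semisimple.

(** * Complements in a graded Lie algebra *)

Section Complement.
Variables (P : 'M[K]_n) (delta : 'I_n -> K) (h : 'M[K]_n).
Hypothesis uP : P \in unitmx.
Local Notation e_ := (e_ P).
Local Notation comp := (comp P).
Hypothesis deltaR : forall i, delta i \is Num.real.
Hypothesis deltaD : forall i j k, comp k (br (e_ i) (e_ j)) != 0 -> delta k = delta i + delta j.
Hypothesis delta_inj : forall i j, delta i = delta j -> delta i != 0 -> i = j.
Hypothesis delta0 : forall i j, delta i = 0 -> delta j = 0 -> br (e_ i) (e_ j) = 0.
Hypothesis delta_br : forall i j, delta i != 0 -> br (e_ i) (e_ j) != 0 ->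
  exists2 i', delta i' = - delta i & br (e_ i') (br (e_ i) (e_ j)) != 0.
Hypothesis hsub : lie_subalgebra br h.
Hypothesis hfull : forall v, exists2 y, (y <= h)%MS & forall i, comp i (v - y) != 0 -> 0 <= delta i.

Let compN i v : comp i (- v) = - comp i v.
Proof. by rewrite -scaleN1r compZ mulN1r. Qed.

Lemma comp_bilin m u v : comp m (br u v) != 0 ->
  exists i j, [/\ comp i u != 0, comp j v != 0 & comp m (br (e_ i) (e_ j)) != 0].
Proof.
move=> nz; apply: contrapT => nex; case/eqP: nz.
rewrite [u](comp_sum uP) br_suml (big_morph (comp m) (compD P m) (comp0 P m)) big1// => i _.
rewrite [v](comp_sum uP) br_sumr (big_morph (comp m) (compD P m) (comp0 P m)) big1// => j _.
rewrite brZl brZr !compZ; apply/eqP; rewrite !mulf_eq0; apply/negPn/negP.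
by rewrite !negb_or => /and3P[? ? ?]; apply: nex; exists i, j.
Qed.

(** Distinct indices of equal degree occur only in degree 0; the index breaks these ties, so that a
    nonzero vector has a single leading index. *)
Definition before i j := (delta i < delta j) || ((delta i == delta j) && (i < j)%N).

Lemma before_irr i : before i i = false.
Proof. by rewrite /before ltxx ltnn andbF. Qed.

Lemma before_le i j : before i j -> delta i <= delta j.
Proof. by case/orP => [/ltW//|/andP[/eqP-> _]]. Qed.

Lemma before_trans i j k : before i j -> before j k -> before i k.
Proof.
rewrite /before => /orP[ij|/andP[/eqP-> ij]] /orP[jk|/andP[/eqP jk' jk]].
- by rewrite (lt_trans ij jk).
- by rewrite -jk' ij.
- by rewrite jk.
- by rewrite jk' eqxx (ltn_trans ij jk) orbT.
Qed.

Lemma before_total i j : i != j -> ~~ before i j -> before j i.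
Proof.
rewrite /before => ij; rewrite negb_or => /andP[nlt].
have le : delta j <= delta i by rewrite real_leNgt.
move: nlt le; rewrite le_eqVlt => nlt /orP[/eqP->|->]//.
rewrite eqxx ltxx /= -leqNgt leq_eqVlt => /orP[/eqP ji|//].
by rewrite (val_inj ji) eqxx in ij.
Qed.

Definition rk i := #|[set k | before k i]|.

Lemma rk_lt k i : before k i -> (rk k < rk i)%N.
Proof.
move=> ki; apply: proper_card; apply/properP; split; last by exists k; rewrite inE ?before_irr.
by apply/fintype.subsetP => l; rewrite !inE => lk; apply: before_trans ki.
Qed.

Definition lead i := exists2 y, (y <= h)%MS & comp i y != 0 /\ forall k, before k i -> comp k y = 0.

Lemma hfull_neg i : exists y w, [/\ (y <= h)%MS, y = e_ i - w & forall k, comp k w != 0 -> 0 <= delta k].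
Proof.
by have [y yh yd] := hfull (e_ i); exists y, (e_ i - y); split=> //; rewrite subKr.
Qed.

Lemma lead_neg i : ~ lead i -> 0 <= delta i.
Proof.
move=> nl; rewrite real_leNgt ?real0//; apply/negP => i0; apply: nl.
have [y [w [yh ey yd]]] := hfull_neg i.
have w0 k : delta k < 0 -> comp k w = 0.
  move=> k0; apply/eqP/negPn/negP => /yd; rewrite real_leNgt ?real0//.
  by rewrite k0.
exists y => //; rewrite ey; split=> [|k ki]; rewrite compD compN comp_e// w0 ?subr0 //.
- by rewrite eqxx oner_eq0.
- by case: eqP ki => // ->; rewrite before_irr.
- exact: le_lt_trans (before_le ki) i0.
Qed.

(* If [br (e_ i) (e_ j)] is a multiple of [e_ k] and [z \in h] has leading term
   [e_ k], then bracketing [z] with an element of [h] that is [e_ i'] up to terms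
   of nonnegative degree, where [i'] is the root opposite to [i], makes [j] leading. *)
Lemma lead_stable i j k : ~ lead i -> ~ lead j -> lead k -> comp k (br (e_ i) (e_ j)) = 0.
Proof.
move=> nli nlj lk; apply/eqP/negPn/negP => nz.
(* If exactly one of the two degrees is 0, then [k] has the nonzero degree of the other index and
   equals it, which contradicts [lead k]. *)
have dk := deltaD nz; have [i0|i0] := eqVneq (delta i) 0.
  have [j0|j0] := eqVneq (delta j) 0; first by case/eqP: nz; rewrite delta0// comp0.
  by apply: nlj; rewrite (delta_inj (i := j) (j := k))// dk i0 add0r.
have [j0|j0] := eqVneq (delta j) 0.
  by apply: nli; rewrite (delta_inj (i := i) (j := k))// dk j0 addr0.
have ip : 0 < delta i by rewrite lt_neqAle eq_sym i0 lead_neg.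
have jp : 0 < delta j by rewrite lt_neqAle eq_sym j0 lead_neg.
have kp : delta k != 0 by rewrite dk gt_eqF// addr_gt0.
have br0 : br (e_ i) (e_ j) != 0 by apply: contraNneq nz => ->; rewrite comp0.
have [i' di'] := delta_br i0 br0.
set c := comp k (br (e_ i) (e_ j)) in nz.
have brk : br (e_ i) (e_ j) = c *: e_ k.
  apply: (comp_ext uP) => l; rewrite compZ (comp_e uP); have [kl|kl] := eqVneq k l; first by rewrite /c kl mulr1.
  rewrite mulr0; apply/eqP/negPn/negP => /deltaD dl; case/eqP: kl.
  by apply: delta_inj => //; rewrite dk.
rewrite brk brZr scaler_eq0 negb_or => /andP[_ i'k].
have [z zh [zk zb]] := lk.
have [y [w [yh ey yd]]] := hfull_neg i'.
have ez l : comp l (z - comp k z *: e_ k) != 0 -> delta k < delta l.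
  rewrite compD compN compZ (comp_e uP); have [<-|kl] := eqVneq k l; first by rewrite mulr1 subrr eqxx.
  rewrite mulr0 subr0 => lz; have nb : ~~ before l k by apply/negP => /zb /eqP; rewrite (negPf lz).
  have := before_total _ nb; rewrite eq_sym => /(_ kl)/orP[//|/andP[/eqP kl' _]].
  by rewrite (delta_inj kl' kp) eqxx in kl.
have ezk l : comp l z != 0 -> delta k <= delta l.
  move=> lz; have [<-|kl] := eqVneq k l; first exact: lexx.
  by apply/ltW/ez; rewrite compD compN compZ (comp_e uP) (negPf kl) mulr0 subr0.
have dj : delta j = delta k + delta i' by rewrite dk di' addrC addKr.
apply: nlj; exists (br y z); first exact: hsub.
(* Only the first term reaches degrees up to [delta j]: the rest of [z] lies in degrees above
   [delta k], and [w] has nonnegative degrees while [delta j < delta k]. *)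
have e : br y z = comp k z *: br (e_ i') (e_ k) + br (e_ i') (z - comp k z *: e_ k) - br w z.
  by rewrite ey brDl brNl brDr brNr brZr [_ *: _ + _]addrC subrK.
have c2 m : delta m <= delta j -> comp m (br (e_ i') (z - comp k z *: e_ k)) = 0.
  move=> mj; apply/eqP/negPn/negP => /comp_bilin[a [b [ai' /ez kb /deltaD dm]]].
  have ea : a = i' by move: ai'; rewrite (comp_e uP); case: (i' =P a) => // _; rewrite eqxx.
  have : delta m < delta m by rewrite (le_lt_trans mj)// dm ea dj addrC ltrD2l.
  by rewrite ltxx.
have c3 m : delta m <= delta j -> comp m (br w z) = 0.
  move=> mj; apply/eqP/negPn/negP => /comp_bilin[a [b [/yd wa /ezk kb /deltaD dm]]].
  have : delta m < delta m; last by rewrite ltxx.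
  rewrite (le_lt_trans mj)// dm (lt_le_trans _ (lerD wa kb))// add0r dk.
  by rewrite ltrDr.
have cm m : delta m <= delta j -> comp m (br y z) = comp k z * comp m (br (e_ i') (e_ k)).
  by move=> mj; rewrite e compD compN compD c2// c3// oppr0 !addr0 compZ.
have only m : comp m (br (e_ i') (e_ k)) != 0 -> m = j.
  by move=> /deltaD dm; apply/esym/delta_inj => //; rewrite dm dj addrC.
split=> [|m mj].
  rewrite cm// mulf_neq0//; have [m m0] := comp_ne0 uP i'k.
  by rewrite -(only m m0).
rewrite cm ?before_le//; have [->|m0] := eqVneq (comp m (br (e_ i') (e_ k))) 0; first by rewrite mulr0.
by move: mj; rewrite (only m m0) before_irr.
Qed.

(** [S] is the span of the [e_ i] with [i] not leading. A nonzero element of [h] has a leading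
    index, where elements of [S] vanish. *)
Theorem complement_subalg : exists S : 'M[K]_n, [/\ lie_subalgebra br S,
  forall v, (v <= h)%MS -> (v <= S)%MS -> v = 0 & (1%:M <= h + S)%MS].
Proof.
have [||S SP] := @subspace_mx K n (fun v => forall i, lead i -> comp i v = 0).
- by move=> i _; rewrite comp0.
- by move=> a u v u0 v0 i li; rewrite comp_lin u0// v0// mulr0 addr0.
exists S; split.
- move=> u v /SP uS /SP vS; apply/SP => k lk; apply/eqP/negPn/negP.
  move=> /comp_bilin[i [j [ui vj]]]; rewrite lead_stable ?eqxx// => l.
    by rewrite uS ?eqxx in ui.
  by rewrite vS ?eqxx in vj.
- move=> v vh /SP vS; apply/eqP/negPn/negP => /(comp_ne0 uP)[i0 vi0].
  pose i := [arg min_(i < i0 | comp i v != 0) rk i].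
  have : comp i v = 0.
    apply: vS; exists v => //; rewrite /i; case: arg_minnP => // l vl lmin; split=> // k kl.
    by apply/eqP/negPn/negP => /lmin; rewrite leqNgt rk_lt.
  by rewrite /i; case: arg_minnP => // l /negPf vl _ /eqP; rewrite vl.
(* Induction from the end of the order: a leading [e_ i] is an element of [h], up to a scalar, minus
   terms that come later. *)
suff eS m i : (n - rk i <= m)%N -> (e_ i <= h + S)%MS.
  by apply: row_ext_sub => v _; rewrite [v](comp_sum uP) summx_sub// => i _; rewrite scalemx_sub// (eS _ _ (leqnn _)).
elim: m i => [|m IH] i.
  rewrite leqn0 subn_eq0 => ni; have : (rk i < n)%N.
    rewrite -[X in (_ < X)%N](card_ord n) -cardsT; apply: proper_card; rewrite properT.
    by apply/eqP => /setP/(_ i); rewrite !inE before_irr.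
  by rewrite ltnNge ni.
move=> im; have [[y yh [yi yb]]|nl] := pselect (lead i); last first.
  apply: submx_trans (addsmxSr _ _); apply/SP => k lk; rewrite (comp_e uP).
  by case: eqP => // ik; case: nl; rewrite ik.
have -> : e_ i = (comp i y)^-1 *: (y - \sum_(k | k != i) comp k y *: e_ k).
  by rewrite {2}[y](comp_sum uP) (bigD1 i)//= addrK scalerA mulVf// scale1r.
rewrite scalemx_sub// addmx_sub ?(submx_trans yh) ?addsmxSl// eqmx_opp summx_sub// => k ki.
have [->|yk] := eqVneq (comp k y) 0; first by rewrite scale0r sub0mx.
rewrite scalemx_sub// IH//; have : before i k.
  by apply: before_total => //; apply/negP => /yb/eqP; rewrite (negPf yk).
move/rk_lt => ik; rewrite -ltnS (leq_trans _ im)// ltn_sub2l//.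
rewrite (leq_trans ik)// -[X in (_ <= X)%N](card_ord n); apply: max_card.
Qed.

End Complement.

Theorem solvable_complement (b h : 'M[K]_n) : semisimple br ->
  lie_subalgebra br b -> lie_solvable br b -> lie_subalgebra br h -> (1%:M <= b + h)%MS ->
  exists S : 'M[K]_n, [/\ lie_subalgebra br S,
    forall v, (v <= h)%MS -> (v <= S)%MS -> v = 0 & (1%:M <= h + S)%MS].
Proof.
move=> ss ab sb ah full; have [B mB bB] := exists_max_solvable ab sb.
have [P [delta [uP dR dB dD [dI d0 dbr]]]] := graded_basis ss mB.
apply: (complement_subalg uP dR dD dI d0 dbr ah) => v.
have /sub_addsmxP[[c d] /= ->] : (v <= b + h)%MS by apply: submx_trans full; apply: submx1.
exists (d *m h); first exact: submxMl.
by move=> i; rewrite addrK; apply: dB; apply: submx_trans bB; apply: submxMl.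
Qed.

Theorem nilpotents_full (W : 'M[K]_n) : semisimple br ->
  (forall x, ad_nilpotent br x -> (x <= W)%MS) ->
  (forall x y, ad_nilpotent br x -> ad_nilpotent br y -> (y *m expm (ad br x) <= W)%MS) ->
  (1%:M <= W)%MS.
Proof.
move=> ss nW eW; have [||B mB _] := @exists_max_solvable 0.
- by move=> u v; rewrite submx0 => /eqP-> _; rewrite br0l sub0mx.
- by exists 0%N; rewrite sub0mx.
exact: (nilpotent_span_ss ss mB nW eW).
Qed.

End Lie.

(** * The adjoint group *)

Lemma sum_triangle (V : nmodType) (F : nat -> nat -> V) m :
  \sum_(0 <= k < m) \sum_(0 <= i < k.+1) F i (k - i)%N =
  \sum_(0 <= i < m) \sum_(0 <= j < m - i) F i j.
Proof.
elim: m => [|m IH]; first by rewrite !big_geq.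
rewrite !big_nat_recr//= IH subSnn big_nat1 addrA -big_split/=.
congr (_ + _); last by rewrite subnn.
apply: eq_big_nat => i /andP[_ im]; rewrite subSn ?(ltnW im)//.
by rewrite big_nat_recr.
Qed.

Section Exponential.
Variables (K : numClosedFieldType) (n' : nat).
Local Notation n := n'.+1.
Local Notation vec := 'rV[K]_n.
Variable br : vec -> vec -> vec.
Hypothesis lb : is_lie_bracket br.
Implicit Types (u v w x y z : vec) (D X g : 'M[K]_n).

(** Divided powers, for which the Leibniz formula has no binomial coefficients. *)
Definition dpow D k u := (k`!%:R)^-1 *: (u *m D ^+ k).

Lemma dpowS D k u : k.+1%:R *: dpow D k.+1 u = dpow D k u *m D.
Proof.
rewrite /dpow -scalemxAl -mulmxA mulmxE -exprSr scalerA factS natrM invfM mulrA mulfV ?mul1r//.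
by rewrite pnatr_eq0.
Qed.

Lemma dpow_br D k u v : is_der br D ->
  dpow D k (br u v) = \sum_(0 <= i < k.+1) br (dpow D i u) (dpow D (k - i) v).
Proof.
move=> dD; elim: k => [|k IH].
  by rewrite big_nat1 /dpow !expr0 !mulmx1 invr1 !scale1r.
have k0 : k.+1%:R != 0 :> K by rewrite pnatr_eq0.
apply: (scalerI k0); rewrite dpowS IH mulmx_suml scaler_sumr.
under eq_big_nat => i /andP[_ ik] do rewrite dD -!dpowS -subSn//.
rewrite big_split /=.
rewrite [X in X + _](_ : _ = \sum_(0 <= i < k.+2) i%:R *: br (dpow D i u) (dpow D (k.+1 - i) v)); last first.
  rewrite [RHS]big_nat_recl// scale0r add0r; apply: eq_big_nat => i _.
  by rewrite [LHS](brZl lb) subSS.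
rewrite [X in _ + X](_ : _ = \sum_(0 <= i < k.+2) (k.+1 - i)%:R *: br (dpow D i u) (dpow D (k.+1 - i) v)); last first.
  rewrite [RHS]big_nat_recr//= subnn scale0r addr0; apply: eq_big_nat => i _.
  by rewrite [LHS](brZr lb).
rewrite -big_split /=; apply: eq_big_nat => i /andP[_ ik].
by rewrite -scalerDl -natrD subnKC.
Qed.

(** The free length [m] allows the exponential of a bracket to be summed up to [n + n], as the
    product of two sums of length [n] requires. *)
Lemma expm_dpow D u m : D ^+ n = 0 -> (n <= m)%N ->
  u *m expm D = \sum_(0 <= k < m) dpow D k u.
Proof.
move=> Dn nm.
have z k : (n <= k)%N -> dpow D k u = 0.
  by move=> nk; rewrite /dpow -(subnKC nk) exprD Dn mul0r mulmx0 scaler0.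
rewrite (@big_cat_nat _ _ _ n)//= [X in _ + X]big1_seq ?addr0 => [|k]; last by rewrite mem_index_iota /= => /andP[nk _]; apply: z.
rewrite /expm mulmx_sumr big_mkord big_ord_recr /= Dn scaler0 mulmx0 addr0.
by apply: eq_bigr => i _; rewrite -scalemxAr.
Qed.

Lemma expm_aut D u v : is_der br D -> D ^+ n = 0 ->
  br u v *m expm D = br (u *m expm D) (v *m expm D).
Proof.
move=> dD Dn.
rewrite (@expm_dpow D _ (n + n))// ?leq_addr// !(@expm_dpow D _ n)//.
under eq_bigr do rewrite dpow_br//.
rewrite (sum_triangle (fun i j => br (dpow D i u) (dpow D j v))).
have z k w : (n <= k)%N -> dpow D k w = 0.
  by move=> nk; rewrite /dpow -(subnKC nk) exprD Dn mul0r mulmx0 scaler0.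
rewrite (@big_cat_nat _ _ _ n) ?leq_addr//= [X in _ + X]big1_seq ?addr0; last first.
  by move=> k; rewrite mem_index_iota /= => /andP[nk _]; apply: big1 => j _; rewrite (z k)// (br0l lb).
rewrite (br_suml lb); apply: eq_big_nat => i /andP[_ ni].
rewrite (@big_cat_nat _ _ _ n)//=; last by rewrite -(addnBA _ (ltnW ni)) leq_addr.
rewrite [X in _ + X]big1_seq ?addr0 ?(br_sumr lb)//.
by move=> k; rewrite mem_index_iota /= => /andP[nk _]; rewrite (z k)// (br0r lb).
Qed.

Lemma expm_det D : D ^+ n = 0 -> \det (expm D) = 1.
Proof.
move=> Dn; pose Q := \sum_(k < n) (k.+1`!%:R)^-1 *: D ^+ k.
have -> : expm D = 1 + D * Q.
  rewrite /expm big_ord_recl /= invr1 scale1r expr0 mulr_sumr; congr (_ + _).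
  by apply: eq_bigr => k _; rewrite /bump add1n -scalerAr exprS.
apply: (nilp_det (k := n)).
have DQ : GRing.comm D Q.
  apply: commr_sum => k _; rewrite /GRing.comm -scalerAr -scalerAl.
  by rewrite -exprS -exprSr.
by rewrite exprMn_comm// Dn mul0r.
Qed.

Definition is_aut g := forall u v, br u v *m g = br (u *m g) (v *m g).

Lemma ad_nilpotentn x : ad_nilpotent br x -> ad br x ^+ n = 0.
Proof. by move=> [k]; apply: nilp_exp. Qed.

Lemma adjoint_group_ind (Q : 'M[K]_n -> Prop) : Q 1 ->
  (forall g h, Q g -> Q h -> Q (g * h)) ->
  (forall x, ad_nilpotent br x -> Q (expm (ad br x))) ->
  forall g, adjoint_group br g -> Q g.
Proof.
move=> Q1 QM Qe g [s [sn ->]]; elim: s sn => [|x s IH] sn; first by rewrite big_nil.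
rewrite big_cons; apply: QM; first by apply/Qe/sn; rewrite mem_head.
by apply: IH => y ys; apply: sn; rewrite inE ys orbT.
Qed.

Lemma adjoint_aut g : adjoint_group br g -> is_aut g.
Proof.
move: g; apply: adjoint_group_ind => [u v|g h ag ah u v|x nx u v].
- by rewrite !mulmx1.
- by rewrite -mulmxE !mulmxA ag ah.
by apply: expm_aut; [exact: der_ad | exact: ad_nilpotentn].
Qed.

Lemma adjoint_det g : adjoint_group br g -> \det g = 1.
Proof.
move: g; apply: adjoint_group_ind => [|g h ag ah|x nx]; first exact: det1.
- by rewrite -mulmxE det_mulmx ag ah mulr1.
by apply/expm_det/ad_nilpotentn.
Qed.

Lemma adjoint_unit g : adjoint_group br g -> g \in unitmx.
Proof. by move/adjoint_det => d; rewrite unitmxE d unitr1. Qed.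

Lemma adjoint_mul g h : adjoint_group br g -> adjoint_group br h -> adjoint_group br (g *m h).
Proof.
move=> [s [sn ->]] [r [rn ->]]; exists (s ++ r); split; last by rewrite big_cat.
by move=> x; rewrite mem_cat => /orP[/sn|/rn].
Qed.

Lemma adjoint_exp x : ad_nilpotent br x -> adjoint_group br (expm (ad br x)).
Proof.
by move=> nx; exists [:: x]; split; [move=> y; rewrite inE => /eqP->|rewrite big_seq1].
Qed.

Lemma ad_aut g x : g \in unitmx -> is_aut g -> ad br (x *m g) = invmx g *m ad br x *m g.
Proof.
move=> ug ag; apply: mx_ext => w; rewrite (mul_ad lb) -{1}(mulmxKV ug w) -ag.
by rewrite !mulmxA -(mul_ad lb).
Qed.

Lemma ad_nilpotent_aut g x : g \in unitmx -> is_aut g -> ad_nilpotent br x -> ad_nilpotent br (x *m g).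
Proof.
move=> ug ag [k xk]; exists k; rewrite ad_aut//.
suff -> : forall j, (invmx g *m ad br x *m g) ^+ j = invmx g *m ad br x ^+ j *m g.
  by rewrite xk mulmx0 mul0mx.
elim=> [|j IH]; first by rewrite !expr0 mulmx1 mulVmx.
by rewrite exprSr IH -mulmxE !mulmxA mulmxK// -(mulmxA (invmx g)) mulmxE -exprSr.
Qed.

(** Differentiation along the orbit is carried out for nilpotent [x] only, whose exponentials lie in
    the group; this extends linear conclusions to all [x]. Conjugates of nilpotents are
    nilpotent. *)
Lemma nilpotents_span (W : 'M[K]_n) : semisimple br ->
  (forall x, ad_nilpotent br x -> (x <= W)%MS) -> (1%:M <= W)%MS.
Proof.
move=> ss nW; apply: (nilpotents_full lb ss nW) => x y nx ny; apply: nW.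
have ae := adjoint_exp nx.
by apply: ad_nilpotent_aut => //; [exact: adjoint_unit | exact: adjoint_aut].
Qed.

End Exponential.

(** * The Lie-Kolchin theorem *)

Section Zariski.
Variables (K : fieldType) (T I : Type) (coord : T -> I -> K).

Definition polyfun (f : T -> K) := exists p, forall t, f t = peval (coord t) p.

Lemma polyfun_const c : polyfun (fun=> c). Proof. by exists (PConst _ c). Qed.
Lemma polyfun_var i : polyfun (fun t => coord t i). Proof. by exists (PVar _ i). Qed.
Lemma polyfunD f g : polyfun f -> polyfun g -> polyfun (fun t => f t + g t).
Proof. by move=> [p fp] [q gq]; exists (PAdd p q) => t; rewrite fp gq. Qed.
Lemma polyfunM f g : polyfun f -> polyfun g -> polyfun (fun t => f t * g t).
Proof. by move=> [p fp] [q gq]; exists (PMul p q) => t; rewrite fp gq. Qed.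
Lemma polyfun_ext f g : f =1 g -> polyfun f -> polyfun g.
Proof. by move=> fg [p fp]; exists p => t; rewrite -fg. Qed.
Lemma polyfun_sum (J : Type) (r : seq J) (Q : pred J) (F : J -> T -> K) :
  (forall j, polyfun (F j)) -> polyfun (fun t => \sum_(j <- r | Q j) F j t).
Proof.
move=> pF; elim: r => [|j r IH].
  by apply: polyfun_ext (polyfun_const 0) => t; rewrite big_nil.
case Qj : (Q j); last by apply: polyfun_ext IH => t; rewrite big_cons Qj.
by apply: polyfun_ext (polyfunD (pF j) IH) => t; rewrite big_cons Qj.
Qed.
Lemma polyfun_prod (J : Type) (r : seq J) (Q : pred J) (F : J -> T -> K) :
  (forall j, polyfun (F j)) -> polyfun (fun t => \prod_(j <- r | Q j) F j t).
Proof.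
move=> pF; elim: r => [|j r IH].
  by apply: polyfun_ext (polyfun_const 1) => t; rewrite big_nil.
case Qj : (Q j); last by apply: polyfun_ext IH => t; rewrite big_cons Qj.
by apply: polyfun_ext (polyfunM (pF j) IH) => t; rewrite big_cons Qj.
Qed.

Definition polymx m k (A : T -> 'M[K]_(m, k)) := forall i j, polyfun (fun t => A t i j).

Lemma polymx_const m k (A : 'M[K]_(m, k)) : polymx (fun=> A).
Proof. by move=> i j; apply: polyfun_const. Qed.
Lemma polymx_mul m k l (A : T -> 'M[K]_(m, k)) (B : T -> 'M_(k, l)) :
  polymx A -> polymx B -> polymx (fun t => A t *m B t).
Proof.
move=> pA pB i j; apply: (@polyfun_ext (fun t => \sum_k0 A t i k0 * B t k0 j)).
  by move=> t; rewrite mxE.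
by apply: polyfun_sum => l0; apply: polyfunM.
Qed.
Lemma polymx_lin m k a (A B : T -> 'M[K]_(m, k)) :
  polymx A -> polymx B -> polymx (fun t => a *: A t + B t).
Proof.
move=> pA pB i j; apply: (@polyfun_ext (fun t => a * A t i j + B t i j)).
  by move=> t; rewrite !mxE.
by apply: polyfunD => //; apply: polyfunM => //; apply: polyfun_const.
Qed.
Lemma polyfun_det m (A : T -> 'M[K]_m) : polymx A -> polyfun (fun t => \det (A t)).
Proof.
move=> pA; apply: polyfun_sum => s; apply: polyfunM; first exact: polyfun_const.
by apply: polyfun_prod => i.
Qed.
Lemma polymx_adj m (A : T -> 'M[K]_m) : polymx A -> polymx (fun t => \adj (A t)).
Proof.
move=> pA i j; apply: (@polyfun_ext (fun t => cofactor (A t) j i)) => [t|]; first by rewrite mxE.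
apply: polyfunM; first exact: polyfun_const.
by apply: polyfun_det => i' j'; apply: polyfun_ext (pA _ _) => t; rewrite !mxE.
Qed.

Lemma zclosed_zero m k (A : T -> 'M[K]_(m, k)) : polymx A -> zclosed coord (fun t => A t = 0).
Proof.
move=> pA; exists (fun p => exists i j, forall t, A t i j = peval (coord t) p) => t.
split=> [A0 p [i [j e]]|e]; first by rewrite -e A0 mxE.
by apply/matrixP => i j; rewrite mxE; have [p ep] := pA i j; rewrite ep; apply: e; exists i, j.
Qed.

Lemma zclosed_false : zclosed coord (fun=> False).
Proof.
exists (eq (PConst _ 1)) => t; split=> // /(_ _ erefl) /= /eqP.
by rewrite oner_eq0.
Qed.

Lemma zclosed_ext C C' : (forall t, C t <-> C' t) -> zclosed coord C -> zclosed coord C'.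
Proof. by move=> CC' [P CP]; exists P => t; rewrite -CC'. Qed.

Lemma zclosed_or C C' : zclosed coord C -> zclosed coord C' -> zclosed coord (fun t => C t \/ C' t).
Proof.
move=> [P CP] [P' CP']; exists (fun r => exists p q, [/\ P p, P' q & r = PMul p q]) => t; split.
  move=> [/CP|/CP'] e _ [p [q [Pp Pq ->]]] /=; first by rewrite e// mul0r.
  by rewrite (e _ Pq) mulr0.
move=> e; have [Ct|nCt] := pselect (C t); [by left | right].
apply/CP' => q Pq; apply/eqP/negPn/negP => q0; apply: nCt; apply/CP => p Pp.
have : peval (coord t) (PMul p q) = 0 by apply: e; exists p, q.
by move=> /= /eqP; rewrite mulf_eq0 (negPf q0) orbF => /eqP.
Qed.

Lemma zclosed_bigor (J : eqType) (s : seq J) (C : J -> T -> Prop) :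
  (forall j, zclosed coord (C j)) -> zclosed coord (fun t => exists2 j, j \in s & C j t).
Proof.
move=> cC; elim: s => [|j s IH].
  by apply: zclosed_ext zclosed_false => t; split=> // -[].
apply: zclosed_ext (zclosed_or (cC j) IH) => t; split.
  by move=> [Cj|[k ks Ck]]; [exists j; rewrite ?mem_head | exists k; rewrite // inE ks orbT].
by move=> [k]; rewrite inE => /predU1P[->|ks] Ck; [left | right; exists k].
Qed.

(** A connected set covered by finitely many closed sets that are disjoint on it lies in one of
    them. The index will be an eigenvalue, restricted to finitely many values. *)
Lemma zconnected_const Y (J : eqType) (s : seq J) (C : J -> T -> Prop) t0 j0 :
  zconnected coord Y -> (forall j, zclosed coord (C j)) ->
  (forall t, Y t -> exists2 j, j \in s & C j t) ->
  (forall t i j, Y t -> C i t -> C j t -> i = j) ->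
  Y t0 -> C j0 t0 -> forall t, Y t -> C j0 t.
Proof.
move=> cY cC exC unC Yt0 Ct0.
pose Z1 t := Y t /\ C j0 t.
pose Z2 t := Y t /\ exists2 j, j \in [seq j <- s | j != j0] & C j t.
have [||||n1|nZ2] := cY Z1 Z2.
- by split=> [t []//|]; exists (C j0).
- by split=> [t []//|]; eexists; split; first exact: (zclosed_bigor [seq j <- s | j != j0] cC).
- move=> t; split=> [Yt|[] []//]; have [j js Cj] := exC t Yt.
  have [jj|jj] := eqVneq j j0; first by left; split; rewrite // -jj.
  by right; split=> //; exists j; rewrite // mem_filter jj.
- move=> t [[Yt C0] [_ [j]]]; rewrite mem_filter => /andP[/eqP jj _] Cj.
  by apply: jj; apply: (unC t).
- by case: (n1 t0); split.
move=> t Yt; have [j js Cj] := exC t Yt.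
have [<-//|jj] := eqVneq j j0; case: (nZ2 t); split=> //.
by exists j; rewrite // mem_filter jj.
Qed.

Fixpoint psubst (S : Type) (f : S -> pexpr K I) (p : pexpr K S) : pexpr K I :=
  match p with
  | PConst c => PConst _ c
  | PVar i => f i
  | PAdd p q => PAdd (psubst f p) (psubst f q)
  | PMul p q => PMul (psubst f p) (psubst f q)
  end.

Lemma peval_psubst (S : Type) (f : S -> pexpr K I) (coord' : S -> K) t :
  (forall i, coord' i = peval (coord t) (f i)) ->
  forall p, peval (coord t) (psubst f p) = peval coord' p.
Proof. by move=> e; elim=> //= p -> q ->. Qed.

End Zariski.

Lemma polyfun_comp (K : fieldType) (T I T' I' : Type) (coord : T -> I -> K)
  (coord' : T' -> I' -> K) (phi : T -> T') f :
  (forall i, polyfun coord (fun t => coord' (phi t) i)) -> polyfun coord' f ->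
  polyfun coord (fun t => f (phi t)).
Proof.
move=> pphi [p fp]; have [s sP] := boolp.choice pphi.
by exists (psubst s p) => t; rewrite fp; symmetry; apply: peval_psubst => i; apply: sP.
Qed.

Lemma zclosed_preim (K : fieldType) (T I T' I' : Type) (coord : T -> I -> K)
  (coord' : T' -> I' -> K) (phi : T -> T') C :
  (forall i, polyfun coord (fun t => coord' (phi t) i)) -> zclosed coord' C ->
  zclosed coord (fun t => C (phi t)).
Proof.
move=> pphi [P CP].
exists (fun r => exists2 p, P p & forall t, peval (coord' (phi t)) p = peval (coord t) r) => t.
rewrite CP; split=> [h r [p Pp <-]|h p Pp]; first exact: h.
have [|r e] := @polyfun_comp _ _ _ _ _ coord coord' phi (fun w => peval (coord' w) p) pphi.
  by exists p.
by rewrite e; apply: h; exists p.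
Qed.

Lemma invmx_eq (K : fieldType) n (X Y : 'M[K]_n) : X *m Y = 1%:M -> invmx X = Y.
Proof. by move=> XY; have [uX _] := mulmx1_unit XY; rewrite -[RHS](mulKmx uX) XY mulmx1. Qed.

Section LieKolchin.
Variables (K : numClosedFieldType) (n' : nat).
Local Notation n := n'.+1.
Implicit Types (A B M a b d g : 'M[K]_n) (H : 'M[K]_n -> Prop) (v w : 'rV[K]_n).
Local Notation mcoord := (@mcoord K n).

(** Determinant 1 makes the inverse the adjugate, hence polynomial in the entries. *)
Record sl_group H : Prop := SlGroup {
  slg1 : H 1%:M;
  slgM : forall a b, H a -> H b -> H (a *m b);
  slgV : forall a, H a -> H (invmx a);
  slg_det : forall a, H a -> \det a = 1 }.

Lemma slg_unit H a : sl_group H -> H a -> a \in unitmx.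
Proof. by move=> gH /(slg_det gH) d; rewrite unitmxE d unitr1. Qed.

Lemma derived_comm H a b : H a -> H b -> derived_group H (a * b * invmx a * invmx b).
Proof.
by move=> Ha Hb; exists [:: (a, b)]; split=> [p|]; [rewrite inE => /eqP-> | rewrite big_seq1].
Qed.

Lemma derived_mul H g g' : derived_group H g -> derived_group H g' -> derived_group H (g *m g').
Proof.
move=> [s [sH ->]] [r [rH ->]]; exists (s ++ r); split; last by rewrite big_cat.
by move=> p; rewrite mem_cat => /orP[/sH|/rH].
Qed.

Lemma derived_ind H (Q : 'M[K]_n -> Prop) : Q 1%:M ->
  (forall g a b, derived_group H g -> Q g -> H a -> H b -> Q (g *m (a * b * invmx a * invmx b))) ->
  forall g, derived_group H g -> Q g.
Proof.
move=> Q1 QM g [s [sH ->]]; elim/last_ind: s sH => [|s p IH] sH; first by rewrite big_nil.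
have sH' q : q \in s -> H q.1 /\ H q.2 by move=> qs; apply: sH; rewrite mem_rcons inE qs orbT.
have [Hp1 Hp2] : H p.1 /\ H p.2 by apply: sH; rewrite mem_rcons mem_head.
rewrite -cats1 big_cat big_seq1 /= -mulmxE; apply: QM => //; last exact: IH.
by exists s.
Qed.

Lemma derived_sl_group H : sl_group H -> sl_group (derived_group H).
Proof.
move=> gH; have uH a : H a -> a \in unitmx by apply: slg_unit.
have dd g : derived_group H g -> \det g = 1.
  move: g; apply: derived_ind => [|g a b _ dg Ha Hb]; first exact: det1.
  by rewrite -!mulmxE !det_mulmx dg !det_inv !(slg_det gH)// invr1 !mulr1.
split=> //.
- by exists [::]; split=> //; rewrite big_nil.
- by move=> a b; apply: derived_mul.
apply: derived_ind => [|g a b dg Vg Ha Hb].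
  by exists [::]; split=> //; rewrite big_nil invmx1.
have ug : g \in unitmx by rewrite unitmxE dd ?unitr1.
have uc : a * b * invmx a * invmx b \in unitmx.
  by rewrite -!mulmxE !unitmx_mul !unitmx_inv !uH.
have -> : invmx (g *m (a * b * invmx a * invmx b)) = (b * a * invmx b * invmx a) *m invmx g.
  apply: invmx_eq; rewrite -!mulmxE !mulmxA.
  by rewrite mulmxKV ?uH// mulmxKV ?uH// mulmxK ?uH// mulmxK ?uH// mulmxV.
by apply: derived_mul => //; apply: derived_comm.
Qed.

Lemma derived_conj H b d : sl_group H -> H b -> derived_group H d -> derived_group H (b *m d *m invmx b).
Proof.
move=> gH Hb; have ub : b \in unitmx by apply: slg_unit Hb.
move: d; apply: derived_ind => [|g a c _ IH Ha Hc].
  by rewrite mulmx1 mulmxV//; exists [::]; split=> //; rewrite big_nil.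
have ua : a \in unitmx by apply: slg_unit Ha.
have uc : c \in unitmx by apply: slg_unit Hc.
have cj x : H x -> H (b *m x *m invmx b) by move=> Hx; do 2 ?[apply: slgM => //]; apply: slgV.
have iv x : x \in unitmx -> invmx (b *m x *m invmx b) = b *m invmx x *m invmx b.
  move=> ux; apply: invmx_eq.
  by rewrite !mulmxA mulmxKV// mulmxK// mulmxV.
have -> : b *m (g *m (a * c * invmx a * invmx c)) *m invmx b = b *m g *m invmx b *m
   ((b *m a *m invmx b) * (b *m c *m invmx b) * invmx (b *m a *m invmx b) * invmx (b *m c *m invmx b)).
  by rewrite !iv// -!mulmxE !mulmxA !(mulmxKV ub).
by apply: derived_mul => //; apply: derived_comm; apply: cj.
Qed.

Lemma invmx_adj a : \det a = 1 -> invmx a = \adj a.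
Proof. by move=> d; rewrite /invmx unitmxE d unitr1 invr1 scale1r. Qed.

Lemma polymx_id : polymx mcoord (fun a => a).
Proof. by move=> i j; apply: (polyfun_var mcoord (i, j)). Qed.

(* Multiplication by a commutator [a b a^-1 b^-1] stays in one piece of a clopen
   partition, as [a] moves in the connected [H] from the identity. *)
Lemma derived_connected H : sl_group H -> zconnected mcoord H -> zconnected mcoord (derived_group H).
Proof.
move=> gH cH Z1 Z2 [sub1 [C1 [cC1 eZ1]]] [sub2 [C2 [cC2 eZ2]]] cov disj.
wlog Z11 : Z1 Z2 sub1 sub2 C1 C2 cC1 cC2 eZ1 eZ2 cov disj / Z1 1%:M.
  move=> W; have := (cov 1%:M).1 (slg1 (derived_sl_group gH)).
  case=> z1; first exact: (W Z1 Z2 sub1 sub2 C1 C2).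
  rewrite or_comm; apply: (W Z2 Z1 sub2 sub1 C2 C1) => // t; last by rewrite and_comm.
  by rewrite cov or_comm.
right; suff all1 : forall g, derived_group H g -> Z1 g.
  by move=> t Z2t; apply: (disj t); split=> //; apply/all1/sub2.
apply: derived_ind => // g a b Dg Z1g Ha Hb.
pose phi x := g *m (x *m b *m \adj x *m invmx b).
have phiE x : H x -> phi x = g *m (x * b * invmx x * invmx b).
  by move=> Hx; rewrite (invmx_adj (slg_det gH Hx)).
have Dphi x : H x -> derived_group H (phi x).
  by move=> Hx; rewrite phiE//; apply: derived_mul => //; apply: derived_comm.
have pphi ij : polyfun mcoord (fun x => mcoord (phi x) ij).
  apply: polymx_mul; first exact: polymx_const.
  apply: polymx_mul; last exact: polymx_const.
  apply: polymx_mul; last exact/polymx_adj/polymx_id.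
  by apply: polymx_mul; [exact: polymx_id | exact: polymx_const].
have rc Z C : zclosed mcoord C -> (forall t, Z t <-> derived_group H t /\ C t) ->
    rel_closed mcoord H (fun x => H x /\ Z (phi x)).
  move=> cC eZ; split=> [x []//|]; exists (fun x => C (phi x)); split; first exact: zclosed_preim pphi cC.
  by move=> x; split=> [[Hx /eZ[_ Cx]]|[Hx Cx]]; split=> //; apply/eZ; split=> //; apply: Dphi.
have [||n1|n2] := cH _ _ (rc Z1 C1 cC1 eZ1) (rc Z2 C2 cC2 eZ2).
- move=> x; split=> [Hx|[] []//].
  by have [z|z] := (cov _).1 (Dphi x Hx); [left | right].
- by move=> x [[_ z1] [_ z2]]; apply: (disj (phi x)).
- case: (n1 1%:M); split; first exact: slg1.
  rewrite (phiE _ (slg1 gH)) -!mulmxE mul1mx invmx1 mulmx1 mulmxV ?mulmx1//.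
  exact: slg_unit Hb.
have [|z2] := (cov _).1 (Dphi a Ha); first by rewrite phiE.
by case: (n2 a).
Qed.

(** Otherwise [a - x] is invertible and maps [A] onto itself, so [v] would lie in [A]. *)
Lemma eig_mod_root A a (x : K) v : (forall u : 'rV_n, (u <= A)%MS -> (u *m a <= A)%MS) ->
  ~~ (v <= A)%MS -> (v *m a - x *: v <= A)%MS -> root (char_poly a) x.
Proof.
move=> sA vA; apply: contraLR; rewrite -eigenvalue_root_char => nx.
have ua := not_eigenvalue_unit nx.
have sub : (A *m (a - x%:M) <= A)%MS.
  apply: row_ext_sub => u /submxP[c ->]; rewrite mulmxA mulmxBr mul_mx_scalar.
  by rewrite addmx_sub ?sA ?submxMl// eqmx_opp scalemx_sub ?submxMl.
have rk : \rank (A *m (a - x%:M)) = \rank A by rewrite mxrankMfree ?row_free_unit.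
have sub' : (A <= A *m (a - x%:M))%MS by rewrite -(mxrank_leqif_sup sub) rk.
apply: contra vA => vx; rewrite -(mulmxK ua v).
have : (v *m (a - x%:M) <= A *m (a - x%:M))%MS.
  by apply: submx_trans sub'; rewrite mulmxBr mul_mx_scalar.
by move=> /submxP[c ->]; rewrite mulmxA mulmxK// submxMl.
Qed.

Lemma zclosed_eig A (a : K) (f : 'M[K]_n -> 'rV[K]_n) (h : 'M[K]_n -> 'rV[K]_n) :
  polymx mcoord f -> polymx mcoord h -> zclosed mcoord (fun b => (f b - a *: h b <= A)%MS).
Proof.
move=> pf ph.
apply: (@zclosed_ext _ _ _ _ (fun b => (- a *: h b + f b) *m cokermx A = 0)).
  move=> b; rewrite scaleNr addrC submxE; split=> [->//|/eqP//].
by apply: zclosed_zero; apply: polymx_mul; [exact: polymx_lin | exact: polymx_const].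
Qed.

Lemma eig_unique A v (x y : K) u : ~~ (v <= A)%MS ->
  (u - x *: v <= A)%MS -> (u - y *: v <= A)%MS -> x = y.
Proof.
move=> vA ux uy; apply/eqP; rewrite -subr_eq0; apply: contraR vA => xy.
rewrite -(eqmx_scale _ xy) scalerBl.
have -> : x *: v - y *: v = (u - y *: v) - (u - x *: v) by rewrite opprB [RHS]addrC addrA subrK.
by rewrite addmx_sub ?eqmx_opp.
Qed.

(** The group version of [lie_thm], with connectedness in place of the Krylov argument. The derived
    group [D] has a weight [chi] on a minimal [M] modulo [A]. As [b] varies in [H], the eigenvalue
    [chi] of the conjugate of [d] by [b] stays among the eigenvalues of [d], so it is constant and
    the weight space fills [M]. The same reasoning makes commutators act trivially, and eigenspaces
    of commuting maps are stable. *)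
Theorem lie_kolchin k H A B : sl_group H -> zconnected mcoord H ->
  (forall g, iter k (@derived_group K n) H g -> g = 1%:M) ->
  stable_under H A -> stable_under H B -> (A <= B)%MS -> ~~ (B <= A)%MS ->
  exists w, [/\ (w <= B)%MS, ~~ (w <= A)%MS & eig_mod H A w].
Proof.
elim: k H A B => [|k IH] H A B gH cH sH sA sB AB nBA.
  have /row_subPn[i iA] := nBA; exists (row i B); rewrite row_sub iA; split=> // g /sH->.
  by exists 1; rewrite mulmx1 scale1r subrr sub0mx.
pose Q M := [/\ (A <= M)%MS, ~~ (M <= A)%MS, stable_under H M & (M <= B)%MS].
have [M [AM nMA sM MB] minM] : exists2 M, Q M & forall M', Q M' -> (\rank M <= \rank M')%N.
  by apply: (@exists_min_rank _ _ Q B).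
suff [w [wM wA wS]] : exists w, [/\ (w <= M)%MS, ~~ (w <= A)%MS & eig_mod H A w].
  by exists w; split=> //; apply: submx_trans MB.
have minS M' : (A <= M')%MS -> (M' <= M)%MS -> stable_under H M' -> ~~ (M' <= A)%MS -> (M <= M')%MS.
  move=> AM' M'M sM' nM'; rewrite -(mxrank_leqif_sup M'M) eqn_leq mxrankS//=.
  by apply: minM; split=> //; apply: submx_trans MB.
clear B sB AB nBA MB minM Q.
set D := derived_group H; have gD : sl_group D := derived_sl_group gH.
have uH a : H a -> a \in unitmx by apply: slg_unit.
have DH g : D g -> H g.
  move: g; apply: derived_ind => [|g a b _ Hg Ha Hb]; first exact: slg1.
  by rewrite -!mulmxE; do ?apply: (slgM gH) => //; apply: (slgV gH).
have sD M' : stable_under H M' -> stable_under D M' by move=> s d v /DH; apply: s.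
have notA v a : H a -> ~~ (v <= A)%MS -> ~~ (v *m a <= A)%MS.
  move=> Ha; apply: contra => va; rewrite -(mulmxK (uH a Ha) v).
  by apply: sA => //; apply: slgV.
have [|w [wM wA wD]] := IH D A M gD (derived_connected gH cH) _ (sD _ sA) (sD _ sM) AM nMA.
  by move=> g; rewrite -iterSr; apply: sH.
have [chi wchi] : {chi : 'M[K]_n -> K & forall d, D d -> (w *m d - chi d *: w <= A)%MS}.
  apply: (@boolp.choice _ _ (fun d (x : K) => D d -> (w *m d - x *: w <= A)%MS)) => d.
  by have [/wD[a ?]|Dd] := pselect (D d); [exists a | exists 0].
have pv v : polymx mcoord (fun b => v *m b).
  by apply: polymx_mul; [exact: polymx_const | exact: polymx_id].
have [rs rsP] : exists rs : 'M[K]_n -> seq K, forall a x, root (char_poly a) x -> x \in rs a.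
  have [rs rsP] := boolp.choice (@char_poly_split K n').
  by exists rs => a x; rewrite rsP root_prod_XsubC.
have trans v : (v <= M)%MS -> (forall d, D d -> (v *m d - chi d *: v <= A)%MS) ->
    forall b d, H b -> D d -> (v *m b *m d - chi d *: (v *m b) <= A)%MS.
  move=> vM vD b d Hb Dd.
  have [vA|vA] := boolP (v <= A)%MS.
    have vbA : (v *m b <= A)%MS by apply: sA.
    by apply: addmx_sub; [apply: sA => //; exact: DH | rewrite eqmx_opp scalemx_sub].
  pose C x b := (v *m b *m d - x *: (v *m b) <= A)%MS.
  apply: (@zconnected_const _ _ _ _ H _ (rs d) C 1%:M (chi d) cH) => //.
  - move=> x; apply: zclosed_eig => //; apply: polymx_mul => //; exact: polymx_const.
  - move=> c Hc; have Dc : D (c *m d *m invmx c) by apply: derived_conj.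
    have Cc : C (chi (c *m d *m invmx c)) c.
      have := sA c _ Hc (vD _ Dc); rewrite mulmxBl -scalemxAl !mulmxA.
      by rewrite mulmxKV ?uH.
    exists (chi (c *m d *m invmx c)) => //; apply: rsP.
    apply: eig_mod_root Cc; last exact: notA.
    by move=> u uA; apply: sA => //; apply: DH.
  - by move=> c x y Hc; apply: eig_unique; apply: notA.
  - exact: slg1.
  - by rewrite /C mulmx1; apply: vD.
have wt v d : (v <= M)%MS -> D d -> (v *m d - chi d *: v <= A)%MS.
  have [||W WP] := @subspace_mx K n (fun v => (v <= M)%MS /\ forall d, D d -> (v *m d - chi d *: v <= A)%MS).
  - by rewrite sub0mx; split=> // c _; rewrite mul0mx scaler0 subr0 sub0mx.
  - move=> a u1 u2 [u1M u1P] [u2M u2P]; split=> [|c Dc]; first by rewrite addmx_sub ?scalemx_sub.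
    have -> : (a *: u1 + u2) *m c - chi c *: (a *: u1 + u2) =
       a *: (u1 *m c - chi c *: u1) + (u2 *m c - chi c *: u2).
      by rewrite mulmxDl -scalemxAl scalerDr opprD addrACA scalerBr !scalerA mulrC.
    by rewrite addmx_sub ?scalemx_sub ?u1P ?u2P.
  suff MW : (M <= W)%MS by move=> vM; have [_] := (WP v).1 (submx_trans vM MW); apply.
  apply: minS.
  - apply: row_ext_sub => u uA; apply/WP; split=> [|c Dc]; first exact: submx_trans AM.
    by rewrite addmx_sub ?(sD _ sA)// eqmx_opp scalemx_sub.
  - by apply: row_ext_sub => u /WP[].
  - move=> b u Hb /WP[uM uP]; apply/WP; split=> [|c Dc]; first exact: sM.
    exact: trans.
  - by apply: contra wA => WA; apply: submx_trans WA; apply/WP.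
have comm a b v : H a -> H b -> (v <= M)%MS -> (v *m a *m b - v *m b *m a <= A)%MS.
  move=> Ha Hb vM; have [vA|vA] := boolP (v <= A)%MS.
    by rewrite addmx_sub ?eqmx_opp// !sA.
  have [|z [mu [zM zA za]]] := @eig_quot K n' a A M _ nMA.
    by move=> u uM; apply: sM.
  (* Here [x] is the scalar of the commutator of [a] and [b]. If [z] has eigenvalue [mu] for [a],
     then [z *m b] has eigenvalue [mu / x], so finitely many [x] occur; at [b = 1] the scalar is
     1. *)
  pose C x b := (v *m a *m b - x *: (v *m b *m a) <= A)%MS.
  have -> : v *m b *m a = 1 *: (v *m b *m a) by rewrite scale1r.
  apply: (@zconnected_const _ _ _ _ H _ [seq mu / x | x <- rs a] C 1%:M 1 cH) => //.
  - move=> x; apply: zclosed_eig => //; apply: polymx_mul => //; exact: polymx_const.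
  - move=> c Hc; pose d := a * c * invmx a * invmx c.
    have Dd : D d by apply: derived_comm.
    have ed (u : 'rV[K]_n) : u *m d *m (c *m a) = u *m a *m c.
      by rewrite /d -!mulmxE !mulmxA mulmxKV ?uH// mulmxKV ?uH.
    have Cd (u : 'rV[K]_n) : (u <= M)%MS -> (u *m a *m c - chi d *: (u *m c *m a) <= A)%MS.
      move=> uM; have := sA (c *m a) _ (slgM gH Hc Ha) (wt u d uM Dd).
      by rewrite mulmxBl ed -scalemxAl mulmxA.
    have zc0 := notA z c Hc zA.
    have zac : (mu *: (z *m c) - chi d *: (z *m c *m a) <= A)%MS.
      have -> : mu *: (z *m c) - chi d *: (z *m c *m a) =
        (z *m a *m c - chi d *: (z *m c *m a)) - (z *m a - mu *: z) *m c.
        rewrite mulmxBl -scalemxAl; move: (z *m a *m c) (mu *: _) (chi d *: _) => p q r.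
        by apply/matrixP => i j; rewrite !mxE; ring.
      by rewrite addmx_sub ?Cd// eqmx_opp sA.
    have mu0 : mu != 0.
      apply: contraNneq (notA z a Ha zA) => mu0.
      by rewrite mu0 scale0r subr0 in za.
    have chi0 : chi d != 0.
      apply: contraNneq zc0 => c0; move: zac; rewrite c0 scale0r subr0.
      by rewrite eqmx_scale.
    exists (chi d); last exact: Cd.
    apply/mapP; exists (mu / chi d); last by rewrite invf_div mulrCA mulfV// mulr1.
    apply: rsP; apply: (@eig_mod_root A a _ (z *m c)) => //.
      by move=> u uA; apply: sA.
    rewrite -(eqmx_scale _ chi0) scalerBr scalerA mulrC divfK//.
    by rewrite -eqmx_opp opprB.
  - move=> c x y Hc; apply: eig_unique; apply: (notA _ a Ha); exact: notA.
  - exact: slg1.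
  - by rewrite /C !mulmx1 scale1r subrr sub0mx.
exists w; split=> // s Hs.
have [|z [a [zM zA zs]]] := @eig_quot K n' s A M _ nMA.
  by move=> u uM; apply: sM.
exists a; have [||W WP] := @subspace_mx K n (fun v => (v <= M)%MS /\ (v *m s - a *: v <= A)%MS).
- by rewrite mul0mx scaler0 subr0 !sub0mx.
- move=> b u1 u2 [u1M u1P] [u2M u2P]; split; first by rewrite addmx_sub ?scalemx_sub.
  have -> : (b *: u1 + u2) *m s - a *: (b *: u1 + u2) =
       b *: (u1 *m s - a *: u1) + (u2 *m s - a *: u2).
    by rewrite mulmxDl -scalemxAl scalerDr opprD addrACA scalerBr !scalerA mulrC.
  by rewrite addmx_sub ?scalemx_sub.
suff MW : (M <= W)%MS by have [_] := (WP w).1 (submx_trans wM MW).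
apply: minS.
- apply: row_ext_sub => u uA; apply/WP; split; first exact: submx_trans AM.
  by rewrite addmx_sub ?sA// eqmx_opp scalemx_sub.
- by apply: row_ext_sub => u /WP[].
- move=> x u Hx /WP[uM uP]; apply/WP; split; first exact: sM.
  have -> : u *m x *m s - a *: (u *m x) = (u *m s - a *: u) *m x + (u *m x *m s - u *m s *m x).
    by rewrite mulmxBl -scalemxAl [RHS]addrC addrA subrK.
  by rewrite addmx_sub ?comm// sA.
- by apply: contra zA => WA; apply: submx_trans WA; apply/WP.
Qed.

Lemma lie_kolchin_trig H : sl_group H -> zconnected mcoord H -> solvable_group H ->
  exists2 P, P \in unitmx & forall g, H g -> is_trig_mx (P *m g *m invmx P).
Proof.
move=> gH cH [k sH]; apply: trig_of_flags => A sA nA.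
have [|||w [_ wA wH]] := @lie_kolchin k H A 1%:M gH cH sH sA.
- by move=> f v _ _; rewrite submx1.
- by rewrite submx1.
- exact: nA.
by exists w.
Qed.

End LieKolchin.

(** * Ultrapowers *)

Section Ultrapower.
Local Open Scope quotient_scope.
Variables (K : fieldType) (T : Type) (F : set_system T).
Hypothesis UF : UltraFilter F.

Let FT (P : T -> Prop) : (forall t, P t) -> F P.
Proof. by move=> Pt; apply: filterS filterT => t _. Qed.

Definition ultra_eq (f g : T -> K) : bool := `[< F (fun t => f t = g t) >].

Lemma ultra_eq_refl : reflexive ultra_eq.
Proof. by move=> f; apply/asboolP/FT. Qed.
Lemma ultra_eq_sym : symmetric ultra_eq.
Proof. by move=> f g; apply/asbool_equiv_eq; split; apply: filterS. Qed.
Lemma ultra_eq_trans : transitive ultra_eq.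
Proof.
move=> g f h /asboolP fg /asboolP gh; apply/asboolP.
by apply: filterS2 fg gh => t -> ->.
Qed.

Definition ultra_equiv := EquivRel ultra_eq ultra_eq_refl ultra_eq_sym ultra_eq_trans.
Definition ultra := {eq_quot ultra_equiv}.
HB.instance Definition _ := Choice.on ultra.

Definition ucls (f : T -> K) : ultra := \pi_ultra f.

Lemma ucls_eq f g : ucls f = ucls g <-> F (fun t => f t = g t).
Proof.
by split=> [/eqmodP/asboolP|fg] //; apply/eqmodP/asboolP.
Qed.

Lemma ucls_repr (x : ultra) : ucls (repr x) = x. Proof. exact: reprK. Qed.

Lemma ucls_ind (P : ultra -> Prop) : (forall f, P (ucls f)) -> forall x, P x.
Proof. by move=> Pf x; rewrite -(ucls_repr x). Qed.

Lemma repr_ucls f : F (fun t => repr (ucls f) t = f t).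
Proof. by apply/ucls_eq; rewrite ucls_repr. Qed.

Definition uadd (x y : ultra) := ucls (fun t => repr x t + repr y t).
Definition uopp (x : ultra) := ucls (fun t => - repr x t).
Definition umul (x y : ultra) := ucls (fun t => repr x t * repr y t).
Definition uinv (x : ultra) := ucls (fun t => (repr x t)^-1).

Lemma uaddE f g : uadd (ucls f) (ucls g) = ucls (fun t => f t + g t).
Proof. by apply/ucls_eq; apply: filterS2 (repr_ucls f) (repr_ucls g) => t -> ->. Qed.
Lemma uoppE f : uopp (ucls f) = ucls (fun t => - f t).
Proof. by apply/ucls_eq; apply: filterS (repr_ucls f) => t ->. Qed.
Lemma umulE f g : umul (ucls f) (ucls g) = ucls (fun t => f t * g t).
Proof. by apply/ucls_eq; apply: filterS2 (repr_ucls f) (repr_ucls g) => t -> ->. Qed.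
Lemma uinvE f : uinv (ucls f) = ucls (fun t => (f t)^-1).
Proof. by apply/ucls_eq; apply: filterS (repr_ucls f) => t ->. Qed.

Let addA : associative uadd.
Proof. by do 3!elim/ucls_ind=> ?; rewrite !uaddE; apply/ucls_eq/FT => t; rewrite addrA. Qed.
Let addC : commutative uadd.
Proof. by do 2!elim/ucls_ind=> ?; rewrite !uaddE; apply/ucls_eq/FT => t; rewrite addrC. Qed.
Let add0 : left_id (ucls (fun=> 0)) uadd.
Proof. by elim/ucls_ind=> ?; rewrite !uaddE; apply/ucls_eq/FT => t; rewrite add0r. Qed.
Let addN : left_inverse (ucls (fun=> 0)) uopp uadd.
Proof. by elim/ucls_ind=> ?; rewrite uoppE !uaddE; apply/ucls_eq/FT => t; rewrite addNr. Qed.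

HB.instance Definition _ := GRing.isZmodule.Build ultra addA addC add0 addN.

Let mulA : associative umul.
Proof. by do 3!elim/ucls_ind=> ?; rewrite !umulE; apply/ucls_eq/FT => t; rewrite mulrA. Qed.
Let mulC : commutative umul.
Proof. by do 2!elim/ucls_ind=> ?; rewrite !umulE; apply/ucls_eq/FT => t; rewrite mulrC. Qed.
Let mul1 : left_id (ucls (fun=> 1)) umul.
Proof. by elim/ucls_ind=> ?; rewrite !umulE; apply/ucls_eq/FT => t; rewrite mul1r. Qed.
Let mulD : left_distributive umul uadd.
Proof. by do 3!elim/ucls_ind=> ?; rewrite !(uaddE, umulE); apply/ucls_eq/FT => t; rewrite mulrDl. Qed.
Let one0 : ucls (fun=> 1) != 0 :> ultra.
Proof.
apply/eqP => /ucls_eq /filter_ex[t] /eqP; rewrite oner_eq0.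
by [].
Qed.

HB.instance Definition _ := GRing.Zmodule_isComNzRing.Build ultra mulA mulC mul1 mulD one0.

Let mulV : forall x : ultra, x != 0 -> uinv x * x = 1.
Proof.
elim/ucls_ind=> f f0; rewrite uinvE [LHS]umulE; apply/ucls_eq.
have [f0'|] := in_ultra_setVsetC (fun t => f t = 0) UF; first by case/eqP: f0; apply/ucls_eq.
by apply: filterS => t /eqP ft; rewrite mulVf.
Qed.
Let inv0 : uinv 0 = 0 :> ultra.
Proof. by rewrite [LHS]uinvE; apply/ucls_eq/FT => t; rewrite invr0. Qed.

HB.instance Definition _ := GRing.ComNzRing_isField.Build ultra mulV inv0.

(** The quotient construction is hidden behind the class map [c], of which later arguments use only
    these four properties. *)
Theorem ultrapower : exists (L : fieldType) (c : (T -> K) -> L),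
  [/\ forall f g, c (fun t => f t + g t) = c f + c g,
      forall f g, c (fun t => f t * g t) = c f * c g,
      c (fun=> 1) = 1 & forall f g, c f = c g <-> F (fun t => f t = g t)].
Proof.
exists ultra, ucls; split=> // [f g|f g|f g].
- by rewrite -uaddE.
- by rewrite -umulE.
- exact: ucls_eq.
Qed.

End Ultrapower.

(** * Extension of derivations *)

Section DerivationExtension.
Variable L : fieldType.
Hypothesis char0 : forall k, k.+1%:R != 0 :> L.
Implicit Types (S : L -> Prop) (D : L -> L) (p q : {poly L}).

(** [D] is a total function whose values matter only on the subring [S]; they may lie outside
    [S]. *)
Record der_on S D : Prop := DerOn {
  dsub1 : S 1;
  dsubD : forall a b, S a -> S b -> S (a + b);
  dsubN : forall a, S a -> S (- a);
  dsubM : forall a b, S a -> S b -> S (a * b);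
  derD : forall a b, S a -> S b -> D (a + b) = D a + D b;
  derM : forall a b, S a -> S b -> D (a * b) = D a * b + a * D b }.

Section Extend.
Variables (S : L -> Prop) (D : L -> L).
Hypothesis dS : der_on S D.

Lemma dsub0 : S 0.
Proof. by rewrite -(subrr 1); apply: (dsubD dS); [|apply: (dsubN dS)]; apply: (dsub1 dS). Qed.
Lemma der0 : D 0 = 0.
Proof. by apply: (addrI (D 0)); rewrite -(derD dS) ?addr0//; apply: dsub0. Qed.
Lemma dsub_sum I (r : seq I) (F : I -> L) : (forall i, S (F i)) -> S (\sum_(i <- r) F i).
Proof.
move=> SF; elim: r => [|i r IH]; first by rewrite big_nil; apply: dsub0.
by rewrite big_cons; apply: (dsubD dS).
Qed.
Lemma der_sum I (r : seq I) (F : I -> L) : (forall i, S (F i)) ->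
  D (\sum_(i <- r) F i) = \sum_(i <- r) D (F i).
Proof.
move=> SF; elim: r => [|i r IH]; first by rewrite !big_nil der0.
by rewrite !big_cons (derD dS) ?IH//; apply: dsub_sum.
Qed.

Definition over p := forall i, S p`_i.
Definition dcoef p := \poly_(i < size p) D p`_i.

Lemma coef_dcoef p i : (dcoef p)`_i = D p`_i.
Proof. by rewrite coef_poly; case: ltnP => // pi; rewrite nth_default// der0. Qed.

Lemma overD p q : over p -> over q -> over (p + q).
Proof. by move=> op oq i; rewrite coefD; apply: (dsubD dS). Qed.
Lemma overN p : over p -> over (- p).
Proof. by move=> op i; rewrite coefN; apply: (dsubN dS). Qed.
Lemma overM p q : over p -> over q -> over (p * q).
Proof. by move=> op oq i; rewrite coefM; apply: dsub_sum => j; apply: (dsubM dS). Qed.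
Lemma overC c : S c -> over c%:P.
Proof. by move=> Sc i; rewrite coefC; case: eqP => // _; apply: dsub0. Qed.
Lemma overX : over 'X.
Proof. by move=> i; rewrite coefX; case: eqP => // _; [apply: (dsub1 dS)|apply: dsub0]. Qed.
Lemma overXn k : over 'X^k.
Proof. by move=> i; rewrite coefXn; case: eqP => // _; [apply: (dsub1 dS)|apply: dsub0]. Qed.

Section Adjoin.
Variables a w : L.
(** The value that the Leibniz rule forces at [p.[a]] once [a] is given the derivative [w]. *)
Definition dval p := (dcoef p).[a] + p^`().[a] * w.

Lemma dvalD p q : over p -> over q -> dval (p + q) = dval p + dval q.
Proof.
move=> op oq; rewrite /dval; have -> : dcoef (p + q) = dcoef p + dcoef q.
  by apply/polyP => i; rewrite coefD !coef_dcoef coefD (derD dS).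
by rewrite derivD !hornerD; ring.
Qed.

Lemma dvalM p q : over p -> over q -> dval (p * q) = dval p * q.[a] + p.[a] * dval q.
Proof.
move=> op oq; rewrite /dval; have -> : dcoef (p * q) = dcoef p * q + p * dcoef q.
  apply/polyP => i; rewrite coefD !coefM coef_dcoef coefM der_sum; last by move=> j; apply: (dsubM dS).
  by rewrite -big_split /=; apply: eq_bigr => j _; rewrite (derM dS)// !coef_dcoef.
by rewrite derivM !(hornerD, hornerM); ring.
Qed.

Lemma dvalC c : dval c%:P = D c.
Proof.
rewrite /dval derivC horner0 mul0r addr0; have -> : dcoef c%:P = (D c)%:P; last by rewrite hornerC.
by apply/polyP => i; rewrite coef_dcoef !coefC; case: eqP => // _; rewrite der0.
Qed.

Lemma dval0 : dval 0 = 0. Proof. by have := dvalC 0; rewrite polyC0 der0. Qed.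

Lemma dvalN p : over p -> dval (- p) = - dval p.
Proof.
move=> op; apply/eqP; rewrite -addr_eq0 -dvalD ?addNr ?dval0//; exact: overN.
Qed.

Lemma adjoin_der : (forall p, over p -> p.[a] = 0 -> dval p = 0) ->
  exists S' D', [/\ der_on S' D', S' a, forall u, S u -> S' u & forall u, S u -> D' u = D u].
Proof.
move=> wd; pose S' u := exists2 p, over p & p.[a] = u.
have [D' D'P] : {D' : L -> L & forall u, S' u -> exists p, [/\ over p, p.[a] = u & dval p = D' u]}.
  apply: (@boolp.choice _ _ (fun u d => S' u -> exists p, [/\ over p, p.[a] = u & dval p = d])) => u.
  by have [[p op pu]|nu] := pselect (S' u); [exists (dval p) => _; exists p | exists 0].
have D'E p : over p -> D' p.[a] = dval p.
  move=> op; have [|q [oq qp <-]] := D'P p.[a]; first by exists p.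
  apply/eqP; rewrite -subr_eq0 -dvalN// -dvalD//; last exact: overN.
  by apply/eqP/wd; [apply: overD => //; apply: overN | rewrite hornerD hornerN qp subrr].
exists S', D'; split.
- split.
  + by exists 1; rewrite ?hornerC//; apply: overC; apply: (dsub1 dS).
  + by move=> _ _ [p op <-] [q oq <-]; exists (p + q); [exact: overD | rewrite hornerD].
  + by move=> _ [p op <-]; exists (- p); [exact: overN | rewrite hornerN].
  + by move=> _ _ [p op <-] [q oq <-]; exists (p * q); [exact: overM | rewrite hornerM].
  + move=> _ _ [p op <-] [q oq <-]; rewrite -hornerD !D'E ?dvalD//; exact: overD.
  + move=> _ _ [p op <-] [q oq <-]; rewrite -hornerM !D'E ?dvalM//; exact: overM.
- by exists 'X; [exact: overX | rewrite hornerX].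
- by move=> u Su; exists u%:P; [exact: overC | rewrite hornerC].
- by move=> u Su; rewrite -[X in D' X](hornerC u a) D'E ?dvalC//; exact: overC.
Qed.

End Adjoin.

(* If [a] is algebraic over [S], its derivative is forced by a relation [g] of
   minimal degree, which is separable in characteristic zero; if not, any value
   will do. *)
Lemma extend_one a : exists S' D',
  [/\ der_on S' D', S' a, forall u, S u -> S' u & forall u, S u -> D' u = D u].
Proof.
suff [w wP] : exists w, forall p, over p -> p.[a] = 0 -> dval a w p = 0 by apply: adjoin_der wP.
have [ex|nex] := pselect (exists m, `[<exists2 g, over g & [/\ g != 0, g.[a] = 0 & size g = m]>]); last first.
  exists 0 => p op pa; have [->|p0] := eqVneq p 0; first exact: dval0.
  by case: nex; exists (size p); apply/asboolP; exists p.
have [m /asboolP[g og [g0 ga gm]] minm] := ex_minnP ex.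
have sg : (1 < size g)%N.
  rewrite ltn_neqAle eq_sym size_poly_gt0 g0 andbT; apply/negP => /size_poly1P[c c0 gc].
  by rewrite gc hornerC in ga; rewrite ga eqxx in c0.
have g'a : g^`().[a] != 0.
  apply/negP => /eqP g'a; suff : (size g <= size g^`())%N by rewrite leqNgt lt_size_deriv.
  rewrite gm; apply: minm; apply/asboolP.
  exists g^`(); last split=> //.
    move=> i; rewrite coef_deriv -mulr_natr; apply: (dsubM dS) => //.
    elim: (i.+1) => [|k IH]; first exact: dsub0.
    by rewrite -natr1; apply: (dsubD dS) => //; apply: (dsub1 dS).
  apply/eqP => /(congr1 (fun p => p`_(size g).-2)); rewrite coef_deriv coef0 => /eqP.
  rewrite prednK; last by rewrite -ltnS prednK// ltnW.
  rewrite -[_ *+ _]mulr_natr mulf_eq0 -lead_coefE lead_coef_eq0 (negPf g0) /=.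
  have -> : (size g).-1 = (size g).-2.+1 by rewrite prednK// -ltnS prednK// ltnW.
  by rewrite (negPf (char0 _)).
(* The unique [w] for which the relation [g.[a] = 0] is respected. *)
exists (- (dcoef g).[a] / g^`().[a]); set w := _ / _.
have Eg : dval a w g = 0 by rewrite /dval /w mulrC divfK// subrr.
move=> p; have [k] := ubnP (size p); elim: k p => // k IH p; rewrite ltnS => sp op pa.
have [->|p0] := eqVneq p 0; first exact: dval0.
have gp : (size g <= size p)%N by rewrite gm; apply: minm; apply/asboolP; exists p.
(* Pseudo-division: [S] is only a ring, so [p] is scaled by the leading coefficient of [g] before
   its top term is cancelled. *)
pose u := (lead_coef g)%:P; pose v := (lead_coef p)%:P * 'X^(size p - size g).
have ou : over u by apply: overC; apply: og.
have ov : over v by apply: overM; [apply: overC; apply: op | exact: overXn].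
have lg0 : lead_coef g != 0 by rewrite lead_coef_eq0.
pose r := u * p - v * g.
have or : over r by apply: overD; [exact: overM | apply: overN; exact: overM].
have ra : r.[a] = 0 by rewrite /r hornerD hornerN !hornerM pa ga !mulr0 subrr.
have sr : (size r < size p)%N.
  have p_gt0 : (0 < size p)%N by rewrite size_poly_gt0.
  rewrite -(prednK p_gt0) ltnS; apply/leq_sizeP => j; rewrite leq_eqVlt => /orP[/eqP <-|].
    rewrite /r coefB /u coefCM /v -mulrA coefCM coefXnM ltnNge.
    have -> : (size p - size g <= (size p).-1)%N.
      by rewrite -ltnS prednK// ltn_subrL (ltn_trans _ sg).
    have -> : ((size p).-1 - (size p - size g) = (size g).-1)%N.
      by rewrite -[size p]prednK// -[in LHS](subnKC gp) /=; lia.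
    by rewrite /= -!lead_coefE mulrC subrr.
  rewrite prednK// => pj; rewrite /r coefB /u coefCM [p`_j]nth_default// mulr0.
  rewrite /v -mulrA coefCM coefXnM; case: ltnP => _; first by rewrite mulr0 subrr.
  rewrite [g`_ _]nth_default ?mulr0 ?subrr//.
  by rewrite leq_subRL ?subnK// (leq_trans (leq_subr _ _)).
have Er : dval a w r = 0 by apply: IH => //; apply: leq_trans sr sp.
move: Er; rewrite /r dvalD; [|exact: overM|by apply: overN; exact: overM].
rewrite dvalN; last exact: overM.
rewrite (dvalM _ _ ou op) (dvalM _ _ ov og).
rewrite pa ga Eg !(mulr0, add0r, subr0) /u hornerC => /eqP.
by rewrite mulf_eq0 (negPf lg0) => /eqP.
Qed.

End Extend.

Lemma extend_seq S D (s : seq L) : der_on S D -> exists S' D',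
  [/\ der_on S' D', forall a, a \in s -> S' a, forall u, S u -> S' u & forall u, S u -> D' u = D u].
Proof.
move=> dS; elim: s => [|a s [S1 [D1 [d1 s1 sub1 e1]]]]; first by exists S, D.
have [S2 [D2 [d2 a2 sub2 e2]]] := extend_one d1 a; exists S2, D2; split=> //.
- by move=> b; rewrite inE => /predU1P[->|/s1/sub2].
- by move=> u /sub1/sub2.
- by move=> u Su; rewrite e2 ?e1//; apply: sub1.
Qed.

End DerivationExtension.

(** * Generic points of the orbit *)

Lemma expm0 (K : fieldType) n (A : 'M[K]_n.+1) : expm (0 *: A) = 1%:M.
Proof.
rewrite scale0r /expm big_ord_recl /= invr1 scale1r expr0 big1 ?addr0// => k _.
by rewrite exprS mul0r scaler0.
Qed.

Section Line.
Variable K : numFieldType.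
Implicit Types (p q : {poly K}).

(** The affine line with its single coordinate, so that [polyfun] and [polymx] also describe
    polynomial paths. *)
Definition line (t : K) (_ : unit) := t.

Lemma polyfun_line f : polyfun line f -> exists p, forall t, f t = p.[t].
Proof.
move=> [e fe]; suff [p pe] : exists p, forall t, peval (line t) e = p.[t].
  by exists p => t; rewrite fe.
elim: e {f fe} => [a|[]|e [p ep] e' [p' ep']|e [p ep] e' [p' ep']].
- by exists a%:P => t; rewrite hornerC.
- by exists 'X => t; rewrite hornerX.
- by exists (p + p') => t /=; rewrite hornerD ep ep'.
- by exists (p * p') => t /=; rewrite hornerM ep ep'.
Qed.

Lemma poly_nonroot p : p != 0 -> exists t, p.[t] != 0.
Proof.
move=> p0; apply: contrapT => /forallNP np.
pose s : seq K := [seq i%:R | i <- iota 0 (size p)].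
have : (size s < size p)%N.
  apply: max_poly_roots p0 _ _.
    by apply/allP => t _; apply/negPn/negP; apply: np.
  rewrite map_inj_uniq ?iota_uniq// => i j /eqP.
  by rewrite eqr_nat => /eqP.
by rewrite size_map size_iota ltnn.
Qed.

Lemma line_irreducible f1 f2 t1 t2 : polyfun line f1 -> polyfun line f2 ->
  f1 t1 != 0 -> f2 t2 != 0 -> exists t, f1 t != 0 /\ f2 t != 0.
Proof.
move=> /polyfun_line[p1 e1] /polyfun_line[p2 e2]; rewrite e1 e2 => n1 n2.
have [|t] := @poly_nonroot (p1 * p2).
  rewrite mulf_neq0//; first by apply: contraNneq n1 => ->; rewrite horner0.
  by apply: contraNneq n2 => ->; rewrite horner0.
by rewrite hornerM mulf_eq0 negb_or => /andP[? ?]; exists t; rewrite e1 e2.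
Qed.

Lemma polyfun_lineX k : polyfun line (fun t => t ^+ k).
Proof.
elim: k => [|k IH]; first by apply: polyfun_ext (polyfun_const _ 1) => t; rewrite expr0.
apply: polyfun_ext (polyfunM (polyfun_var line tt) IH) => t.
by rewrite exprS.
Qed.

Lemma polymx_expm n (A : 'M[K]_n.+1) : polymx line (fun t => expm (t *: A)).
Proof.
move=> i j; apply: (@polyfun_ext _ _ _ _ (fun t => \sum_(k < n.+2) (k`!%:R)^-1 * (t ^+ k * (A ^+ k) i j))).
  by move=> t; rewrite summxE; apply: eq_bigr => k _; rewrite exprZn !mxE.
apply: polyfun_sum => k; apply: polyfunM; first exact: polyfun_const.
by apply: polyfunM; [exact: polyfun_lineX | exact: polyfun_const].
Qed.

End Line.

Section Derivative.
Variables (K : numFieldType) (I : Type).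

(** Formal directional derivative of [p] at the point [a] in the direction [b]. *)
Fixpoint pderiv (p : pexpr K I) (a b : I -> K) : K :=
  match p with
  | PConst _ => 0
  | PVar i => b i
  | PAdd p q => pderiv p a b + pderiv q a b
  | PMul p q => pderiv p a b * peval a q + peval a p * pderiv q a b
  end.

Lemma pderiv_path (p : pexpr K I) (c : I -> {poly K}) :
  (forall t, peval (fun i => (c i).[t]) p = 0) ->
  pderiv p (fun i => (c i).[0]) (fun i => (c i)^`().[0]) = 0.
Proof.
have [P [Pe Pd]] : exists P : {poly K}, (forall t, peval (fun i => (c i).[t]) p = P.[t]) /\
    pderiv p (fun i => (c i).[0]) (fun i => (c i)^`().[0]) = P^`().[0].
  elim: p => [a|i|p [P [eP dP]] q [Q [eQ dQ]]|p [P [eP dP]] q [Q [eQ dQ]]] /=.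
  - by exists a%:P; split=> [t|]; rewrite ?derivC !hornerC.
  - by exists (c i).
  - by exists (P + Q); rewrite derivD hornerD dP dQ; split=> // t; rewrite hornerD eP eQ.
  - exists (P * Q); rewrite derivM hornerD !hornerM dP dQ eP eQ; split=> // t.
    by rewrite hornerM eP eQ.
move=> e; rewrite Pd; have [->|P0] := eqVneq P 0; first by rewrite deriv0 horner0.
by have [t] := poly_nonroot P0; rewrite -Pe e eqxx.
Qed.

End Derivative.

Section Adjoint.
Variables (K : numClosedFieldType) (n' : nat).
Local Notation n := n'.+1.
Local Notation vec := 'rV[K]_n.
Variable br : vec -> vec -> vec.
Hypothesis lb : is_lie_bracket br.
Local Notation vcoord := (@vcoord K n).
Local Notation G := (adjoint_group br).

Lemma ad_nilpotentZ a x : ad_nilpotent br x -> ad_nilpotent br (a *: x).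
Proof.
move=> [k xk]; exists k; rewrite (adZ lb).
suff -> : forall j, (a *: ad br x) ^+ j = a ^+ j *: ad br x ^+ j by rewrite xk scaler0.
by move=> j; rewrite exprZn.
Qed.

Lemma adjoint_expZ t x : ad_nilpotent br x -> G (expm (t *: ad br x)).
Proof. by move=> nx; rewrite -(adZ lb); apply: adjoint_exp; apply: ad_nilpotentZ. Qed.

(** Such paths, products of one-parameter groups, reduce irreducibility of the orbit to that of the
    line. *)
Lemma adjoint_path g : G g -> exists gam : K -> 'M[K]_n,
  [/\ polymx (@line K) gam, forall t, G (gam t), gam 0 = 1%:M & gam 1 = g].
Proof.
move: g; apply: adjoint_group_ind.
- exists (fun=> 1%:M); split=> // [|t]; first exact: polymx_const.
  by exists [::]; rewrite big_nil.
- move=> g h [a [pa Ga a0 a1]] [b [pb Gb b0 b1]]; exists (fun t => a t *m b t); split.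
  + exact: polymx_mul.
  + by move=> t; apply: adjoint_mul.
  + by rewrite a0 b0 mulmx1.
  + by rewrite a1 b1.
- move=> x nx; exists (fun t => expm (t *: ad br x)); split.
  + exact: polymx_expm.
  + by move=> t; apply: adjoint_expZ.
  + exact: expm0.
  + by rewrite scale1r.
Qed.

Variable x0 : vec.
Local Notation O := (orbit_by G x0).

Lemma orbit_adjoint w g : O w -> G g -> O (w *m g).
Proof. by move=> [h [Gh ->]] Gg; exists (h *m g); rewrite mulmxA; split=> //; apply: adjoint_mul. Qed.

(** The path [x0 *m a (1 - t) *m b t] joins [w1] to [w2] inside the orbit, and on it both functions
    are nonzero polynomials in [t]. *)
Lemma orbit_irreducible f1 f2 w1 w2 : polyfun vcoord f1 -> polyfun vcoord f2 ->
  O w1 -> O w2 -> f1 w1 != 0 -> f2 w2 != 0 -> exists w, [/\ O w, f1 w != 0 & f2 w != 0].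
Proof.
move=> p1 p2 [g1 [G1 ->]] [g2 [G2 ->]] n1 n2.
have [a [pa Ga a0 a1]] := adjoint_path G1; have [b [pb Gb b0 b1]] := adjoint_path G2.
pose path t := x0 *m a (1 - t) *m b t.
have ppath i : polyfun (@line K) (fun t => vcoord (path t) i).
  apply: polymx_mul => //; apply: polymx_mul; first exact: polymx_const.
  move=> k l; apply: (@polyfun_comp _ _ _ _ _ _ (@line K) (fun t => 1 - t) (fun t => a t k l)) => // j.
  apply: (@polyfun_ext _ _ _ _ (fun t => 1 + -1 * t)); first by move=> t; rewrite /line mulN1r.
  apply: polyfunD; first exact: polyfun_const.
  by apply: polyfunM; [exact: polyfun_const | exact: (polyfun_var (@line K) tt)].
have [||t [t1 t2]] := @line_irreducible _ _ _ 0 1 (polyfun_comp ppath p1) (polyfun_comp ppath p2).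
- by rewrite /path subr0 a1 b0 mulmx1.
- by rewrite /path subrr a0 b1 mulmx1.
exists (path t); split=> //; apply: orbit_adjoint; last exact: Gb.
by exists (a (1 - t)).
Qed.

(** The path [w *m expm (t *: ad br x)] is polynomial, stays in the orbit and has velocity
    [w *m ad br x] at 0. *)
Lemma orbit_tangent (R : pexpr K 'I_n) w x : (forall w, O w -> peval (vcoord w) R = 0) ->
  O w -> ad_nilpotent br x -> pderiv R (vcoord w) (vcoord (w *m ad br x)) = 0.
Proof.
move=> R0 Ow nx.
pose c (i : 'I_n) := \poly_(k < n.+1) ((k`!%:R)^-1 * (w *m ad br x ^+ k) 0 i).
have cE t : vcoord (w *m expm (t *: ad br x)) = (fun i => (c i).[t]).
  apply: funext => i; rewrite horner_poly /vcoord /expm mulmx_sumr summxE.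
  by apply: eq_bigr => k _; rewrite -scalemxAr exprZn -scalemxAr !mxE; ring.
have := @pderiv_path _ _ R c; rewrite -cE.
have -> : (fun i => (c i)^`().[0]) = vcoord (w *m ad br x).
  by apply: funext => i; rewrite horner_coef0 coef_deriv coef_poly /= mulr1n invr1 mul1r expr1.
rewrite expm0 mulmx1; apply=> t; rewrite -cE; apply: R0; apply: orbit_adjoint => //.
exact: adjoint_expZ.
Qed.

(* By irreducibility of the orbit, the sets [{g | f (y *m g) != 0}], for [f] a
   polynomial function that does not vanish identically on the orbit, have the
   finite intersection property on [B]. *)
Lemma generic_ultrafilter (B : 'M[K]_n -> Prop) y : zdense_in vcoord O (orbit_by B y) ->
  exists U : set_system 'M[K]_n, [/\ UltraFilter U, forall X : set 'M[K]_n, (forall g, B g -> X g) -> U X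
    & forall R : pexpr K 'I_n, U (fun g => peval (vcoord (y *m g)) R = 0) ->
      forall w, O w -> peval (vcoord w) R = 0].
Proof.
move=> [BO dB].
pose F0 (X : set 'M[K]_n) := exists f, [/\ polyfun vcoord f, exists2 w, O w & f w != 0 &
  forall g, B g -> f (y *m g) != 0 -> X g].
have x0O : O x0 by exists 1%:M; rewrite mulmx1; split=> //; exists [::]; rewrite big_nil.
have FB (X : set 'M[K]_n) : (forall g, B g -> X g) -> F0 X.
  move=> BX; exists (fun=> 1); split=> [||g /BX//]; first exact: polyfun_const.
  by exists x0; rewrite ?oner_eq0.
have PF0 : ProperFilter F0.
  split.
    move=> [f [[p fp] [w Ow fw] F]]; suff : f w = 0 by move/eqP; apply/negP.
    (* Density enters here: a function that vanishes at all [y *m g] vanishes on [O], so no set of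
       the filter is empty. *)
    rewrite fp; apply: (dB (fun t => peval (vcoord t) p = 0)) => //.
      by exists (eq p) => t; split=> [e _ <-//|]; apply.
    move=> _ [g [Bg ->]]; rewrite -fp; apply/eqP/negPn/negP => /F.
    exact.
  split=> [|X Y [f1 [p1 [w1 O1 n1] F1]] [f2 [p2 [w2 O2 n2] F2]]|X Y XY [f [pf ef Xf]]].
  - exact: FB.
  - have [w [Ow fw1 fw2]] := orbit_irreducible p1 p2 O1 O2 n1 n2.
    exists (fun w => f1 w * f2 w); split; [exact: polyfunM | by exists w; rewrite ?mulf_neq0 |].
    by move=> g Bg; rewrite mulf_eq0 negb_or => /andP[? ?]; split; [apply: F1 | apply: F2].
  - by exists f; split=> // g Bg /Xf fg; apply: XY; apply: fg.
have [U [UU FU]] := ultraFilterLemma PF0.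
exists U; split=> // [X /FB /FU//|R UR w Ow].
apply/eqP/negPn/negP => nR.
have : U (fun g => peval (vcoord (y *m g)) R != 0).
  apply: FU; exists (fun w => peval (vcoord w) R); split=> //; first by exists R.
  by exists w.
by move=> UR'; have [g [/= ->]] := filter_ex (filterI UR UR'); rewrite eqxx.
Qed.

End Adjoint.

(** * Tangent spaces of dense orbits *)

Section MatrixDerivation.
Variables (L : fieldType) (S : L -> Prop) (D : L -> L).
Hypothesis dS : der_on S D.

Definition mxin m k (A : 'M[L]_(m, k)) := forall i j, S (A i j).

Lemma mxin_mul m k l (A : 'M[L]_(m, k)) (B : 'M_(k, l)) : mxin A -> mxin B -> mxin (A *m B).
Proof. by move=> SA SB i j; rewrite mxE; apply: (dsub_sum dS) => a; apply: (dsubM dS). Qed.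

Lemma mxder_mul m k l (A : 'M[L]_(m, k)) (B : 'M_(k, l)) : mxin A -> mxin B ->
  map_mx D (A *m B) = map_mx D A *m B + A *m map_mx D B.
Proof.
move=> SA SB; apply/matrixP => i j; rewrite !mxE (der_sum dS).
  by rewrite -big_split /=; apply: eq_bigr => a _; rewrite (derM dS)// !mxE.
by move=> a; apply: (dsubM dS).
Qed.

End MatrixDerivation.

Section IndependentDecomposition.
Variables (K L : fieldType) (iota : {rmorphism K -> L}).

(** Matrix units give one decomposition. In one with the fewest terms the scalars are independent
    over [K], since a relation would eliminate a term. *)
Lemma indep_decomp m k (Z : 'M[L]_(m, k)) : exists N (om : 'I_N -> L) (A : 'I_N -> 'M[K]_(m, k)),
  Z = \sum_i om i *: map_mx iota (A i) /\
  forall a : 'I_N -> K, \sum_i iota (a i) * om i = 0 -> forall i, a i = 0.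
Proof.
pose rep N := exists (om : 'I_N -> L) (A : 'I_N -> 'M[K]_(m, k)), Z = \sum_i om i *: map_mx iota (A i).
have ex : exists N, `[<rep N>].
  exists #|{: 'I_m * 'I_k}|; apply/asboolP.
  exists (fun i => Z (enum_val i).1 (enum_val i).2), (fun i => delta_mx (enum_val i).1 (enum_val i).2).
  rewrite [LHS]matrix_sum_delta pair_bigA /= (reindex _ (onW_bij _ (@enum_val_bij ('I_m * 'I_k)%type))) /=.
  by apply: eq_bigr => p _; rewrite map_delta_mx.
have [N /asboolP[om [A ZE]] minN] := ex_minnP ex.
exists N, om, A; split=> // a a0 i; apply/eqP/negPn/negP => ai.
case: N => [|N] in om A ZE minN a a0 i ai *; first by case: i ai.
suff : rep N by move=> /asboolP/minN; rewrite ltnn.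
pose b j := a (lift i j) / a i.
exists (fun j => om (lift i j)), (fun j => A (lift i j) - b j *: A i).
have omi : om i = - \sum_j iota (b j) * om (lift i j).
  move: a0; rewrite (bigD1_ord i)//= => /eqP; rewrite addr_eq0 => /eqP e.
  have ia : iota (a i) != 0 by rewrite fmorph_eq0.
  apply: (mulfI ia); rewrite e mulrN; congr (- _); rewrite mulr_sumr; apply: eq_bigr => j _.
  by rewrite [RHS]mulrA -rmorphM /b [a i * _]mulrC divfK.
rewrite ZE (bigD1_ord i)//= omi scaleNr scaler_suml addrC -sumrB.
apply: eq_bigr => j _; rewrite map_mxB map_mxZ scalerBr scalerA; congr (_ - _ *: _).
exact: mulrC.
Qed.

End IndependentDecomposition.

Section TangentCore.
Variables (K : numClosedFieldType) (n' : nat).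
Local Notation n := n'.+1.
Local Notation vec := 'rV[K]_n.
Variable br : vec -> vec -> vec.
Hypothesis lb : is_lie_bracket br.
Hypothesis ss : semisimple br.
Variables (L : fieldType) (iota : {rmorphism K -> L}).
Local Notation "A ^i" := (map_mx iota A) (at level 2, format "A ^i").
Local Notation e_ i := (delta_mx 0 i : 'rV[K]_n).
Implicit Types (w : 'rV[L]_n) (Z : 'M[L]_n) (D : 'M[K]_n).

(** The adjoint map of the algebra extended to scalars in [L]. *)
Definition ad_ext w : 'M[L]_n := \sum_i w 0 i *: (ad br (e_ i))^i.

Lemma ad_ext_lin a w1 w2 : ad_ext (a *: w1 + w2) = a *: ad_ext w1 + ad_ext w2.
Proof.
rewrite /ad_ext scaler_sumr -big_split; apply: eq_bigr => i _ /=.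
by rewrite !mxE scalerDl scalerA.
Qed.

Lemma ad_ext0 : ad_ext 0 = 0.
Proof. by rewrite /ad_ext big1// => i _; rewrite mxE scale0r. Qed.

Lemma ad_ext_sum (I : Type) (r : seq I) (F : I -> L) (f : I -> 'rV[L]_n) :
  ad_ext (\sum_(i <- r) F i *: f i) = \sum_(i <- r) F i *: ad_ext (f i).
Proof.
elim: r => [|i r IH]; first by rewrite !big_nil ad_ext0.
by rewrite !big_cons ad_ext_lin IH.
Qed.

Lemma ad_ext_map (u : vec) : ad_ext u^i = (ad br u)^i.
Proof.
rewrite [u in RHS]row_sum_delta (ad_sum lb) raddf_sum; apply: eq_bigr => i _ /=.
by rewrite (adZ lb) map_mxZ mxE.
Qed.

Lemma der_basis D : (forall i, ad br (e_ i) *m D - D *m ad br (e_ i) - ad br (row i D) = 0) ->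
  is_der br D.
Proof.
move=> h; have e i v : br (e_ i) v *m D = br (e_ i *m D) v + br (e_ i) (v *m D).
  have /(congr1 (fun X => v *m X)) := h i; rewrite mulmx0 -addrA -opprD mulmxBr => /eqP.
  by rewrite subr_eq0 mulmxDr !mulmxA !(mul_ad lb) rowE addrC => /eqP.
move=> u v; rewrite [u]row_sum_delta !(br_suml lb, mulmx_suml) -big_split.
apply: eq_bigr => i _ /=; rewrite -scalemxAl !(brZl lb) -scalemxAl e.
by rewrite scalerDr.
Qed.

(** The derivation property over [L], tested on the standard basis. *)
Definition ext_der Z := forall i, (ad br (e_ i))^i *m Z - Z *m (ad br (e_ i))^i - ad_ext (row i Z) = 0.

(* The conditions on [Z] are linear over [K], so they hold for each component of
   [Z] with respect to [K]-independent scalars of [L]. *)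
Lemma ext_der_kill P (y : vec) (C : 'M[K]_n) Z :
  (forall u, is_trig_mx (P *m ad br u *m invmx P) -> y *m ad br u *m C = 0) ->
  P \in unitmx -> ext_der Z -> is_trig_mx (P^i *m Z *m invmx P^i) -> y^i *m Z *m C^i = 0.
Proof.
move=> hC uP dZ /is_trig_mxP tZ.
have [N [om [A [ZE ind]]]] := indep_decomp iota Z.
have lin m k (X : 'M[K]_(m, n)) (Y : 'M[K]_(n, k)) :
    X^i *m Z *m Y^i = \sum_j om j *: (X *m A j *m Y)^i.
  rewrite ZE mulmx_sumr mulmx_suml; apply: eq_bigr => j _.
  by rewrite -scalemxAr -scalemxAl !map_mxM.
have dA j : is_der br (A j).
  apply: der_basis => i; apply/matrixP => a b.
  rewrite [RHS]mxE; move: j; apply: ind.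
  have : ((ad br (e_ i))^i *m Z - Z *m (ad br (e_ i))^i - ad_ext (row i Z)) a b = 0 by rewrite dZ mxE.
  have -> : ad_ext (row i Z) = \sum_j om j *: (ad br (row i (A j)))^i.
    have -> : row i Z = \sum_j om j *: (row i (A j))^i.
      by rewrite ZE raddf_sum; apply: eq_bigr => j _ /=; rewrite linearZ /= map_row.
    by rewrite ad_ext_sum; apply: eq_bigr => j _; rewrite ad_ext_map.
  have := lin _ _ (ad br (e_ i)) 1%:M; rewrite map_mx1 mulmx1 => ->.
  have := lin _ _ 1%:M (ad br (e_ i)); rewrite map_mx1 mul1mx => ->.
  rewrite -!sumrB summxE => e; rewrite -[RHS]e; apply: eq_bigr => j _.
  rewrite !mulmx1 !mul1mx !mxE !rmorphB /=; ring.
rewrite lin big1// => j _; have [u Au] := der_inner lb ss (dA j).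
rewrite Au hC ?map_mx0 ?scaler0// -Au.
apply/is_trig_mxP => a b ab; move: j {Au}; apply: ind.
rewrite -[RHS](tZ a b ab) -map_invmx lin summxE; apply: eq_bigr => j _.
by rewrite !mxE mulrC.
Qed.

(** [M] is a generic automorphism with inverse [M'], and [C] tests membership in [[b, y]]. The
    derivations [Z] show that [C] kills [y M (ad x) M'] for nilpotent [x], hence for all [x].
    Because [M] is an automorphism, [y (ad u)] is an [L]-combination of these vectors. *)
Lemma ad_ext_kill P (y : vec) (C : 'M[K]_n) (M M' : 'M[L]_n) :
  (forall u, is_trig_mx (P *m ad br u *m invmx P) -> y *m ad br u *m C = 0) ->
  P \in unitmx -> M *m M' = 1%:M ->
  (forall i, (ad br (e_ i))^i *m M = M *m ad_ext (row i M)) ->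
  (forall x, ad_nilpotent br x -> exists Z, [/\ ext_der Z,
     is_trig_mx (P^i *m Z *m invmx P^i) & y^i *m Z = y^i *m M *m (ad br x)^i *m M']) ->
  forall u, y *m ad br u *m C = 0.
Proof.
move=> hC uP MM' eM hZ.
have h0 x : y^i *m M *m (ad br x)^i *m M' *m C^i = 0.
  have [||W WP] := @subspace_mx K n (fun x => y^i *m M *m (ad br x)^i *m M' *m C^i = 0).
  - by rewrite (ad0 lb) map_mx0 mulmx0 !mul0mx.
  - move=> a u v eu ev; rewrite (ad_lin lb) map_mxD map_mxZ mulmxDr !mulmxDl.
    by rewrite -scalemxAr -!scalemxAl eu ev scaler0 addr0.
  have WT : (1%:M <= W)%MS.
    apply: (nilpotents_span lb ss) => z /hZ[Z [dZ tZ eZ]]; apply/WP; rewrite -eZ.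
    exact: ext_der_kill dZ tZ.
  by apply/WP; apply: submx_trans WT; apply: submx1.
have he i : y *m ad br (e_ i) *m C = 0.
  apply/(map_mx_inj (f := iota)); rewrite map_mx0 !map_mxM.
  rewrite -[(ad br _)^i]mulmx1 -MM' (mulmxA (ad br (e_ i))^i M M') eM.
  rewrite !mulmxA /ad_ext mulmx_sumr !mulmx_suml big1// => j _.
  by rewrite -scalemxAr -!scalemxAl h0 scaler0.
move=> u; rewrite [u]row_sum_delta (ad_sum lb) mulmx_sumr mulmx_suml big1// => i _.
by rewrite (adZ lb) -scalemxAr -scalemxAl he scaler0.
Qed.

End TangentCore.

Section UltrapowerMatrices.
Variables (K L : fieldType) (T : Type) (c : (T -> K) -> L).
Hypothesis cD : forall f g, c (fun t => f t + g t) = c f + c g.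
Hypothesis cM : forall f g, c (fun t => f t * g t) = c f * c g.
Hypothesis c1 : c (fun=> 1) = 1.

Lemma ultra_const : exists iota : {rmorphism K -> L}, forall a, c (fun=> a) = iota a.
Proof.
pose i a := c (fun=> a).
have i0 : i 0 = 0 by apply: (addrI (i 0)); rewrite -cD !addr0.
have iB : zmod_morphism i.
  move=> a b; apply: (addIr (i b)); rewrite subrK -cD; congr c.
  by apply: funext => t; rewrite subrK.
have iM : monoid_morphism i by split=> // a b; rewrite /i cM.
pose iota : {rmorphism K -> L} :=
  HB.pack i (GRing.isZmodMorphism.Build K L i iB) (GRing.isMonoidMorphism.Build K L i iM).
by exists iota.
Qed.

Lemma ultra_sum I (r : seq I) (F : I -> T -> K) :
  c (fun t => \sum_(i <- r) F i t) = \sum_(i <- r) c (F i).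
Proof.
elim: r => [|i r IH].
  rewrite big_nil; apply: (addrI (c (fun=> 0))); rewrite -cD addr0; congr c.
  by apply: funext => t; rewrite big_nil addr0.
rewrite big_cons -IH -cD; congr c; apply: funext => t; by rewrite big_cons.
Qed.

Definition umx m k (A : T -> 'M[K]_(m, k)) : 'M[L]_(m, k) := \matrix_(i, j) c (fun t => A t i j).

Lemma umxM m k l (A : T -> 'M[K]_(m, k)) (B : T -> 'M[K]_(k, l)) :
  umx (fun t => A t *m B t) = umx A *m umx B.
Proof.
apply/matrixP => i j; rewrite !mxE.
under eq_bigr do rewrite !mxE -cM.
rewrite -ultra_sum; congr c; apply: funext => t; by rewrite mxE.
Qed.

Lemma umx_const (iota : {rmorphism K -> L}) m k (A : 'M[K]_(m, k)) :
  (forall a, c (fun=> a) = iota a) -> umx (fun=> A) = map_mx iota A.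
Proof. by move=> e; apply/matrixP => i j; rewrite !mxE e. Qed.

End UltrapowerMatrices.

Section Tangent.
Variables (K : numClosedFieldType) (n' : nat).
Local Notation n := n'.+1.
Local Notation vec := 'rV[K]_n.
Variable br : vec -> vec -> vec.
Hypothesis lb : is_lie_bracket br.
Hypothesis ss : semisimple br.
Local Notation vcoord := (@vcoord K n).
Local Notation G := (adjoint_group br).
Local Notation e_ i := (delta_mx 0 i : 'rV[K]_n).
Variables (x0 y : vec) (B : 'M[K]_n -> Prop) (P C : 'M[K]_n).
Local Notation O := (orbit_by G x0).
Hypothesis BG : forall g, B g -> G g.
Hypothesis BV : forall g, B g -> B (invmx g).
Hypothesis uP : P \in unitmx.
Hypothesis tB : forall g, B g -> is_trig_mx (P *m g *m invmx P).
Hypothesis Oy : O y.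
Hypothesis dense : zdense_in vcoord O (orbit_by B y).
Hypothesis hC : forall u, is_trig_mx (P *m ad br u *m invmx P) -> y *m ad br u *m C = 0.

(* The ultrapower along the generic ultrafilter contains a copy of the function
   field of [O]; the vector field [w |-> w *m ad br x] acts on it, and the
   action extends to the field generated by the entries of a generic [g]. *)
Theorem tangent_kill u : y *m ad br u *m C = 0.
Proof.
have [U [UU UB UO]] := generic_ultrafilter lb dense.
have [L [c [cD cM c1 cE]]] := ultrapower K UU.
have [iota iE] := ultra_const cD cM c1.
have char0 k : k.+1%:R != 0 :> L by rewrite -(rmorph_nat iota) fmorph_eq0 pnatr_eq0.
have umx_eq m k (f g : 'M[K]_n -> 'M[K]_(m, k)) : (forall h, B h -> f h = g h) -> umx c f = umx c g.
  by move=> fg; apply/matrixP => i j; rewrite !mxE; apply/cE; apply: UB => h /fg ->.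
pose M := umx c id; pose M' := umx c invmx.
have unitB g : B g -> g \in unitmx by move/BG; exact: adjoint_unit.
have MM' : M *m M' = 1%:M.
  rewrite -(umxM cD cM) -(map_mx1 iota) -(umx_const _ iE); apply: umx_eq => g Bg.
  by rewrite mulmxV ?unitB.
have M'M : M' *m M = 1%:M by apply: mulmx1C.
have umap m k l (A : 'M[K]_(m, k)) (f : 'M[K]_n -> 'M_(k, l)) :
    umx c (fun g => A *m f g) = map_mx iota A *m umx c f.
  by rewrite (umxM cD cM) (umx_const _ iE).
have umapr m k l (f : 'M[K]_n -> 'M_(m, k)) (A : 'M[K]_(k, l)) :
    umx c (fun g => f g *m A) = umx c f *m map_mx iota A.
  by rewrite (umxM cD cM) (umx_const _ iE).
have eM i : map_mx iota (ad br (e_ i)) *m M = M *m ad_ext br iota (row i M).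
  have -> : ad_ext br iota (row i M) = umx c (fun g => ad br (e_ i *m g)).
    apply/matrixP => a b; rewrite [RHS]mxE summxE.
    under eq_bigr do rewrite !mxE -iE -cM.
    rewrite -(ultra_sum cD); congr c; apply: funext => g.
    rewrite -rowE [row i g]row_sum_delta (ad_sum lb) summxE; apply: eq_bigr => j _.
    by rewrite (adZ lb) !mxE.
  rewrite -umap -(umxM cD cM); apply: umx_eq => g Bg.
  rewrite (ad_aut lb) ?unitB//; last exact/adjoint_aut/BG.
  by rewrite !mulmxA mulmxV ?unitB// mul1mx.
have trigU f : (forall g, B g -> is_trig_mx (P *m f g *m invmx P)) ->
    is_trig_mx (map_mx iota P *m umx c f *m invmx (map_mx iota P)).
  move=> tf; apply/is_trig_mxP => i j ij; rewrite -map_invmx -umap -umapr mxE.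
  rewrite -(rmorph0 iota) -iE; apply/cE; apply: UB => g /tf/is_trig_mxP; exact.
apply: (ad_ext_kill lb ss hC uP MM' eM) => x nx.
pose ev p g := peval (vcoord (y *m g)) p.
pose dv p g := pderiv p (vcoord (y *m g)) (vcoord (y *m g *m ad br x)).
pose S a := exists p, a = c (ev p).
(* Polynomials in the coordinates that agree in [L] agree on [O], so their tangential derivatives
   agree too. This makes [D] well defined on the image of the coordinate ring. *)
have wd p q : c (ev p) = c (ev q) -> c (dv p) = c (dv q).
  move=> /cE pq; apply/cE; apply: UB => g Bg.
  have := @orbit_tangent _ _ br lb x0 (PAdd p (PMul (PConst _ (-1)) q)) (y *m g) x.
  rewrite /= mul0r add0r mulN1r => e; apply/eqP; rewrite -subr_eq0; apply/eqP; apply: e => //.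
    apply: (UO (PAdd p (PMul (PConst _ (-1)) q))); move: pq; apply: filterS => h /= pq.
    by rewrite mulN1r [X in X - _]pq subrr.
  by apply: (orbit_adjoint Oy); apply: BG.
have [D DE] : {D : L -> L & forall p, D (c (ev p)) = c (dv p)}.
  have [D DP] : {D : L -> L & forall a, S a -> exists p, a = c (ev p) /\ D a = c (dv p)}.
    apply: (@boolp.choice _ _ (fun a d => S a -> exists p, a = c (ev p) /\ d = c (dv p))) => a.
    by have [[p pa]|nS] := pselect (S a); [exists (c (dv p)) => _; exists p | exists 0].
  exists D => p; have [|q [pq ->]] := DP (c (ev p)); first by exists p.
  exact/wd/esym.
have dS : der_on S D.
  split.
  - by exists (PConst _ 1); rewrite -c1.
  - by move=> _ _ [p ->] [q ->]; exists (PAdd p q); rewrite -cD.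
  - move=> _ [p ->]; exists (PMul (PConst _ (-1)) p).
    by rewrite [RHS](cM (fun=> -1) (ev p)) iE rmorphN1 mulN1r.
  - by move=> _ _ [p ->] [q ->]; exists (PMul p q); rewrite -cM.
  - by move=> _ _ [p ->] [q ->]; rewrite !DE -!cD -(DE (PAdd p q)).
  - by move=> _ _ [p ->] [q ->]; rewrite !DE -!cM -cD -(DE (PMul p q)).
pose s := [seq M p.1 p.2 | p : 'I_n * 'I_n].
have [S' [D' [dS' s' SS' DD']]] := extend_seq char0 s dS.
have D'E p : D' (c (ev p)) = c (dv p) by rewrite DD' ?DE//; exists p.
have SM : mxin S' M.
  by move=> i j; apply: s'; apply/mapP; exists (i, j); rewrite ?mem_enum.
have Sc a : S' (iota a) by apply: SS'; exists (PConst _ a); rewrite -iE.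
have Dc a : D' (iota a) = 0.
  by have := D'E (PConst _ a); rewrite /ev /dv /= !iE rmorph0.
have Siota m k (A : 'M[K]_(m, k)) : mxin S' (map_mx iota A) by move=> i j; rewrite mxE.
have Diota m k (A : 'M[K]_(m, k)) : map_mx D' (map_mx iota A) = 0.
  by apply/matrixP => i j; rewrite !mxE.
have Dl m k l (A : 'M[K]_(m, k)) (X : 'M[L]_(k, l)) : mxin S' X ->
    map_mx D' (map_mx iota A *m X) = map_mx iota A *m map_mx D' X.
  by move=> SX; rewrite (mxder_mul dS')// Diota mul0mx add0r.
have Dr m k l (X : 'M[L]_(m, k)) (A : 'M[K]_(k, l)) : mxin S' X ->
    map_mx D' (X *m map_mx iota A) = map_mx D' X *m map_mx iota A.
  by move=> SX; rewrite (mxder_mul dS')// Diota mulmx0 addr0.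
have Dad w : mxin S' w -> map_mx D' (ad_ext br iota w) = ad_ext br iota (map_mx D' w).
  move=> Sw; apply/matrixP => i j; rewrite [LHS]mxE !summxE (der_sum dS').
    apply: eq_bigr => k _; rewrite [X in D' X]mxE [X in _ * X]mxE (derM dS')//.
    by rewrite Dc mulr0 addr0 !mxE.
  by move=> k; rewrite !mxE; apply: (dsubM dS').
have Sad w : mxin S' w -> mxin S' (ad_ext br iota w).
  move=> Sw i j; rewrite summxE; apply: (dsub_sum dS') => k; rewrite !mxE.
  exact: (dsubM dS').
have Srow i : mxin S' (row i M) by move=> a b; rewrite mxE.
(* The logarithmic derivative of the generic element. Differentiating [eM] gives the derivation
   property; entries of the triangular form that are 0 have derivative 0; and [D'] acts on the
   coordinates of [y g] by the vector field. *)
pose V := map_mx D' M; exists (V *m M'); split.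
- move=> i; have := congr1 (map_mx D') (eM i).
  rewrite Dl// (mxder_mul dS')//; last exact: Sad.
  rewrite Dad// -/V map_row => eV.
  have eM' : ad_ext br iota (row i M) *m M' = M' *m map_mx iota (ad br (e_ i)).
    by rewrite -[LHS]mul1mx -M'M -!mulmxA (mulmxA M) -eM -mulmxA MM' mulmx1.
  have eMM w : M *m ad_ext br iota (w *m M) *m M' = ad_ext br iota w.
    rewrite mulmx_sum_row ad_ext_sum mulmx_sumr mulmx_suml; apply: eq_bigr => j _.
    by rewrite -scalemxAr -eM -scalemxAl -mulmxA MM' mulmx1.
  rewrite mulmxA eV mulmxDl -(mulmxA V _ M') eM' (mulmxA V M') [X in X - _]addrAC subrr add0r.
  by rewrite -[row i V]mulmx1 -M'M mulmxA eMM -row_mul subrr.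
- have uP' : map_mx iota P \in unitmx by rewrite map_unitmx.
  rewrite -conj_unitK//; apply: trig_mul; last by apply: trigU => g /BV /tB.
  have /is_trig_mxP tM := trigU id tB; apply/is_trig_mxP => i j /tM.
  rewrite -!map_invmx -Dl// -Dr; last by apply: (mxin_mul dS').
  by rewrite [in X in _ -> X]mxE => ->; apply: (der0 dS').
- have yM : map_mx D' (map_mx iota y *m M) = map_mx iota y *m M *m map_mx iota (ad br x).
    rewrite -umap -umapr; apply/matrixP => i j; rewrite !ord1 !mxE.
    exact: (D'E (PVar _ j)).
  by rewrite mulmxA -Dl// yM.
Qed.

End Tangent.

(** * From dense orbits to complementary subalgebras *)

Section Conormal.
Variables (K : numClosedFieldType) (n' : nat).
Local Notation n := n'.+1.
Local Notation vec := 'rV[K]_n.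
Variable br : vec -> vec -> vec.
Hypothesis lb : is_lie_bracket br.

(** In the triangular basis a bracket of two elements of [b] has zero diagonal, so it is
    Killing-orthogonal to [b]. *)
Lemma trig_subalg P : P \in unitmx -> exists b : 'M[K]_n,
  [/\ lie_subalgebra br b, lie_solvable br b &
      forall u, (u <= b)%MS <-> is_trig_mx (P *m ad br u *m invmx P)].
Proof.
move=> uP; have [||b bP] := @subspace_mx K n (fun u => is_trig_mx (P *m ad br u *m invmx P)).
- by rewrite (ad0 lb) mulmx0 mul0mx; apply/is_trig_mxP => i j _; rewrite mxE.
- move=> a u v /is_trig_mxP tu /is_trig_mxP tv; apply/is_trig_mxP => i j ij.
  rewrite (ad_lin lb) mulmxDr mulmxDl -scalemxAr -scalemxAl mxE [X in X + _]mxE.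
  by rewrite tu// tv// mulr0 addr0.
have com u v : (u <= b)%MS -> (v <= b)%MS ->
    P *m ad br (br u v) *m invmx P = P *m ad br v *m invmx P *m (P *m ad br u *m invmx P) -
      P *m ad br u *m invmx P *m (P *m ad br v *m invmx P).
  by move=> ub vb; rewrite !conj_unitK// (ad_br lb) mulmxBr mulmxBl.
have ab : lie_subalgebra br b.
  move=> u v ub vb; apply/bP; rewrite com//; move: ub vb => /bP tu /bP tv.
  have /is_trig_mxP t1 := trig_mul tv tu; have /is_trig_mxP t2 := trig_mul tu tv.
  by apply/is_trig_mxP => i j ij; rewrite mxE [X in _ + X]mxE t1// t2// subr0.
exists b; split=> //; apply: (cartan_criterion lb ab) => u v ub' vb.
have [||W WP] := @subspace_mx K n (fun u => kf br u v = 0).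
- exact: kf0l.
- by move=> a u1 u2 e1 e2; rewrite (kf_linl lb) e1 e2 mulr0 addr0.
apply/WP; apply: submx_trans ub' _; apply: derived_sub => u1 u2 u1b u2b; apply/WP.
rewrite (kf_trig uP); [|exact/bP/ab|exact/bP].
apply: big1 => i _; rewrite com// trig_comm_diag ?mul0r//; exact/bP.
Qed.

Lemma ker_ad_subalg y : lie_subalgebra br (kermx (ad br y)).
Proof.
move=> u v /sub_kermxP; rewrite (mul_ad lb) => yu /sub_kermxP; rewrite (mul_ad lb) => yv.
by apply/sub_kermxP; rewrite (der_ad lb) !(mul_ad lb) yu yv (br0l lb) (br0r lb) addr0.
Qed.

Lemma spherical_conormal x : semisimple br ->
  spherical br (orbit_by (adjoint_group br) x) ->
  conormal br (orbit_by (adjoint_group br) x).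
Proof.
move=> ss [B [[[BG B1 BM BV] _ cB sB _] [y [Oy dy]]]].
have gB : sl_group B by split=> // g /BG; exact: adjoint_det.
have [P uP tB] := lie_kolchin_trig gB cB sB.
have [b [ab sb bP]] := trig_subalg uP.
have full : (1%:M <= b + kermx (ad br y))%MS.
  (* [tangent_kill] is used with [C] the cokernel of [b *m ad br y]. The factorization [D] obtained
     from this inclusion makes [1 - D *m b] land in the centralizer of [y]. *)
  have sub : (ad br y <= b *m ad br y)%MS.
    rewrite submxE; apply/eqP; apply: mx_ext => v; rewrite mulmx0 mulmxA (mul_ad lb).
    rewrite (brC lb) mulNmx -(mul_ad lb).
    rewrite (tangent_kill lb ss BG BV uP tB Oy dy) ?oppr0// => u /bP/submxP[d ->].
    by rewrite (mul_ad lb) (brC lb) mulNmx -(mul_ad lb) -(mulmxA d b) -mulmxA mulmx_coker mulmx0 oppr0.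
  have /submxP[D yD] := sub.
  rewrite -[1%:M](subrK (D *m b)) addrC addmx_sub_adds ?submxMl//.
  by apply/sub_kermxP; rewrite mulmxBl mul1mx -mulmxA -yD subrr.
have [S [aS dS fS]] := solvable_complement lb ss ab sb (@ker_ad_subalg y) full.
exists y; split=> //; exists S; split=> //; split.
- by rewrite /eqmx submx1 fS.
rewrite sub0mx andbT; apply: row_ext_sub => v; rewrite sub_capmx => /andP[vk vS].
by rewrite (dS _ vk vS) sub0mx.
Qed.

End Conormal.

Theorem theorem3p3 (R : realType) (n : nat)
    (br : 'rV[R[i]]_n -> 'rV[R[i]]_n -> 'rV[R[i]]_n) :
  is_lie_bracket br -> semisimple br ->
  forall x : 'rV[R[i]]_n, ad_nilpotent br x ->
  spherical br (orbit_by (adjoint_group br) x) ->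
  conormal br (orbit_by (adjoint_group br) x).
Proof.
(* Dimension 0 is treated apart, with [S = 0], because the main argument works in matrix rings of
   successor size. *)
case: n br => [|n] br lb ss x _; last exact: spherical_conormal.
move=> _; exists x; split.
  by exists 1%:M; split; [exists [::]; rewrite big_nil | rewrite mulmx1].
exists 0; split; first by move=> u v _ _; rewrite (thinmx0 (br u v)) sub0mx.
by split; rewrite !flatmx0 !submx_refl.
Qed.
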